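(* Let $k\ge2$ be an integer, $\rho\in(0,1)$, and let $D\subset\mathbb R^2$ be a polygon of diameter $h_D$ that is shape regular with parameter $\rho$. Let $\Pi^0_{k,D}$ be the $L^2(D)$-orthogonal projection onto $\mathbb P_k(D)$. Then there is a constant $C$ depending only on $k$ and $\rho$ such that $$|\Pi^0_{k,D}\xi|_{H^2(D)}\le C|\xi|_{H^2(D)}\qquad\text{for all }\xi\in H^2(D),$$ and, for every integer $l$ with $1\le l\le k$, $$|\xi-\Pi^0_{k,D}\xi|_{H^2(D)}\le C h_D^{l-1}|\xi|_{H^{l+1}(D)}\qquad\text{for all }\xi\in H^{l+1}(D).$$
   Context: Shape regularity with parameter $\rho$: every edge $e$ of $D$ has length $|e|\ge\rho h_D$, and $D$ is star shaped with respect to a disc of radius $\rho h_D$. $\mathbb P_k(D)$ is the space of (restrictions to $D$ of) polynomials of total degree $\le k$. *)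

(* Defs.v *)
From HB Require Import structures.
From mathcomp Require Import all_boot all_order all_algebra.
From mathcomp Require Import all_classical all_reals all_analysis.

Set Implicit Arguments.
Unset Strict Implicit.
Unset Printing Implicit Defensive.

Import Order.TTheory GRing.Theory Num.Theory.
Import numFieldNormedType.Exports.

Local Open Scope classical_set_scope.
Local Open Scope ring_scope.

Section Geometry.
Context {R : realType}.
Implicit Types (D : set (R * R)) (x y z : R * R).

(* The library norm on [R * R] is the max norm, hence an explicit Euclidean
   distance. *)
Definition edist x y : R :=
  Num.sqrt ((x.1 - y.1) ^+ 2 + (x.2 - y.2) ^+ 2).

Definition segment x y : set (R * R) :=
  [set ((1 - t) * x.1 + t * y.1, (1 - t) * x.2 + t * y.2) | t in `[0, 1]].

Definition diameter D : R := sup [set edist p.1 p.2 | p in D `*` D].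

Definition disc (c : R * R) (r : R) : set (R * R) := [set x | edist c x < r].

Definition edge n (v : 'I_n -> R * R) (i : 'I_n) : set (R * R) :=
  segment (v i) (v (ordS i)).

(* The closed polygonal chain through the vertices v_0, ..., v_{n-1}, v_0 is
   simple: two distinct edges meet at most in a common endpoint. *)
Definition simple_polygon n (v : 'I_n -> R * R) : Prop :=
  [/\ (2 < n)%N, injective v &
      forall i j, i != j ->
        edge v i `&` edge v j `<=`
        [set v i; v (ordS i)] `&` [set v j; v (ordS j)]].

(* [D] is the region enclosed by the chain, as an open set: a bounded domain
   whose topological boundary is the union of the edges.  Two consecutive edges
   may be aligned. *)
Definition polygon n (v : 'I_n -> R * R) D : Prop :=
  [/\ simple_polygon v, D !=set0, open D, connected D &
      bounded_set D /\ closure D `\` D = \bigcup_i edge v i].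

Definition star_shaped D (B : set (R * R)) : Prop :=
  forall x b, D x -> B b -> segment x b `<=` D.

(* [D] is open, so it is the open disc that has to be contained in [D]; the
   closed region is then star shaped with respect to the closed disc. *)
Definition shape_regular (rho : R) n (v : 'I_n -> R * R) D : Prop :=
  (forall i, rho * diameter D <= edist (v i) (v (ordS i))) /\
  exists c, star_shaped D (disc c (rho * diameter D)).

End Geometry.

Section Sobolev.
Context {R : realType}.
Implicit Types (D : set (R * R)) (u g phi : R * R -> R).

Definition leb2 := (@lebesgue_measure R \x @lebesgue_measure R)%E.

Definition D1 phi : R * R -> R := 'D_(1, 0) phi.
Definition D2 phi : R * R -> R := 'D_(0, 1) phi.
Definition partial (i j : nat) phi : R * R -> R := iter i D1 (iter j D2 phi).

(* Continuously differentiable up to order [n]. *)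
Fixpoint Cn (n : nat) phi : Prop :=
  if n is m.+1 then
    [/\ forall z, derivable phi z (1, 0), forall z, derivable phi z (0, 1),
        Cn m (D1 phi) & Cn m (D2 phi)]
  else continuous phi.

Definition test_function D phi : Prop :=
  [/\ forall n, Cn n phi, compact (closure [set z | phi z != 0]) &
      closure [set z | phi z != 0] `<=` D].

(* Functions on [D] are represented by functions on the whole plane; their
   values outside [D] are irrelevant. *)
Definition L2 D u : Prop := u \_ D \in Lfun leb2 2%:E.

Definition L2ip D u g : R := Rintegral leb2 D (fun z => u z * g z).

Definition weak_partial_of D (i j : nat) u g : Prop :=
  L2 D g /\
  forall phi, test_function D phi ->
    L2ip D u (partial i j phi) = (-1) ^+ (i + j) * L2ip D g phi.

Definition Sobolev (m : nat) D u : Prop :=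
  L2 D u /\
  forall i j, (i + j <= m)%N -> exists g, weak_partial_of D i j u g.

(* The weak derivative is unique up to a null set; [xget] picks a
   representative (the default [0] is irrelevant for functions having the weak
   derivative). *)
Definition weak_partial D (i j : nat) u : R * R -> R :=
  xget (cst 0) [set g | weak_partial_of D i j u g].

Definition Sobolev_seminorm (m : nat) D u : R :=
  Num.sqrt (\sum_(i < m.+1)
    L2ip D (weak_partial D i (m - i) u) (weak_partial D i (m - i) u)).

Definition polyfun (k : nat) : set (R * R -> R) :=
  [set p | exists c : nat -> nat -> R, forall z,
    p z = \sum_(i < k.+1) \sum_(j < k.+1 | (i + j <= k)%N)
            c i j * z.1 ^+ i * z.2 ^+ j].

(* The orthogonal projection onto polynomials of degree at most [k], as a
   polynomial function on the whole plane. *)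
Definition L2proj (k : nat) D u : R * R -> R :=
  xget (cst 0) [set p | polyfun k p /\
    forall q, polyfun k q -> L2ip D (u \- p) q = 0].

End Sobolev.

(* Main.v *)
Require Import Defs.
From HB Require Import structures.
From mathcomp Require Import all_boot all_order all_algebra.
From mathcomp Require Import all_classical all_reals all_analysis.
From mathcomp Require Import measurable_realfun.
From mathcomp Require Import ring lra.

Set Implicit Arguments.
Unset Strict Implicit.
Unset Printing Implicit Defensive.

Import Order.TTheory GRing.Theory Num.Theory.
Import numFieldNormedType.Exports.

Local Open Scope classical_set_scope.
Local Open Scope ring_scope.

(* Let h be the diameter of D and theta a smooth probability density supported in the disc of
   radius rho h.  Poincare's inequality ||w|| <= C h ||grad w|| for w of theta-mean zero is obtained
   by duality with test functions f: contracting the density f towards a point a of the disc by a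
   factor 2 changes the integral of w f by at most h ||grad w|| ||f||, and averaging over a with
   weight theta makes the roles of f and theta symmetric.  Choosing q of degree at most l such
   that every derivative of xi - q of order at most l has theta-mean zero and iterating Poincare's
   inequality gives the Bramble-Hilbert estimate for xi - q.  Finally, Pi xi - q = Pi (xi - q) is
   bounded in L2 by xi - q, hence in H2 by the inverse inequality, which follows by scaling from
   a bound on the unit square.  The first estimate is the case l = 1, where the second derivatives
   of q vanish. *)

(** The constant has to be uniform over all polygons with the same [rho], so arguments by
    compactness are replaced by explicit estimates in terms of the diameter and of the disc of
    radius [rho * h]. A function of H^m has only weak derivatives, that is, identities against test
    functions. This is why the transport in Poincare's inequality moves the test function and never
    [w]: conservation of mass makes the derivative of the transported density a divergence of test
    functions, to which the definition of a weak derivative applies directly. Density of the test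
    functions in L2 converts the dual bound into a norm, and also gives the uniqueness of weak
    derivatives. The contraction stops at the factor 2. Going on to a point would compare with a
    value [w a], meaningless in L2, and in the plane the bound on the rate of change does not decay
    as the contraction proceeds, so the total cost would be infinite. At the factor 2 the image of x
    is the midpoint of x and a, an expression symmetric in both. *)

(** * Smooth functions of two variables through their derivatives along the axes *)

Section CoordinateCalculus.
Context {R : realType}.
Implicit Types (f g phi : R * R -> R) (z : R * R).

(** Both difference quotients are the same function of the increment, so one-variable rules apply to
    slices. *)
Lemma is_derive1_coord f z d :
  is_derive z (1, 0) f d <-> is_derive z.1 1 (fun x => f (x, z.2)) d.
Proof.
have E : (fun h : R => h^-1 *: ((f \o shift z) (h *: (1, 0)) - f z)) =
  (fun h : R => h^-1 *: (((fun x => f (x, z.2)) \o shift z.1) (h *: 1) - f (z.1, z.2))).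
  apply/funext => h; rewrite /= -surjective_pairing.
  congr (_ *: (f _ - _)); rewrite [RHS]surjective_pairing /=.
  by rewrite [LHS]surjective_pairing /= scaler0 add0r.
by split => -[d1 d2]; constructor; rewrite /derivable /derive ?E// -?E.
Qed.

Lemma is_derive2_coord f z d :
  is_derive z (0, 1) f d <-> is_derive z.2 1 (fun y => f (z.1, y)) d.
Proof.
have E : (fun h : R => h^-1 *: ((f \o shift z) (h *: (0, 1)) - f z)) =
  (fun h : R => h^-1 *: (((fun y => f (z.1, y)) \o shift z.2) (h *: 1) - f (z.1, z.2))).
  apply/funext => h; rewrite /= -surjective_pairing.
  congr (_ *: (f _ - _)); rewrite [RHS]surjective_pairing /=.
  by rewrite [LHS]surjective_pairing /= scaler0 add0r.
by split => -[d1 d2]; constructor; rewrite /derivable /derive ?E// -?E.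
Qed.

Lemma D1_is_derive f f1 : (forall z, is_derive z (1, 0) f (f1 z)) -> D1 f = f1.
Proof. by move=> h; apply/funext => z; rewrite /D1; case: (h z). Qed.

Lemma D2_is_derive f f2 : (forall z, is_derive z (0, 1) f (f2 z)) -> D2 f = f2.
Proof. by move=> h; apply/funext => z; rewrite /D2; case: (h z). Qed.

Lemma CnS_is_derive n f f1 f2 :
  (forall z, is_derive z (1, 0) f (f1 z)) ->
  (forall z, is_derive z (0, 1) f (f2 z)) ->
  Cn n f1 -> Cn n f2 -> Cn n.+1 f.
Proof.
move=> h1 h2 c1 c2; split.
- by move=> z; case: (h1 z).
- by move=> z; case: (h2 z).
- by rewrite (D1_is_derive h1).
- by rewrite (D2_is_derive h2).
Qed.

Lemma CnS_is_derive1 n f : Cn n.+1 f -> forall z, is_derive z (1, 0) f (D1 f z).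
Proof. by move=> [h _ _ _] z; apply: derivableP. Qed.

Lemma CnS_is_derive2 n f : Cn n.+1 f -> forall z, is_derive z (0, 1) f (D2 f z).
Proof. by move=> [_ h _ _] z; apply: derivableP. Qed.

Definition Cinf f := forall n, Cn n f.

Lemma Cinf_continuous f : Cinf f -> continuous f.
Proof. by move/(_ 0%N). Qed.

Lemma Cinf_D1 f : Cinf f -> Cinf (D1 f).
Proof. by move=> h n; case: (h n.+1). Qed.

Lemma Cinf_D2 f : Cinf f -> Cinf (D2 f).
Proof. by move=> h n; case: (h n.+1). Qed.

Lemma Cinf_is_derive1 f : Cinf f -> forall z, is_derive z (1, 0) f (D1 f z).
Proof. by move/(_ 1%N)/CnS_is_derive1. Qed.

Lemma Cinf_is_derive2 f : Cinf f -> forall z, is_derive z (0, 1) f (D2 f z).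
Proof. by move/(_ 1%N)/CnS_is_derive2. Qed.

Lemma Cinf_partial i j f : Cinf f -> Cinf (partial i j f).
Proof.
move=> hf; rewrite /partial; elim: i => [|i IH] /=; last exact: Cinf_D1.
by elim: j => [//|j IH] /=; exact: Cinf_D2.
Qed.

Lemma Cn_cst n (c : R) : Cn n (fun _ : R * R => c).
Proof.
elim: n c => [|n IH] c; first by move=> z; exact: cvg_cst.
apply: (@CnS_is_derive _ _ (fun=> 0) (fun=> 0)) => // z; exact: is_derive_cst.
Qed.

Lemma CnD n f g : Cn n f -> Cn n g -> Cn n (fun z => f z + g z).
Proof.
elim: n f g => [|n IH] f g; first by move=> cf cg z; apply: continuousD; [exact: cf|exact: cg].
move=> cf cg.
apply: (@CnS_is_derive _ _ (fun z => D1 f z + D1 g z) (fun z => D2 f z + D2 g z)).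
- by move=> z; apply: is_deriveD; apply: CnS_is_derive1 => //; eassumption.
- by move=> z; apply: is_deriveD; apply: CnS_is_derive2 => //; eassumption.
- by case: cf => _ _ ? _; case: cg => _ _ ? _; apply: IH.
- by case: cf => _ _ _ ?; case: cg => _ _ _ ?; apply: IH.
Qed.

Lemma is_deriveM_fun f g z v df dg : is_derive z v f df -> is_derive z v g dg ->
  is_derive z v (fun z => f z * g z) (df * g z + f z * dg).
Proof.
move=> hf hg; apply: (@is_derive_eq _ _ _ _ _ _ _ _ (is_deriveM hf hg)).
by rewrite addrC /GRing.scale /= [df * _]mulrC.
Qed.

Lemma D1M f g : Cinf f -> Cinf g ->
  D1 (fun z => f z * g z) = fun z => D1 f z * g z + f z * D1 g z.
Proof.
by move=> hf hg; apply: D1_is_derive => z; apply: is_deriveM_fun; exact: Cinf_is_derive1.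
Qed.

Lemma D2M f g : Cinf f -> Cinf g ->
  D2 (fun z => f z * g z) = fun z => D2 f z * g z + f z * D2 g z.
Proof.
by move=> hf hg; apply: D2_is_derive => z; apply: is_deriveM_fun; exact: Cinf_is_derive2.
Qed.

Lemma D1D f g : Cinf f -> Cinf g ->
  D1 (fun z => f z + g z) = fun z => D1 f z + D1 g z.
Proof.
by move=> hf hg; apply: D1_is_derive => z; apply: is_deriveD; exact: Cinf_is_derive1.
Qed.

Lemma D2D f g : Cinf f -> Cinf g ->
  D2 (fun z => f z + g z) = fun z => D2 f z + D2 g z.
Proof.
by move=> hf hg; apply: D2_is_derive => z; apply: is_deriveD; exact: Cinf_is_derive2.
Qed.

Lemma Cinf_cst (c : R) : Cinf (fun=> c).
Proof. by move=> n; exact: Cn_cst. Qed.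

Lemma CinfD f g : Cinf f -> Cinf g -> Cinf (fun z => f z + g z).
Proof. by move=> hf hg n; exact: CnD. Qed.

(** With both factors in [Cinf], the induction never has to weaken a factor from [Cn n.+1] to
    [Cn n]. *)
Lemma CinfM f g : Cinf f -> Cinf g -> Cinf (fun z => f z * g z).
Proof.
move=> hf hg n; elim: n f g hf hg => [|n IH] f g hf hg.
  by move=> z; apply: continuousM; exact: Cinf_continuous.
apply: (@CnS_is_derive _ _ (fun z => D1 f z * g z + f z * D1 g z)
                          (fun z => D2 f z * g z + f z * D2 g z)).
- by move=> z; apply: is_deriveM_fun; exact: Cinf_is_derive1.
- by move=> z; apply: is_deriveM_fun; exact: Cinf_is_derive2.
- by apply: CnD; apply: IH => //; exact: Cinf_D1.
- by apply: CnD; apply: IH => //; exact: Cinf_D2.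
Qed.

Lemma CinfZ (c : R) f : Cinf f -> Cinf (fun z => c * f z).
Proof. by move=> hf; apply: CinfM => //; exact: Cinf_cst. Qed.

Lemma D1Z (c : R) f : Cinf f -> D1 (fun z => c * f z) = fun z => c * D1 f z.
Proof.
move=> hf; rewrite (D1M (Cinf_cst c) hf); apply/funext => z.
by rewrite (D1_is_derive (f1 := fun=> 0)) ?mul0r ?add0r// => ?; exact: is_derive_cst.
Qed.

Lemma D2Z (c : R) f : Cinf f -> D2 (fun z => c * f z) = fun z => c * D2 f z.
Proof.
move=> hf; rewrite (D2M (Cinf_cst c) hf); apply/funext => z.
by rewrite (D2_is_derive (f2 := fun=> 0)) ?mul0r ?add0r// => ?; exact: is_derive_cst.
Qed.

Lemma Cinf_sum (I : Type) (s : seq I) (P : pred I) (F : I -> R * R -> R) :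
  (forall i, P i -> Cinf (F i)) -> Cinf (fun z => \sum_(i <- s | P i) F i z).
Proof.
move=> hF; elim: s => [|i s IH].
  by rewrite (_ : (fun _ => _) = fun=> 0) //; [exact: Cinf_cst|apply/funext => z; rewrite big_nil].
case Pi: (P i).
  rewrite (_ : (fun _ => _) = fun z => F i z + \sum_(i <- s | P i) F i z).
    by apply: CinfD => //; exact: hF.
  by apply/funext => z; rewrite big_cons Pi.
by rewrite (_ : (fun _ => _) = fun z => \sum_(i <- s | P i) F i z)//; apply/funext => z; rewrite big_cons Pi.
Qed.

(** All successive derivatives are given at once as a sequence, which the induction shifts by
    one. *)
Lemma Cn_coord1 n (h : nat -> R -> R) :
  (forall m (x : R), is_derive x 1 (h m) (h m.+1 x)) -> Cn n (fun z => h 0%N z.1).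
Proof.
move=> hh; elim: n h hh => [|n IH] h hh.
  move=> z; apply: (@continuous_comp _ _ _ fst (h 0%N)); first exact: cvg_fst.
  by apply/differentiable_continuous/derivable1_diffP; case: (hh 0%N z.1).
apply: (@CnS_is_derive _ _ (fun z => h 1%N z.1) (fun=> 0)).
- by move=> z; apply/is_derive1_coord => /=; exact: hh.
- by move=> z; apply/is_derive2_coord => /=; exact: is_derive_cst.
- by apply: (IH (fun m => h m.+1)).
- exact: Cn_cst.
Qed.

Lemma Cn_coord2 n (h : nat -> R -> R) :
  (forall m (x : R), is_derive x 1 (h m) (h m.+1 x)) -> Cn n (fun z => h 0%N z.2).
Proof.
move=> hh; elim: n h hh => [|n IH] h hh.
  move=> z; apply: (@continuous_comp _ _ _ snd (h 0%N)); first exact: cvg_snd.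
  by apply/differentiable_continuous/derivable1_diffP; case: (hh 0%N z.2).
apply: (@CnS_is_derive _ _ (fun=> 0) (fun z => h 1%N z.2)).
- by move=> z; apply/is_derive1_coord => /=; exact: is_derive_cst.
- by move=> z; apply/is_derive2_coord => /=; exact: hh.
- exact: Cn_cst.
- by apply: (IH (fun m => h m.+1)).
Qed.

Lemma is_derive_fst z : is_derive z (1, 0) (fst : R * R -> R) 1.
Proof. by apply/is_derive1_coord; exact: is_derive_id. Qed.
Lemma is_derive_snd z : is_derive z (0, 1) (snd : R * R -> R) 1.
Proof. by apply/is_derive2_coord; exact: is_derive_id. Qed.
Lemma is_derive2_fst z : is_derive z (0, 1) (fst : R * R -> R) 0.
Proof. by apply/is_derive2_coord; exact: is_derive_cst. Qed.
Lemma is_derive1_snd z : is_derive z (1, 0) (snd : R * R -> R) 0.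
Proof. by apply/is_derive1_coord; exact: is_derive_cst. Qed.

Lemma Cinf_fst : Cinf fst.
Proof.
case=> [|n]; first by move=> z; exact: cvg_fst.
apply: (CnS_is_derive is_derive_fst is_derive2_fst); exact: Cn_cst.
Qed.

Lemma Cinf_snd : Cinf snd.
Proof.
case=> [|n]; first by move=> z; exact: cvg_snd.
apply: (CnS_is_derive is_derive1_snd is_derive_snd); exact: Cn_cst.
Qed.

(** Here [a] is the image of the origin, not the fixed point; [push_center] converts from a
    center. *)
Definition homothety (a : R * R) (s : R) z := (a.1 + s * z.1, a.2 + s * z.2).

Lemma continuous_pair (T : topologicalType) (g h : T -> R) (t : T) :
  {for t, continuous g} -> {for t, continuous h} ->
  {for t, continuous (fun s => (g s, h s))}.
Proof. by move=> cg ch; exact: (cvg_pair cg ch). Qed.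

Lemma homothety_continuous a s : continuous (homothety a s).
Proof.
move=> z.
apply: (@continuous_pair _ (fun z => a.1 + s * z.1) (fun z => a.2 + s * z.2)).
  by apply: cvgD; [exact: cvg_cst|apply: cvgM; [exact: cvg_cst|exact: cvg_fst]].
by apply: cvgD; [exact: cvg_cst|apply: cvgM; [exact: cvg_cst|exact: cvg_snd]].
Qed.

Lemma is_derive_affine (a s x : R) : is_derive x 1 (fun x => a + s * x) s.
Proof.
have := is_deriveD (is_derive_cst a x 1) (is_deriveZ s (is_derive_id x 1)).
by rewrite add0r /GRing.scale /= mulr1.
Qed.

Lemma is_derive1_homothety a s f z d : is_derive (homothety a s z) (1, 0) f d ->
  is_derive z (1, 0) (f \o homothety a s) (s * d).
Proof.
move/is_derive1_coord => h; apply/is_derive1_coord => /=.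
rewrite mulrC.
exact: (@is_derive1_comp _ (fun x => f (x, a.2 + s * z.2)) (fun x => a.1 + s * x) z.1 _ _ h (is_derive_affine a.1 s z.1)).
Qed.

Lemma is_derive2_homothety a s f z d : is_derive (homothety a s z) (0, 1) f d ->
  is_derive z (0, 1) (f \o homothety a s) (s * d).
Proof.
move/is_derive2_coord => h; apply/is_derive2_coord => /=.
rewrite mulrC.
exact: (@is_derive1_comp _ (fun x => f (a.1 + s * z.1, x)) (fun x => a.2 + s * x) z.2 _ _ h (is_derive_affine a.2 s z.2)).
Qed.

Lemma CnZ n (c : R) f : Cn n f -> Cn n (fun z => c * f z).
Proof.
elim: n f => [|n IH] f cf.
  by move=> z; apply: continuousM; [exact: cvg_cst|exact: cf].
have [_ _ c1 c2] := cf.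
apply: (@CnS_is_derive _ _ (fun z => c * D1 f z) (fun z => c * D2 f z)).
- by move=> z; apply: is_deriveZ; apply: CnS_is_derive1 cf z.
- by move=> z; apply: is_deriveZ; apply: CnS_is_derive2 cf z.
- exact: IH.
- exact: IH.
Qed.

Lemma Cinf_homothety a s f : Cinf f -> Cinf (f \o homothety a s).
Proof.
move=> hf n; elim: n f hf => [|n IH] f hf.
  move=> z; apply: continuous_comp; first exact: homothety_continuous.
  exact: Cinf_continuous.
apply: (@CnS_is_derive _ _ (fun z => s * (D1 f \o homothety a s) z) (fun z => s * (D2 f \o homothety a s) z)).
- by move=> z; apply: is_derive1_homothety; exact: Cinf_is_derive1.
- by move=> z; apply: is_derive2_homothety; exact: Cinf_is_derive2.
- by apply: CnZ; apply: IH; exact: Cinf_D1.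
- by apply: CnZ; apply: IH; exact: Cinf_D2.
Qed.

Lemma D1_homothety a s f : Cinf f ->
  D1 (f \o homothety a s) = fun z => s * D1 f (homothety a s z).
Proof.
by move=> hf; apply: D1_is_derive => z; apply: is_derive1_homothety; exact: Cinf_is_derive1.
Qed.

Lemma D2_homothety a s f : Cinf f ->
  D2 (f \o homothety a s) = fun z => s * D2 f (homothety a s z).
Proof.
by move=> hf; apply: D2_is_derive => z; apply: is_derive2_homothety; exact: Cinf_is_derive2.
Qed.

Lemma is_derive_cvg (F : R -> R) (t d : R) :
  is_derive t 1 F d <-> (fun h : R => h^-1 * (F (h + t) - F t)) @ 0^' --> d.
Proof.
have E : (fun h : R => h^-1 *: ((F \o shift t) (h *: 1) - F t)) =
    (fun h : R => h^-1 * (F (h + t) - F t)).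
  by apply/funext => h /=; rewrite /GRing.scale /= mulr1.
split=> [[] | h].
  by rewrite /derivable /derive E => dF <-.
constructor; first by rewrite /derivable E; apply/cvg_ex; exists d.
by rewrite /derive E; apply/cvg_lim.
Qed.

(** The points [a] and [b] come in either order, and [c] is located by its distance to [a]: a
    squeeze then sends [c] to [a] when [b] tends to [a]. *)
Lemma MVT_between (u du : R -> R) (a b : R) :
  (forall x : R, is_derive x 1 u (du x)) ->
  exists c, `|c - a| <= `|b - a| /\ u b - u a = du c * (b - a).
Proof.
move=> hu.
have cu x y : {within `[x, y], continuous u}.
  apply: continuous_subspaceT => w.
  by apply/differentiable_continuous/derivable1_diffP; case: (hu w).
have [ab|/ltW ba] := leP a b.
  have [c] := @MVT_segment _ u du a b ab (fun x _ => hu x) (cu _ _).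
  rewrite in_itv /= => /andP[h1 h2] ->; exists c; split => //.
  by rewrite !ger0_norm ?subr_ge0// lerB.
have [c] := @MVT_segment _ u du b a ba (fun x _ => hu x) (cu _ _).
rewrite in_itv /= => /andP[h1 h2] E; exists c; split.
  by rewrite !ler0_norm ?subr_le0// !opprB lerB.
by rewrite -opprB E -mulrN opprB.
Qed.

Lemma cvg_dist_le (T : Type) (F : set_system T) (s u : T -> R) (l m : R) :
  Filter F -> (forall x, `|s x - l| <= `|u x - m|) -> u @ F --> m -> s @ F --> l.
Proof.
move=> FF h /cvgrPdist_lt hu; apply/cvgrPdist_lt => e e0.
move: (hu e e0); apply: filterS => x; rewrite distrC [`|l - _|]distrC.
exact: le_lt_trans.
Qed.

Lemma cvg_pair_coord (T : Type) (F : set_system T) (r : T -> R * R) (z : R * R) :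
  Filter F -> (r x).1 @[x --> F] --> z.1 -> (r x).2 @[x --> F] --> z.2 ->
  r @ F --> z.
Proof.
case: z => a b FF /= h1 h2.
have -> : r = fun x => ((r x).1, (r x).2).
  by apply/funext => x; rewrite -surjective_pairing.
exact: (cvg_pair h1 h2).
Qed.

(** The increment is split into a horizontal step, treated by the mean value theorem and the
    continuity of [D1 f], and a vertical step, which is the one-variable chain rule. This avoids
    total differentiability. *)
Lemma is_derive_path f (g h : R -> R) (t g' h' : R) : Cn 1 f ->
  is_derive t 1 g g' -> is_derive t 1 h h' ->
  is_derive t 1 (fun s => f (g s, h s)) (D1 f (g t, h t) * g' + D2 f (g t, h t) * h').
Proof.
move=> cf hg hh; have [_ _ c1 c2] := cf.
have f1 := CnS_is_derive1 cf; have f2 := CnS_is_derive2 cf.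
have B : is_derive t 1 (fun s => f (g t, h s)) (D2 f (g t, h t) * h').
  apply: (@is_derive1_comp _ (fun y => f (g t, y)) h) => //.
  by have /is_derive2_coord := f2 (g t, h t).
have /choice[c hc] (e : R) : exists c, `|c - g t| <= `|g (e + t) - g t| /\
    f (g (e + t), h (e + t)) - f (g t, h (e + t)) =
    D1 f (c, h (e + t)) * (g (e + t) - g t).
  apply: (@MVT_between (fun x => f (x, h (e + t))) (fun x => D1 f (x, h (e + t)))) => x.
  by have /is_derive1_coord := f1 (x, h (e + t)).
have sh (k : R -> R) k' : is_derive t 1 k k' -> k (e + t) @[e --> 0^'] --> k t.
  move=> hk; have ck : {for t, continuous k}.
    by apply/differentiable_continuous/derivable1_diffP; case: hk.
  have et : e + t @[e --> (0 : R)^'] --> t.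
    rewrite -{2}[t]add0r; apply: cvgD; last exact: cvg_cst.
    exact: nbhs_dnbhs.
  exact: (cvg_comp _ _ et ck).
apply/is_derive_cvg.
have -> : (fun e => e^-1 * (f (g (e + t), h (e + t)) - f (g t, h t))) =
  (fun e => D1 f (c e, h (e + t)) * (e^-1 * (g (e + t) - g t)) +
            e^-1 * (f (g t, h (e + t)) - f (g t, h t))).
  apply/funext => e; have [_ E] := hc e.
  by rewrite mulrCA -E -mulrDr addrA subrK.
apply: cvgD; last by move/is_derive_cvg : B.
apply: cvgM; last by move/is_derive_cvg : hg.
have cc : c e @[e --> 0^'] --> g t.
  apply: (@cvg_dist_le _ _ c (fun e => g (e + t)) (g t) (g t)) (sh _ _ hg) => e.
  by case: (hc e).
have ch : (c e, h (e + t)) @[e --> 0^'] --> (g t, h t).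
  by apply: cvg_pair_coord => //=; exact: sh hh.
exact: (cvg_comp _ _ ch (c1 (g t, h t))).
Qed.

(** The second difference of [f] over a small square with corner [z] is a mean value of either mixed
    derivative, depending on the order of the two differences. *)
Lemma schwarz f : Cn 2 f -> D1 (D2 f) = D2 (D1 f).
Proof.
move=> cf; apply/funext => z.
have [_ _ c1 c2] := cf.
have f1 := CnS_is_derive1 cf; have f2 := CnS_is_derive2 cf.
have f12 := @CnS_is_derive2 0%N _ c1; have f21 := @CnS_is_derive1 0%N _ c2.
have [_ _ _ k12] := c1; have [_ _ k21 _] := c2.
(* The square has side [1/(n+1)]; [p] and [q] are the points produced by the two orders of
   differencing. *)
have H (n : nat) : exists p q : R * R, [/\ `|p.1 - z.1| <= n.+1%:R^-1, `|p.2 - z.2| <= n.+1%:R^-1,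
    `|q.1 - z.1| <= n.+1%:R^-1, `|q.2 - z.2| <= n.+1%:R^-1 & D2 (D1 f) p = D1 (D2 f) q].
  set h : R := n.+1%:R^-1; have h0 : 0 < h by rewrite invr_gt0.
  have hN : `|h| = h by rewrite gtr0_norm.
  have [x [x1 x2]] := @MVT_between (fun s => f (s, z.2 + h) - f (s, z.2))
    (fun s => D1 f (s, z.2 + h) - D1 f (s, z.2)) z.1 (z.1 + h)
    (fun s => is_deriveB ((is_derive1_coord _ _ _).1 (f1 (s, z.2 + h)))
                         ((is_derive1_coord _ _ _).1 (f1 (s, z.2)))).
  have [y [y1 y2]] := @MVT_between (fun s => D1 f (x, s)) (fun s => D2 (D1 f) (x, s)) z.2 (z.2 + h)
     (fun s => (is_derive2_coord _ _ _).1 (f12 (x, s))).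
  have [y' [y'1 y'2]] := @MVT_between (fun s => f (z.1 + h, s) - f (z.1, s))
    (fun s => D2 f (z.1 + h, s) - D2 f (z.1, s)) z.2 (z.2 + h)
    (fun s => is_deriveB ((is_derive2_coord _ _ _).1 (f2 (z.1 + h, s)))
                         ((is_derive2_coord _ _ _).1 (f2 (z.1, s)))).
  have [x' [x'1 x'2]] := @MVT_between (fun s => D2 f (s, y')) (fun s => D1 (D2 f) (s, y')) z.1 (z.1 + h)
     (fun s => (is_derive1_coord _ _ _).1 (f21 (s, y'))).
  exists (x, y), (x', y'); move: x1 y1 x'1 y'1; rewrite ![_ + h - _]addrC !addKr hN => x1 y1 x'1 y'1.
  split; [exact: x1|exact: y1|exact: x'1|exact: y'1|].
  move: x2 y'2; rewrite y2 x'2 ![_ + h - _]addrC !addKr => E1 E2.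
  apply: (mulIf (lt0r_neq0 h0)); apply: (mulIf (lt0r_neq0 h0)).
  apply: (etrans (esym E1)); apply: etrans E2.
  move: (f (z.1 + h, z.2 + h)) (f (z.1 + h, z.2)) (f (z.1, z.2 + h)) (f (z.1, z.2)) => a b c d.
  by rewrite !opprD !opprK !addrA [a - b - c]addrAC.
have [p /choice[q pq]] := choice H.
have cz (r : nat -> R * R) : (forall n, `|(r n).1 - z.1| <= n.+1%:R^-1) ->
    (forall n, `|(r n).2 - z.2| <= n.+1%:R^-1) -> r n @[n --> \oo] --> z.
  have sq (s : nat -> R) l : (forall n, `|s n - l| <= n.+1%:R^-1) -> s n @[n --> \oo] --> l.
    move=> hs; apply: cvg_dist_le (@cvg_harmonic R) => n.
    by rewrite subr0 [X in _ <= X]ger0_norm ?harmonic_ge0.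
  by move=> /sq h1 /sq h2; exact: cvg_pair_coord.
have pz : p n @[n --> \oo] --> z by apply: cz => n; case: (pq n).
have qz : q n @[n --> \oo] --> z by apply: cz => n; case: (pq n).
have A := cvg_comp _ _ pz (k12 z); have B := cvg_comp _ _ qz (k21 z).
have E : D2 (D1 f) \o p = D1 (D2 f) \o q.
  by apply/funext => n; case: (pq n) => _ _ _ _; exact.
rewrite E in A; exact: (cvg_unique _ B A).
Qed.

End CoordinateCalculus.

(** * Planar Lebesgue measure: homotheties, and open sets as countable unions of boxes *)

HB.instance Definition _ (R : realType) := Measure.on (@leb2 R).

Section PlaneMeasure.
Context {R : realType}.
Local Notation mR := (measurableTypeR R).
Local Notation plane := (mR * mR)%type.
Implicit Types (a : R * R) (s : R).

Lemma measurable_affine (a s : R) :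
  measurable_fun [set: mR] (fun x : mR => a + s * x : mR).
Proof.
apply: continuous_measurable_fun => x.
by apply: cvgD; [exact: cvg_cst|apply: cvgM; [exact: cvg_cst|exact: cvg_id]].
Qed.

(** Both sides are measures in [X], so it suffices to compare them on half-open intervals. *)
Lemma lebesgue_measure_affine (a s : R) (X : set mR) : s != 0 -> measurable X ->
  lebesgue_measure X = (`|s|%:E * lebesgue_measure ((fun x => a + s * x)%R @^-1` X))%E.
Proof.
move=> s0 mX.
pose f := fun x : mR => (a + s * x : mR).
have mf : measurable_fun [set: mR] f by exact: measurable_affine.
pose pf := [the {measure set mR -> \bar R} of pushforward (@lebesgue_measure R) f].
pose m := mscale (NngNum (normr_ge0 s)) (pf mf).
change (lebesgue_measure X = m X).
apply: lebesgue_measure_unique => // Y /ocitvP[->|[[c d] /= cd ->]].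
  by rewrite !measure0.
rewrite /m /mscale /= /pushforward /=.
have [sp|sn] := ltP 0 s.
  have -> : f @^-1` `]c, d] = `] (c - a) / s, (d - a) / s]%classic.
    apply/seteqP; split => x /=; rewrite !in_itv /= /f ltr_pdivrMr// ler_pdivlMr//;
    by rewrite ltrBlDl lerBrDl [x * s]mulrC.
  rewrite gtr0_norm// !lebesgue_measure_itv /= !lte_fin ltr_pdivrMr// mulfVK//.
  rewrite ltrD2r cd -!EFinB -EFinM; congr EFin.
  by field.
(* A negative slope reverses the interval, so the preimage of []c, d]] is closed on the left
   instead; its length is unaffected. *)
have {}sn : s < 0 by rewrite lt_neqAle s0.
have -> : f @^-1` `]c, d] = `[ (d - a) / s, (c - a) / s [%classic.
  apply/seteqP; split => x /=; rewrite !in_itv /= /f ltr_ndivlMr// ler_ndivrMr//;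
  by rewrite andbC ltrBlDl lerBrDl [x * s]mulrC.
rewrite ltr0_norm// !lebesgue_measure_itv /= !lte_fin ltr_ndivrMr// mulfVK//.
rewrite ltrD2r cd -!EFinB -EFinM; congr EFin.
by field.
Qed.

Lemma measurable_homothety a s : measurable_fun [set: plane] (homothety a s : plane -> plane).
Proof.
apply: measurable_fun_pair.
  by apply: (measurableT_comp (measurable_affine a.1 s)); exact: measurable_fst.
by apply: (measurableT_comp (measurable_affine a.2 s)); exact: measurable_snd.
Qed.

Lemma leb2X (A B : set mR) : measurable A -> measurable B ->
  leb2 (A `*` B) = (lebesgue_measure A * lebesgue_measure B)%E.
Proof. by move=> mA mB; rewrite /leb2 product_measure1E. Qed.

(** By uniqueness of the product measure only rectangles matter, and each of their sides contributes
    one factor [|s|]. *)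
Lemma leb2_homothety a s (X : set plane) : s != 0 -> measurable X ->
  leb2 X = ((s ^+ 2)%:E * leb2 (homothety a s @^-1` X))%E.
Proof.
move=> s0 mX.
pose pf := [the {measure set plane -> \bar R} of pushforward (@leb2 R) (homothety a s : plane -> plane)].
pose m := mscale (NngNum (sqr_ge0 s)) (pf (measurable_homothety a s)).
change (leb2 X = m X).
apply: product_measure_unique => // A B mA mB.
transitivity ((s ^+ 2)%:E * leb2 (((fun x : mR => (a.1 + s * x)%R : mR) @^-1` A) `*`
  ((fun x : mR => (a.2 + s * x)%R : mR) @^-1` B)))%E; first by [].
have pre c (Y : set mR) : measurable Y -> measurable ((fun x : mR => c + s * x : mR) @^-1` Y).
  by move=> mY; rewrite -[X in measurable X]setTI; apply: measurable_affine.
rewrite leb2X; [|exact: pre|exact: pre].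
apply: (etrans _ (esym (congr2 mule (lebesgue_measure_affine a.1 s0 mA)
                                   (lebesgue_measure_affine a.2 s0 mB)))).
rewrite -real_normK ?num_real// expr2 EFinM muleACA//.
Qed.

Lemma measurable_box (i j : interval R) : measurable ([set` i] `*` [set` j] : set plane).
Proof. by apply: measurableX; exact: measurable_itv. Qed.

(** Rational corners keep the family of boxes countable; the closed box inside [D] will hold the
    compact support of a bump. *)
Lemma rat_box (D : set (R * R)) z : open D -> D z -> exists q : (rat * rat) * (rat * rat),
  [/\ ratr q.1.1 < z.1 < ratr q.1.2, ratr q.2.1 < z.2 < ratr q.2.2 &
   `[ratr q.1.1 : R, ratr q.1.2] `*` `[ratr q.2.1, ratr q.2.2] `<=` D].
Proof.
move=> oD Dz; have := open_nbhs_nbhs (conj oD Dz).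
move=> /nbhs_ballP[e /= e0 he].
have [q11 /[!in_itv]/= /andP[a1 a2]] : exists q : rat, ratr q \in `]z.1 - e, z.1[.
  by apply: rat_in_itvoo; rewrite ltrBlDr ltrDl.
have [q12 /[!in_itv]/= /andP[b1 b2]] : exists q : rat, ratr q \in `]z.1, z.1 + e[.
  by apply: rat_in_itvoo; rewrite ltrDl.
have [q21 /[!in_itv]/= /andP[c1 c2]] : exists q : rat, ratr q \in `]z.2 - e, z.2[.
  by apply: rat_in_itvoo; rewrite ltrBlDr ltrDl.
have [q22 /[!in_itv]/= /andP[d1 d2]] : exists q : rat, ratr q \in `]z.2, z.2 + e[.
  by apply: rat_in_itvoo; rewrite ltrDl.
exists ((q11, q12), (q21, q22)); rewrite a2 b1 c2 d1; split => //= x [] /=.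
rewrite !in_itv /= => /andP[x1 x2] /andP[y1 y2]; apply: he; split => /=;
  rewrite /ball /= ltr_distlC; apply/andP; split; lra.
Qed.

(* A countable cover of the open set [D] by boxes whose closures lie in [D]. *)
Definition box_cover (D : set (R * R)) (n : nat) : set plane :=
  if @unpickle ((rat * rat) * (rat * rat))%type n is Some q then
    if `[< `[ratr q.1.1 : R, ratr q.1.2] `*` `[ratr q.2.1, ratr q.2.2] `<=` D >] then
      `]ratr q.1.1, ratr q.1.2[ `*` `]ratr q.2.1, ratr q.2.2[
    else set0
  else set0.

Lemma box_coverP D n : box_cover D n = set0 \/ exists a b c d : R,
  [/\ a <= b, c <= d, `[a, b] `*` `[c, d] `<=` D & box_cover D n = `]a, b[ `*` `]c, d[ ].
Proof.
rewrite /box_cover; case: unpickle => [q|]; last by left.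
case: asboolP => [h|_]; last by left.
have [ab|ba] := leP (ratr q.1.1 : R) (ratr q.1.2); last first.
  by left; rewrite set_itv_ge ?set0X// bnd_simp -leNgt ltW.
have [cd|dc] := leP (ratr q.2.1 : R) (ratr q.2.2); last first.
  by left; rewrite (@set_itv_ge _ _ (BRight (ratr q.2.1))) ?setX0// bnd_simp -leNgt ltW.
by right; exists (ratr q.1.1), (ratr q.1.2), (ratr q.2.1), (ratr q.2.2).
Qed.

Lemma bigcup_box_cover D : open D -> \bigcup_n box_cover D n = D.
Proof.
move=> oD; apply/seteqP; split => [z [n _]|z Dz].
  have [->//|[a [b [c [d [ab cd h ->]]]]]] := box_coverP D n.
  move=> [] /=; rewrite !in_itv /= => /andP[z1 z2] /andP[z3 z4].
  by apply: h; split => /=; rewrite in_itv /=; [rewrite (ltW z1) (ltW z2)|rewrite (ltW z3) (ltW z4)].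
have [q [/andP[q1 q2] /andP[q3 q4] qD]] := rat_box oD Dz.
exists (pickle q); first by [].
rewrite /box_cover pickleK; case: asboolP => [_|/(_ qD)[]].
by split => /=; rewrite in_itv /=; [rewrite q1|rewrite q3].
Qed.

Lemma measurable_box_cover D n : measurable (box_cover D n).
Proof.
by have [->//|[a [b [c [d [_ _ _ ->]]]]]] := box_coverP D n; exact: measurable_box.
Qed.

Lemma open_measurable2 (D : set (R * R)) : open D -> measurable (D : set plane).
Proof.
move=> oD; rewrite -(bigcup_box_cover oD).
by apply: bigcupT_measurable => n; exact: measurable_box_cover.
Qed.

Lemma continuous_measurable2 (f : R * R -> R) : continuous f ->
  measurable_fun [set: plane] (f : plane -> mR).
Proof.
move=> cf; apply: (measurability _ (RGenOpens.measurableE R)) => _ [_ [a [b ->]] <-].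
rewrite setTI; apply: open_measurable2; apply: open_comp => // x _; exact: cf.
Qed.

Lemma ge0_integral_homothety a s (f : plane -> \bar R) : s != 0 ->
  measurable_fun [set: plane] f -> (forall z, 0 <= f z)%E ->
  (\int[leb2]_z f z = (s ^+ 2)%:E * \int[leb2]_z f (homothety a s z))%E.
Proof.
move=> s0 mf f0.
pose pf := [the {measure set plane -> \bar R} of pushforward (@leb2 R) (homothety a s : plane -> plane)].
pose m := mscale (NngNum (sqr_ge0 s)) (pf (measurable_homothety a s)).
rewrite (eq_measure_integral m); last by move=> A mA _; exact: leb2_homothety.
transitivity ((s ^+ 2)%:E * \int[pf (measurable_homothety a s)]_z f z)%E.
  exact: (@ge0_integral_mscale _ _ _ (pf (measurable_homothety a s)) _ measurableT
           (NngNum (sqr_ge0 s)) _ mf (fun z _ => f0 z)).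
apply: (congr1 (mule (s ^+ 2)%:E)).
exact: (ge0_integral_pushforward (measurable_homothety a s) _ measurableT mf (fun z _ => f0 z)).
Qed.

Lemma integrable_homothety a s (f : plane -> R) : s != 0 ->
  leb2.-integrable [set: plane] (EFin \o f) ->
  leb2.-integrable [set: plane] (EFin \o (f \o homothety a s)).
Proof.
move=> s0 /integrableP[mf intf]; apply/integrableP; split.
  exact: (measurableT_comp mf (measurable_homothety a s)).
have s2 : 0 < s ^+ 2 by rewrite exprn_even_gt0.
have mf' : measurable_fun [set: plane] (fun z => `|(f z)%:E|)%E by exact: measurableT_comp.
have := ge0_integral_homothety a s0 mf' (fun z => abse_ge0 _).
move: intf => /= /[swap] ->.
move: (integral _ _ _) => [r _|//|//]; first exact: ltry.
by rewrite gt0_muley.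
Qed.

Lemma Rintegral_homothety a s (f : plane -> R) : s != 0 ->
  leb2.-integrable [set: plane] (EFin \o f) ->
  Rintegral leb2 setT f = s ^+ 2 * Rintegral leb2 setT (f \o homothety a s).
Proof.
move=> s0 intf; have intg := integrable_homothety a s0 intf.
have mf := measurable_int _ intf.
have E : (\int[leb2]_z (EFin \o f) z = (s ^+ 2)%:E * \int[leb2]_z (EFin \o (f \o homothety a s)) z)%E.
  have K (x : R) (A B : \bar R) : A \is a fin_num -> B \is a fin_num ->
      (x%:E * A - x%:E * B = x%:E * (A - B))%E.
    case: A => // A _; case: B => // B _.
    by rewrite -[LHS]/((x * A - x * B)%:E) -mulrBr.
  have P := ge0_integral_homothety a s0 (measurable_funepos mf) (fun z => funepos_ge0 _ z).
  have N := ge0_integral_homothety a s0 (measurable_funeneg mf) (fun z => funeneg_ge0 _ z).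
  have cP : (EFin \o (f \o homothety a s))^\+%E = ((EFin \o f)^\+ \o homothety a s)%E.
    by rewrite -funepos_comp.
  have cN : (EFin \o (f \o homothety a s))^\-%E = ((EFin \o f)^\- \o homothety a s)%E.
    by rewrite -funeneg_comp.
  have fP : (\int[leb2]_z (EFin \o f)^\+ (homothety a s z))%E \is a fin_num.
    by have := integrable_pos_fin_num measurableT intg; rewrite cP.
  have fN : (\int[leb2]_z (EFin \o f)^\- (homothety a s z))%E \is a fin_num.
    by have := integrable_neg_fin_num measurableT intg; rewrite cN.
  apply: (etrans (integralE _ _ _)).
  apply: (etrans (congr2 (fun x y => x - y)%E P N)).
  apply: (etrans (K _ _ _ fP fN)).
  by rewrite [in RHS]integralE cP cN.
rewrite /Rintegral E fineM//.
exact: (integrable_fin_num measurableT intg).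
Qed.

Lemma bounded_measure_lty (D : set (R * R)) (z0 : R * R) (r : R) :
  (forall z, D z -> `|z.1 - z0.1| <= r /\ `|z.2 - z0.2| <= r) ->
  measurable (D : set plane) -> (leb2 D <= ((2 * r) ^+ 2)%:E)%E.
Proof.
move=> hD mD.
(* An empty [D] says nothing about the sign of [r]; a point of [D] forces [0 <= r]. *)
have [->|/set0P[w /hD[+ _]]] := eqVneq (D : set plane) set0.
  by rewrite measure0 lee_fin sqr_ge0.
move=> /(le_trans (normr_ge0 _)) r0.
have mI (x : R) : measurable (`[x - r, x + r] : set mR) by exact: measurable_itv.
have sub : (D : set plane) `<=` `[z0.1 - r, z0.1 + r] `*` `[z0.2 - r, z0.2 + r].
  move=> z /hD[]; rewrite !ler_norml => h1 h2.
  by split => /=; rewrite in_itv /=; lra.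
have mB : measurable (`[z0.1 - r, z0.1 + r] `*` `[z0.2 - r, z0.2 + r] : set plane).
  exact: measurable_box.
apply: (le_trans (le_measure (@leb2 R) (mem_set mD) (mem_set mB) sub)).
pose I1 : set mR := `[z0.1 - r, z0.1 + r]%classic; pose I2 : set mR := `[z0.2 - r, z0.2 + r]%classic.
apply: (@le_trans _ _ (lebesgue_measure I1 * lebesgue_measure I2)%E).
  by rewrite -(leb2X (mI z0.1) (mI z0.2)).
have L (x : R) : @lebesgue_measure R `[x - r, x + r]%classic = (2 * r)%:E.
  rewrite lebesgue_measure_itv /= lte_fin; case: ltP => h; last first.
    by rewrite (_ : r = 0) ?mulr0//; lra.
  by rewrite -EFinB; congr EFin; lra.
by rewrite (L z0.1) (L z0.2) -EFinM expr2.
Qed.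

Lemma leb2_sigma_finite : sigma_finite [set: plane] (@leb2 R).
Proof.
exists (fun n => `[- n%:R, n%:R] `*` `[- n%:R, n%:R]).
  apply/seteqP; split => // z _.
  exists (Num.trunc (Num.max `|z.1| `|z.2|)).+1 => //.
  have /ltW : Num.max `|z.1| `|z.2| < (Num.trunc (Num.max `|z.1| `|z.2|)).+1%:R :> R by rewrite truncnS_gt.
  by rewrite ge_max !ler_norml => /andP[h1 h2]; split => /=; rewrite in_itv.
move=> n; split; first exact: measurable_box.
apply: (le_lt_trans (@bounded_measure_lty _ (0, 0) n%:R _ (measurable_box _ _))); last exact: ltry.
by move=> z [] /=; rewrite !in_itv /= !subr0 -!ler_norml.
Qed.

HB.instance Definition _ := Measure_isSigmaFinite.Build _ _ _ (@leb2 R) leb2_sigma_finite.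

End PlaneMeasure.

(** * The space L2(D): inner product, norm and their inequalities *)

Section L2Space.
Context {R : realType}.
Local Notation mR := (measurableTypeR R).
Local Notation plane := (mR * mR)%type.
Implicit Types (D : set (R * R)) (u v w : R * R -> R).

Let p12 : (1 <= 2%:E :> \bar R)%E. Proof. by rewrite lee_fin ler1n. Qed.

(** Restriction extends by zero, hence the condition [op 0 0 = 0]. *)
Lemma restrict_fun2 D (op : R -> R -> R) u v : op 0 0 = 0 ->
  (fun z => op (u z) (v z)) \_ D = fun z => op ((u \_ D) z) ((v \_ D) z).
Proof. by move=> op0; apply/funext => z; rewrite !patchE; case: ifP. Qed.

Lemma L2D D u v : L2 D u -> L2 D v -> L2 D (fun z => u z + v z).
Proof.
move=> hu hv; rewrite /L2 (@restrict_fun2 _ (fun x y => x + y)) ?addr0//.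
exact: ((Lfun_addr_closed _ p12).2 _ _ hu hv).
Qed.

Lemma L2Z D (c : R) u : L2 D u -> L2 D (fun z => c * u z).
Proof.
move=> hu; rewrite /L2 (@restrict_fun2 _ (fun x y => c * x) u u) ?mulr0//.
have := @Lfun_scale _ _ _ _ _ c 2 _ hu.
rewrite (_ : c \o* _ = fun z => c * (u \_ D) z).
  by apply; rewrite ler1n.
by apply/funext => z /=; rewrite mulrC.
Qed.

Lemma L2B D u v : L2 D u -> L2 D v -> L2 D (fun z => u z - v z).
Proof.
move=> hu /(L2Z (-1)) hv; rewrite (_ : (fun _ => _) = fun z => u z + -1 * v z).
  exact: L2D.
by apply/funext => z; rewrite mulN1r.
Qed.

Lemma L2_measurable D u : L2 D u -> measurable_fun [set: plane] (u \_ D : plane -> mR).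
Proof. by case/andP => /[!inE]. Qed.

Lemma eq_L2 D u v : (forall z, D z -> u z = v z) -> L2 D u -> L2 D v.
Proof.
move=> uv; rewrite /L2 (_ : v \_ D = u \_ D)//; apply/funext => z.
by rewrite !patchE; case: ifPn => // /set_mem /uv.
Qed.

Lemma L2_integrableM D u v : measurable (D : set plane) -> L2 D u -> L2 D v ->
  leb2.-integrable (D : set plane) (EFin \o (fun z => u z * v z)).
Proof.
move=> mD hu hv; have := Lfun2_mul_Lfun1 hu hv.
move/(Lfun1_integrable _ _).1 => h.
apply/(integrable_mkcond _ mD); rewrite restrict_EFin.
by rewrite (@restrict_fun2 _ (fun x y => x * y)) ?mulr0.
Qed.

Lemma L2_intro D u : measurable_fun [set: plane] (u \_ D : plane -> mR) ->
  (\int[leb2]_z (((u \_ D) z) ^+ 2)%:E < +oo)%E -> L2 D u.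
Proof.
move=> mu hu; apply/andP; split; rewrite inE//=.
rewrite /finite_norm unlock /Lnorm.
apply: poweR_lty; apply: le_lt_trans hu.
rewrite le_eqVlt; apply/orP; left; apply/eqP; apply: eq_integral => z _ /=.
by rewrite powR_mulrn// -normrX ger0_norm// sqr_ge0.
Qed.

Lemma L2_sqr_lty D u : L2 D u -> (\int[leb2]_z (((u \_ D) z) ^+ 2)%:E < +oo)%E.
Proof.
move/Lfun2_integrable_sqr/integrableP => -[_]; apply: le_lt_trans.
rewrite le_eqVlt; apply/orP; left; apply/eqP; apply: eq_integral => z _ /=.
by rewrite ger0_norm// sqr_ge0.
Qed.

Lemma L2_le D u v : measurable_fun [set: plane] (u \_ D : plane -> mR) -> L2 D v ->
  (forall z, D z -> `|u z| <= `|v z|) -> L2 D u.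
Proof.
move=> mu hv uv; apply: L2_intro => //; apply: le_lt_trans (L2_sqr_lty hv).
have mX w : measurable_fun [set: plane] (w : plane -> mR) ->
    measurable_fun [set: plane] (fun z : plane => (w z ^+ 2)%:E).
  by move=> mw; apply/measurable_EFinP; exact: measurable_funX.
apply: ge0_le_integral => //.
- by move=> z _; rewrite lee_fin sqr_ge0.
- exact: mX.
- exact: (mX _ (L2_measurable hv)).
- move=> z _; rewrite lee_fin !patchE; case: ifPn => [/set_mem Dz|//].
  by rewrite -[X in X <= _]real_normK ?num_real// -[X in _ <= X]real_normK ?num_real// lerXn2r ?nnegrE// uv.
Qed.

Lemma measurable_restrict2 D u : measurable (D : set plane) ->
  measurable_fun [set: plane] (u : plane -> mR) -> measurable_fun [set: plane] (u \_ D : plane -> mR).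
Proof.
by move=> mD mu; apply/(measurable_restrictT _ mD); exact: measurable_funTS.
Qed.

Lemma L2_abs D u : L2 D u -> L2 D (fun z => `|u z|).
Proof.
move=> hu; apply: (L2_le _ hu) => [|z _]; last by rewrite normr_id.
rewrite (@restrict_fun2 _ (fun x _ => `|x|) u u) ?normr0//.
exact: (measurableT_comp (@normr_measurable R setT) (L2_measurable hu)).
Qed.

Lemma L2_cst D (c : R) : measurable (D : set plane) -> (leb2 D < +oo)%E -> L2 D (fun=> c).
Proof.
move=> mD fD; apply: L2_intro; first by apply: measurable_restrict2 => //; exact: measurable_cst.
rewrite (_ : (\int[leb2]_z _)%E = (\int[leb2]_(z in D) (cst (c ^+ 2)%:E) z)%E).
  by rewrite integral_cst// lte_mul_pinfty// lee_fin sqr_ge0.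
rewrite [RHS]integral_mkcond; apply: eq_integral => z _.
by rewrite !patchE; case: ifP => //; rewrite expr0n.
Qed.

Lemma L2_bounded D u (M : R) : measurable (D : set plane) -> (leb2 D < +oo)%E ->
  measurable_fun [set: plane] (u \_ D : plane -> mR) ->
  (forall z, D z -> `|u z| <= M) -> L2 D u.
Proof.
move=> mD fD mu uM; apply: (L2_le mu (L2_cst M mD fD)) => z Dz.
exact: le_trans (uM z Dz) (ler_norm _).
Qed.

Lemma eq_L2ip D u v u' v' : (forall z, D z -> u z * v z = u' z * v' z) ->
  L2ip D u v = L2ip D u' v'.
Proof. by move=> h; apply: eq_Rintegral => z /set_mem; exact: h. Qed.

Lemma L2ipC D u v : L2ip D u v = L2ip D v u.
Proof. by apply: eq_L2ip => z _; rewrite mulrC. Qed.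

Section Inner.
Variable D : set (R * R).
Hypothesis mD : measurable (D : set plane).

Lemma L2ipDl u v w : L2 D u -> L2 D v -> L2 D w ->
  L2ip D (fun z => u z + v z) w = L2ip D u w + L2ip D v w.
Proof.
move=> hu hv hw; rewrite /L2ip -RintegralD//; [|exact: L2_integrableM|exact: L2_integrableM].
by apply: eq_Rintegral => z _; rewrite mulrDl.
Qed.

Lemma L2ipZl c u w : L2 D u -> L2 D w ->
  L2ip D (fun z => c * u z) w = c * L2ip D u w.
Proof.
move=> hu hw; rewrite /L2ip -RintegralZl//; last exact: L2_integrableM.
by apply: eq_Rintegral => z _; rewrite mulrA.
Qed.

Lemma L2ipBl u v w : L2 D u -> L2 D v -> L2 D w ->
  L2ip D (fun z => u z - v z) w = L2ip D u w - L2ip D v w.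
Proof.
move=> hu hv hw; rewrite /L2ip -RintegralB//; [|exact: L2_integrableM|exact: L2_integrableM].
by apply: eq_Rintegral => z _; rewrite mulrBl.
Qed.

Lemma L2ipDr u v w : L2 D u -> L2 D v -> L2 D w ->
  L2ip D w (fun z => u z + v z) = L2ip D w u + L2ip D w v.
Proof. by move=> hu hv hw; rewrite L2ipC L2ipDl// ![L2ip D _ w]L2ipC. Qed.

Lemma L2ipBr u v w : L2 D u -> L2 D v -> L2 D w ->
  L2ip D w (fun z => u z - v z) = L2ip D w u - L2ip D w v.
Proof. by move=> hu hv hw; rewrite L2ipC L2ipBl// ![L2ip D _ w]L2ipC. Qed.

Lemma L2ipZr c u w : L2 D u -> L2 D w ->
  L2ip D w (fun z => c * u z) = c * L2ip D w u.
Proof. by move=> hu hw; rewrite L2ipC L2ipZl// [L2ip D _ w]L2ipC. Qed.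

Lemma L2ip_ge0 u : 0 <= L2ip D u u.
Proof. by apply: Rintegral_ge0 => z _; rewrite -expr2 sqr_ge0. Qed.

Definition L2norm u : R := Num.sqrt (L2ip D u u).

Lemma L2norm_ge0 u : 0 <= L2norm u. Proof. exact: sqrtr_ge0. Qed.

Lemma sqr_L2norm u : L2norm u ^+ 2 = L2ip D u u.
Proof. by rewrite sqr_sqrtr// L2ip_ge0. Qed.

Lemma eq_L2norm u v : (forall z, D z -> u z = v z) -> L2norm u = L2norm v.
Proof. by move=> uv; congr Num.sqrt; apply: eq_L2ip => z Dz; rewrite uv. Qed.

Lemma cauchy_schwarz u v : L2 D u -> L2 D v -> `|L2ip D u v| <= L2norm u * L2norm v.
Proof.
move=> hu hv.
have Q (t : R) : 0 <= L2ip D u u - 2 * t * L2ip D u v + t ^+ 2 * L2ip D v v.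
  apply: le_trans (L2ip_ge0 (fun z => u z - t * v z)) _.
  have hw := L2B hu (L2Z t hv).
  rewrite L2ipBl ?L2ipBr ?L2ipZl ?L2ipBr ?L2ipZr//; try exact: L2Z.
  by rewrite (L2ipC D v u); lra.
rewrite -ler_sqr ?nnegrE ?mulr_ge0 ?L2norm_ge0// exprMn !sqr_L2norm real_normK ?num_real//.
have [v0|v0] := eqVneq (L2ip D v v) 0; last first.
  have vp : 0 < L2ip D v v by rewrite lt_def v0 L2ip_ge0.
  have := Q (L2ip D u v / L2ip D v v).
  set a := L2ip D u v; set b := L2ip D u u; set c := L2ip D v v in v0 vp * => h.
  have E : b - 2 * (a / c) * a + (a / c) ^+ 2 * c = (b * c - a ^+ 2) / c by field.
  by move: h; rewrite E pmulr_lge0 ?invr_gt0// subr_ge0.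
have [a0|a0] := eqVneq (L2ip D u v) 0; first by rewrite a0 v0 expr0n mulr0.
(* When [v] has norm zero the quadratic [Q] is affine in [t], and this [t] gives it the value -1. *)
have := Q ((L2ip D u u + 1) / (2 * L2ip D u v)); rewrite v0.
set a := L2ip D u v in a0 *; set b := L2ip D u u.
have -> : b - 2 * ((b + 1) / (2 * a)) * a + ((b + 1) / (2 * a)) ^+ 2 * 0 = -1 by field.
by lra.
Qed.

Lemma ler_L2normD u v : L2 D u -> L2 D v ->
  L2norm (fun z => u z + v z) <= L2norm u + L2norm v.
Proof.
move=> hu hv; rewrite -ler_sqr ?nnegrE ?addr_ge0 ?L2norm_ge0//.
rewrite sqrrD !sqr_L2norm L2ipDl ?L2ipDr//; try exact: L2D.
have := cauchy_schwarz hu hv; rewrite (L2ipC D v u) => /(le_trans (ler_norm _)).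
by lra.
Qed.

Lemma L2normZ c u : L2 D u -> L2norm (fun z => c * u z) = `|c| * L2norm u.
Proof.
move=> hu; rewrite /L2norm L2ipZl ?L2ipZr//; last exact: L2Z.
by rewrite mulrA -expr2 sqrtrM ?sqr_ge0// sqrtr_sqr.
Qed.

Lemma ler_L2normB u v : L2 D u -> L2 D v ->
  L2norm (fun z => u z - v z) <= L2norm u + L2norm v.
Proof.
move=> hu hv; rewrite (@eq_L2norm _ (fun z => u z + -1 * v z)); last by move=> z _; rewrite mulN1r.
apply: le_trans (ler_L2normD hu (L2Z _ hv)) _.
by rewrite L2normZ// normrN1 mul1r.
Qed.

Lemma L2norm_le u v : L2 D u -> L2 D v -> (forall z, D z -> `|u z| <= `|v z|) ->
  L2norm u <= L2norm v.
Proof.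
move=> hu hv uv; apply: ler_wsqrtr; apply: le_Rintegral => //; try exact: L2_integrableM.
move=> z Dz; rewrite -!expr2 -[X in X <= _]real_normK ?num_real// -[X in _ <= X]real_normK ?num_real//.
by rewrite lerXn2r ?nnegrE// uv.
Qed.

End Inner.
End L2Space.

(** * Test functions and integration by parts *)

Section TestFunctions.
Context {R : realType}.
Local Notation mR := (measurableTypeR R).
Local Notation plane := (mR * mR)%type.
Implicit Types (D : set (R * R)) (u f g phi psi : R * R -> R).

Definition supp phi : set (R * R) := closure [set z | phi z != 0].

Lemma testfn_Cinf D phi : test_function D phi -> Cinf phi.
Proof. by case. Qed.

Lemma notin_supp phi z : ~ supp phi z -> phi z = 0.
Proof.
move=> h; apply: contrapT => /eqP h'; apply: h; exact: subset_closure.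
Qed.

Lemma testfn_supp D phi : test_function D phi -> supp phi `<=` D.
Proof. by case. Qed.

Lemma testfn_compact D phi : test_function D phi -> compact (supp phi).
Proof. by case. Qed.

Lemma testfn_out D phi z : test_function D phi -> ~ D z -> phi z = 0.
Proof. by move=> /testfn_supp hs hz; apply: notin_supp => /hs. Qed.

(** A compact [K] is closed, so it contains the support as soon as [psi] vanishes outside it. *)
Lemma testfn_intro D (K : set (R * R)) psi : compact K -> K `<=` D -> Cinf psi ->
  (forall z, ~ K z -> psi z = 0) -> test_function D psi.
Proof.
move=> cK KD hpsi h0.
have clK : closed K by apply: compact_closed => //; exact: norm_hausdorff.
have sK : supp psi `<=` K.
  rewrite [X in _ `<=` X](iffLR (closure_id K) clK); apply: closure_subset => z /= /eqP hz.
  by apply: contrapT => /h0.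
split=> //; last exact: subset_trans sK KD.
by apply: subclosed_compact cK sK; exact: closed_closure.
Qed.

Lemma testfn_sub D phi psi : test_function D phi -> Cinf psi ->
  (forall z, ~ supp phi z -> psi z = 0) -> test_function D psi.
Proof. by move=> [_ c s] *; exact: testfn_intro c s _ _. Qed.

Lemma testfnW D D' phi : D `<=` D' -> test_function D phi -> test_function D' phi.
Proof. by move=> DD' [? ? h]; split=> //; exact: subset_trans h DD'. Qed.

Lemma testfnM D g phi : Cinf g -> test_function D phi -> test_function D (fun z => g z * phi z).
Proof.
move=> hg hphi; apply: (testfn_sub hphi).
  by apply: CinfM => //; exact: testfn_Cinf hphi.
by move=> z /notin_supp ->; rewrite mulr0.
Qed.

Lemma testfnZ D (c : R) phi : test_function D phi -> test_function D (fun z => c * phi z).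
Proof. by apply: testfnM; exact: Cinf_cst. Qed.

Lemma testfn0 D : test_function D (fun=> 0).
Proof.
by apply: (@testfn_intro _ set0); [exact: compact0|exact: sub0set|exact: Cinf_cst|].
Qed.

Lemma testfnD D phi psi : test_function D phi -> test_function D psi ->
  test_function D (fun z => phi z + psi z).
Proof.
move=> [h1 c1 s1] [h2 c2 s2].
apply: (@testfn_intro _ (supp phi `|` supp psi)).
- exact: compactU.
- by rewrite subUset.
- exact: CinfD.
- by move=> z /not_orP[/notin_supp -> /notin_supp ->]; rewrite addr0.
Qed.

Lemma near_supp phi z : ~ supp phi z -> \forall w \near z, phi w = cst 0 w.
Proof.
move=> h; have : nbhs z (~` supp phi).
  by apply: open_nbhs_nbhs; split => //; apply: closed_openC; exact: closed_closure.
by apply: filterS => w /notin_supp.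
Qed.

Lemma testfn_D1 D phi : test_function D phi -> test_function D (D1 phi).
Proof.
move=> h; apply: (testfn_sub h); first by apply: Cinf_D1; exact: testfn_Cinf h.
by move=> z /near_supp /(near_eq_derive ((1, 0) : R * R)); rewrite /D1 => ->; rewrite derive_cst.
Qed.

Lemma testfn_D2 D phi : test_function D phi -> test_function D (D2 phi).
Proof.
move=> h; apply: (testfn_sub h); first by apply: Cinf_D2; exact: testfn_Cinf h.
by move=> z /near_supp /(near_eq_derive ((0, 1) : R * R)); rewrite /D2 => ->; rewrite derive_cst.
Qed.

Lemma testfn_partial D i j phi : test_function D phi -> test_function D (partial i j phi).
Proof.
move=> h; rewrite /partial; elim: i => [|i IH] /=; last exact: testfn_D1.
by elim: j => [//|j IH] /=; exact: testfn_D2.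
Qed.

Lemma testfn_bounded D phi : test_function D phi -> exists M : R, 0 <= M /\ forall z, `|phi z| <= M.
Proof.
move=> h; have ch := Cinf_continuous (testfn_Cinf h).
have [e|ne] := eqVneq (supp phi) set0.
  by exists 0; split => // z; rewrite notin_supp ?normr0// e.
move/set0P in ne.
have cn : {within supp phi, continuous (fun z => `|phi z|)}.
  apply: continuous_subspaceT => z; apply: (@continuous_comp _ _ _ phi (fun x => `|x|)); first exact: ch.
  exact: norm_continuous.
have [c _ cM] := compact_EVT_max ne (testfn_compact h) cn.
exists `|phi c|; split => // z.
have [/mem_set /cM//|/notin_supp ->] := pselect (supp phi z).
by rewrite normr0.
Qed.

Lemma testfn_supp_bounded D phi : test_function D phi ->
  exists M : R, 0 <= M /\ forall z, phi z != 0 -> `|z.1| <= M /\ `|z.2| <= M.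
Proof.
move=> [_ /compact_bounded [M [_ hM]] _].
exists (Num.max 0 M + 1); split; first by rewrite addr_ge0// le_max lexx.
move=> z hz; have : `|z| <= Num.max 0 M + 1.
  apply: hM; last exact: subset_closure.
  by rewrite (@le_lt_trans _ _ (Num.max 0 M)) ?ltrDl// le_max lexx orbT.
by rewrite prod_normE ge_max => /andP.
Qed.

Lemma testfn_measurable D phi : test_function D phi ->
  measurable_fun [set: plane] (phi : plane -> mR).
Proof. by move=> h; apply: continuous_measurable2; apply: Cinf_continuous; exact: testfn_Cinf h. Qed.

Lemma testfn_integrable D phi : test_function D phi ->
  leb2.-integrable [set: plane] (EFin \o phi).
Proof.
move=> h; have [M [M0 hM]] := testfn_supp_bounded h.
have [B [B0 hB]] := testfn_bounded h.
pose Q : set plane := `[- M, M] `*` `[- M, M].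
have mQ : measurable Q by exact: measurable_box.
have E : phi = phi \_ Q.
  apply/funext => z; rewrite patchE; case: ifPn => //.
  rewrite notin_setE => nQ; apply: contrapT => /eqP /hM [h1 h2]; apply: nQ.
  by split => /=; rewrite in_itv /= -ler_norml.
rewrite E -restrict_EFin; apply/(integrable_mkcond _ mQ).
apply: measurable_bounded_integrable => //.
- apply: le_lt_trans (ltry _).
  apply: (@bounded_measure_lty _ _ (0, 0) M _ mQ) => z [] /=.
  by rewrite !in_itv /= !subr0 -!ler_norml.
- by apply: measurable_funTS; exact: testfn_measurable h.
- exists B; split; first exact: num_real.
  by move=> b bB z _; exact: le_trans (hB z) (ltW bB).
Qed.

Lemma testfn_L2 D phi D' : measurable (D' : set plane) -> test_function D phi -> L2 D' phi.
Proof.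
move=> mD' h; have [B [B0 hB]] := testfn_bounded h.
apply: L2_intro; first by apply: measurable_restrict2 => //; exact: testfn_measurable h.
have hh : test_function D (fun z => phi z * phi z) by apply: testfnM => //; exact: testfn_Cinf h.
have /integrableP[m] := testfn_integrable hh; apply: le_lt_trans.
apply: ge0_le_integral => //.
- by move=> z _; rewrite lee_fin sqr_ge0.
- apply/measurable_EFinP/measurable_funX; apply: measurable_restrict2 => //; exact: testfn_measurable h.
- exact: measurableT_comp.
move=> z _; rewrite /= lee_fin -expr2 patchE; case: ifP => _; first exact: ler_norm.
apply: (@le_trans _ _ (0 ^+ 2 : R)); first exact: lexx.
by rewrite expr0n normr_ge0.
Qed.

Lemma L2ip_testfn D u phi : test_function D phi ->
  L2ip D u phi = Rintegral leb2 setT (fun z => u z * phi z).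
Proof.
move=> h; rewrite /L2ip Rintegral_mkcond; congr Rintegral; apply/funext => z.
rewrite patchE; case: ifPn => //; rewrite notin_setE => nz.
by rewrite (testfn_out h)// mulr0.
Qed.

Lemma integral_derive_compact (f df : R -> R) (M : R) : 0 <= M ->
  (forall x : R, is_derive x 1 f (df x)) -> continuous df ->
  (forall x, f x != 0 -> `|x| <= M) -> (forall x, df x != 0 -> `|x| <= M) ->
  (\int[lebesgue_measure]_x (df x)%:E = 0)%E.
Proof.
move=> M0 hf cdf fM dfM.
have cf : continuous f.
  by move=> x; apply/differentiable_continuous/derivable1_diffP; case: (hf x).
have f0 x : M < `|x| -> f x = 0.
  by move=> Mx; apply: contrapT => /eqP /fM; rewrite leNgt Mx.
(* The margin of one unit puts both endpoints where [f] vanishes. *)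
pose I : set mR := `[- (M + 1), M + 1]%classic.
have -> : (\int[lebesgue_measure]_x (df x)%:E = \int[lebesgue_measure]_(x in I) (df x)%:E)%E.
  rewrite [RHS]integral_mkcond; apply: eq_integral => x _; rewrite patchE.
  case: ifPn => //; rewrite notin_setE /I /= in_itv /= -ler_norml => h.
  congr EFin; apply: contrapT => /eqP /dfM h'; apply: h; rewrite (le_trans h')// lerDl //.
rewrite (@continuous_FTC2 _ df f).
- by rewrite !f0 ?subee// ?normrN ger0_norm ?addr_ge0// ltrDl.
- by rewrite (@lt_trans _ _ 0)// ?oppr_lt0 ltr_wpDl.
- exact: continuous_subspaceT.
- split.
  + by move=> x _; case: (hf x).
  + by apply: cvg_at_right_filter; exact: cf.
  + by apply: cvg_at_left_filter; exact: cf.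
- by move=> x _; rewrite derive1E; case: (hf x).
Qed.

(** Fubini with the first variable innermost: each slice integrates the derivative of a compactly
    supported function. *)
Lemma Rintegral_D1 D psi : test_function D psi -> Rintegral leb2 setT (D1 psi) = 0.
Proof.
move=> h; have hD := testfn_D1 h.
have [M [M0 hM]] := testfn_supp_bounded h; have [N [N0 hN]] := testfn_supp_bounded hD.
have := integral21_prod_meas1 (testfn_integrable hD).
rewrite /Rintegral => <-.
rewrite (_ : fubini_G _ _ = cst 0%E) ?integral_cst ?mul0e//.
apply/funext => y; rewrite /fubini_G /=.
apply: (@integral_derive_compact (fun x => psi (x, y)) _ (Num.max M N)).
- by rewrite le_max M0.
- by move=> x; have /is_derive1_coord := Cinf_is_derive1 (testfn_Cinf h) (x, y).
- move=> x; apply: (@continuous_comp _ _ _ (fun x => (x, y)) (D1 psi)).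
    by apply: cvg_pair_coord => /=; [exact: cvg_id|exact: cvg_cst].
  exact: (Cinf_continuous (testfn_Cinf hD)).
- by move=> x /hM [/= ? _]; rewrite le_max; apply/orP; left.
- by move=> x /hN [/= ? _]; rewrite le_max; apply/orP; right.
Qed.

Lemma Rintegral_D2 D psi : test_function D psi -> Rintegral leb2 setT (D2 psi) = 0.
Proof.
move=> h; have hD := testfn_D2 h.
have [M [M0 hM]] := testfn_supp_bounded h; have [N [N0 hN]] := testfn_supp_bounded hD.
have := integral12_prod_meas1 (testfn_integrable hD).
rewrite /Rintegral => <-.
rewrite (_ : fubini_F _ _ = cst 0%E) ?integral_cst ?mul0e//.
apply/funext => x; rewrite /fubini_F /=.
apply: (@integral_derive_compact (fun y => psi (x, y)) _ (Num.max M N)).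
- by rewrite le_max M0.
- by move=> y; have /is_derive2_coord := Cinf_is_derive2 (testfn_Cinf h) (x, y).
- move=> y; apply: (@continuous_comp _ _ _ (fun y => (x, y)) (D2 psi)).
    by apply: cvg_pair_coord => /=; [exact: cvg_cst|exact: cvg_id].
  exact: (Cinf_continuous (testfn_Cinf hD)).
- by move=> y /hM [/= _ ?]; rewrite le_max; apply/orP; left.
- by move=> y /hN [/= _ ?]; rewrite le_max; apply/orP; right.
Qed.

(** The product [f * phi] is again a test function, so the integral of its derivative vanishes. *)
Lemma L2ip_D1 D f phi : Cinf f -> test_function D phi ->
  L2ip D f (D1 phi) = - L2ip D (D1 f) phi.
Proof.
move=> hf h; have cphi := testfn_Cinf h.
rewrite (L2ip_testfn _ h) (L2ip_testfn _ (testfn_D1 h)).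
have := Rintegral_D1 (testfnM hf h); rewrite (D1M hf cphi) RintegralD//.
- by move=> /eqP; rewrite addr_eq0 => /eqP ->; rewrite opprK.
- by apply: (@testfn_integrable D); apply: testfnM => //; exact: Cinf_D1.
- by apply: (@testfn_integrable D); apply: testfnM => //; exact: testfn_D1.
Qed.

Lemma L2ip_D2 D f phi : Cinf f -> test_function D phi ->
  L2ip D f (D2 phi) = - L2ip D (D2 f) phi.
Proof.
move=> hf h; have cphi := testfn_Cinf h.
rewrite (L2ip_testfn _ h) (L2ip_testfn _ (testfn_D2 h)).
have := Rintegral_D2 (testfnM hf h); rewrite (D2M hf cphi) RintegralD//.
- by move=> /eqP; rewrite addr_eq0 => /eqP ->; rewrite opprK.
- by apply: (@testfn_integrable D); apply: testfnM => //; exact: Cinf_D2.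
- by apply: (@testfn_integrable D); apply: testfnM => //; exact: testfn_D2.
Qed.

(** In [partial] the [D2] act first, so an innermost [D1] has to be carried past all of them by
    [schwarz]. *)
Lemma partial_D1 i j f : Cinf f -> partial i j (D1 f) = partial i.+1 j f.
Proof.
move=> hf; rewrite /partial iterSr; congr iter; elim: j => [//|j IH] /=.
by rewrite IH schwarz//; have /(_ 2%N) := Cinf_partial 0 j hf.
Qed.

Lemma partial_D2 i j f : partial i j (D2 f) = partial i j.+1 f.
Proof. by rewrite /partial -iterSr. Qed.

Lemma L2ip_partial D i j f phi : Cinf f -> test_function D phi ->
  L2ip D f (partial i j phi) = (-1) ^+ (i + j) * L2ip D (partial i j f) phi.
Proof.
elim: i f phi => [|i IH] f phi hf h.
  elim: j f hf => [|j IH] f hf; first by rewrite expr0 mul1r.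
  change (partial 0 j.+1 phi) with (D2 (partial 0 j phi)).
  rewrite (L2ip_D2 hf (testfn_partial 0 j h)) (IH _ (Cinf_D2 hf)) partial_D2.
  by rewrite !add0n exprS mulN1r mulNr.
change (partial i.+1 j phi) with (D1 (partial i j phi)).
rewrite (L2ip_D1 hf (testfn_partial i j h)).
by rewrite (IH _ _ (Cinf_D1 hf) h) (partial_D1 _ _ hf) addSn exprS mulN1r mulNr.
Qed.

Lemma weak_partial_smooth D i j f : Cinf f -> L2 D (partial i j f) ->
  weak_partial_of D i j f (partial i j f).
Proof. by move=> hf hL; split => // phi; exact: L2ip_partial. Qed.

End TestFunctions.

(** * Smooth cutoff functions built from exp(-1/x) *)

Section SmoothCutoff.
Context {R : realType}.
Local Notation mR := (measurableTypeR R).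
Local Notation plane := (mR * mR)%type.
Implicit Types (D : set (R * R)) (p : {poly R}).

Lemma expn_expRN_bounded n : exists C : R, forall u : R, 0 <= u -> u ^+ n * expR (- u) <= C.
Proof.
case: n => [|n].
  exists 1 => u u0; rewrite expr0 mul1r -expR0 ler_expR; lra.
(* For the exponent m = n+1, [exp u] is the m-th power of [exp (u / m)], which is at least
   [u / m]. *)
exists (n.+1%:R ^+ n.+1) => u u0; rewrite expRN ler_pdivrMr ?expR_gt0//.
have -> : expR u = expR (u / n.+1%:R) ^+ n.+1.
  by rewrite -expRM_natl mulrC divfK// pnatr_eq0.
rewrite -exprMn lerXn2r ?nnegrE ?mulr_ge0 ?expR_ge0//.
rewrite mulrC -ler_pdivrMr ?ltr0n//.
by apply: le_trans (expR_ge1Dx _); rewrite lerDr.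
Qed.

Lemma horner_expRN_bounded p : exists C : R, 0 <= C /\
  forall u : R, 0 <= u -> `|p.[u] * expR (- u)| <= C.
Proof.
have [B hB] := choice expn_expRN_bounded.
have B0 n : 0 <= B n.
  by apply: le_trans (hB n 1 ler01); rewrite mulr_ge0 ?exprn_ge0 ?expR_ge0.
exists (\sum_(i < size p) `|p`_i| * B i); split.
  by apply: sumr_ge0 => i _; rewrite mulr_ge0.
move=> u u0; rewrite horner_coef mulr_suml; apply: le_trans (ler_norm_sum _ _ _) _.
apply: ler_sum => i _; rewrite -mulrA normrM ler_wpM2l//.
by rewrite ger0_norm ?hB// mulr_ge0 ?exprn_ge0 ?expR_ge0.
Qed.

(** The family p(1/x) exp(-1/x) is stable under differentiation, which reduces the smoothness of
    exp(-1/x) to a recursion on polynomials. *)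
Definition flat p (x : R) : R := if 0 < x then p.[x^-1] * expR (- x^-1) else 0.

Lemma is_derive_flat p (x : R) : is_derive x 1 (flat p) (flat ('X^2 * (p - p^`()%R)) x).
Proof.
have [x0|x0|->] := ltgtP x 0.
- rewrite {2}/flat ltNge (ltW x0) /=.
  have e0 : \forall y \near x, cst 0 y = flat p y.
    have : \forall y \near x, y < 0 by exact: lt_nbhsl.
    by apply: filterS => y y0; rewrite /flat ltNge (ltW y0).
  exact: near_eq_is_derive e0 (is_derive_cst _ _ _).
- rewrite {2}/flat x0.
  have e0 : \forall y \near x, p.[y^-1] * expR (- y^-1) = flat p y.
    have : \forall y \near x, 0 < y by exact: lt_nbhsr.
    by apply: filterS => y y0; rewrite /flat y0.
  have xn0 : x != 0 by rewrite gt_eqF.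
  have dV : is_derive x 1 (fun y : R => y^-1) (- x^-2).
    apply: (is_derive_eq (is_deriveV (f := fun y : R => y) xn0 (is_derive_id x 1))).
    by rewrite /GRing.scale /= mulr1.
  have dN : is_derive x 1 (fun y : R => - y^-1) (x^-2).
    by have := is_deriveN dV; rewrite opprK.
  have dE := @is_derive1_comp _ expR (fun y : R => - y^-1) x _ _ (is_derive_expR (- x^-1)) dN.
  have dh : is_derive x^-1 1 (horner p) (p^`()%R).[x^-1].
    by rewrite derivE derive1E; apply: derivableP; exact: derivable_horner.
  have dP := @is_derive1_comp _ (horner p) (fun y : R => y^-1) x _ _ dh dV.
  apply: near_eq_is_derive e0 _.
  apply: (@is_derive_eq _ _ _ _ _ _ _ _ (is_deriveM dP dE)).
  rewrite /GRing.scale /= !hornerE /= exprVn; ring.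
rewrite {2}/flat ltxx.
(* At 0, with u = 1/h, the difference quotient is h times u^2 p(u) exp(-u), whose second factor is
   bounded. *)
have [C [C0 hC]] := horner_expRN_bounded ('X^2 * p).
apply/is_derive_cvg.
apply: (@cvg_dist_le _ _ _ _ (fun h : R => C * h) 0 0); last first.
  by rewrite -[X in _ --> X](mulr0 C); apply: cvgM; [exact: cvg_cst|exact: nbhs_dnbhs].
move=> h; rewrite !subr0 addr0 {2}/flat ltxx subr0 normrM [X in _ <= X]normrM (ger0_norm C0).
rewrite /flat; case: ifPn => h0; last by rewrite normr0 mulr0 mulr_ge0.
have := hC h^-1; rewrite invr_ge0 (ltW h0) => /(_ isT).
rewrite !hornerE /= -mulrA normrM normfV (gtr0_norm h0) => hh.
have hi : 0 < h^-1 by rewrite invr_gt0.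
rewrite normrX (gtr0_norm hi) in hh.
have -> : h^-1 * `|p.[h^-1] * expR (- h^-1)| = h * (h^-1 ^+ 2 * `|p.[h^-1] * expR (- h^-1)|).
  by rewrite mulrA expr2 mulrA mulfV ?mul1r// gt_eqF.
by rewrite mulrC ler_wpM2r// ltW.
Qed.

Definition flat_iter (m : nat) : {poly R} := iter m (fun p => 'X^2 * (p - p^`()%R)) 1.

Definition cut (x : R) : R := flat 1 x.

Lemma cutE (x : R) : cut x = if 0 < x then expR (- x^-1) else 0.
Proof. by rewrite /cut /flat hornerC mul1r. Qed.

Lemma cut_ge0 x : 0 <= cut x.
Proof. by rewrite cutE; case: ifP => // _; exact: expR_ge0. Qed.

Lemma cut_le1 x : cut x <= 1.
Proof.
rewrite cutE; case: ifP => // x0.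
by rewrite -expR0 ler_expR oppr_le0 invr_ge0 ltW.
Qed.

Lemma cut_gt0 x : (0 < cut x) = (0 < x).
Proof. by rewrite cutE; case: ifPn => [|_]; rewrite ?expR_gt0 ?ltxx. Qed.

Lemma Cinf_cut1 : Cinf (fun z : R * R => cut z.1).
Proof. by move=> n; apply: (@Cn_coord1 _ n (fun m => flat (flat_iter m))) => m x; exact: is_derive_flat. Qed.

Lemma Cinf_cut2 : Cinf (fun z : R * R => cut z.2).
Proof. by move=> n; apply: (@Cn_coord2 _ n (fun m => flat (flat_iter m))) => m x; exact: is_derive_flat. Qed.

(** Each factor has the shape of [cut] after a [homothety] of ratio 1 or -1, so its smoothness
    follows by conversion. *)
Definition bump (a b c d : R) (z : R * R) : R :=
  (cut (- a + 1 * z.1) * cut (b + -1 * z.1)) * (cut (- c + 1 * z.2) * cut (d + -1 * z.2)).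

Lemma Cinf_bump a b c d : Cinf (bump a b c d).
Proof.
apply: CinfM; apply: CinfM.
- exact: (Cinf_homothety (- a, - c) 1 Cinf_cut1).
- exact: (Cinf_homothety (b, d) (-1) Cinf_cut1).
- exact: (Cinf_homothety (- a, - c) 1 Cinf_cut2).
- exact: (Cinf_homothety (b, d) (-1) Cinf_cut2).
Qed.

Lemma bump_ge0 a b c d z : 0 <= bump a b c d z.
Proof. by rewrite !mulr_ge0// cut_ge0. Qed.

Lemma bump_le1 a b c d z : bump a b c d z <= 1.
Proof.
by rewrite /bump !mulr_ile1// ?mulr_ge0 ?cut_ge0 ?cut_le1// mulr_ile1 ?cut_ge0 ?cut_le1.
Qed.

Lemma bump_gt0 a b c d z : (0 < bump a b c d z) = (a < z.1 < b) && (c < z.2 < d).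
Proof.
have K (x y : R) : 0 <= x -> 0 <= y -> (0 < x * y) = (0 < x) && (0 < y).
  move=> x0 y0; rewrite !lt_def x0 y0 mulr_ge0// mulf_eq0 negb_or !andbT //.
rewrite /bump !K ?mulr_ge0 ?cut_ge0// !cut_gt0.
by rewrite !mul1r !mulN1r !subr_gt0 ![- _ + _]addrC !subr_gt0.
Qed.

Lemma bump_eq0 a b c d z : ~ ((`]a, b[ `*` `]c, d[) z) -> bump a b c d z = 0.
Proof.
move=> h; apply/eqP; rewrite eq_le bump_ge0 andbT leNgt bump_gt0.
by apply/negP => /andP[h1 h2]; apply: h; split; rewrite /= in_itv.
Qed.

Lemma compact_box (a b c d : R) : compact (`[a, b] `*` `[c, d] : set (R * R)).
Proof. by apply: compact_setX; exact: segment_compact. Qed.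

Lemma testfn_bump D a b c d : `[a, b] `*` `[c, d] `<=` D ->
  test_function D (bump a b c d).
Proof.
move=> h; apply: (testfn_intro (@compact_box a b c d) h); first exact: Cinf_bump.
move=> z hz; apply: bump_eq0 => -[/=]; rewrite !in_itv /= => /andP[h1 h2] /andP[h3 h4].
by apply: hz; split; rewrite /= in_itv /= !ltW.
Qed.

(* [1 - (1 - bump)^n] increases to the indicator function of the open box. *)
Definition bumpn a b c d (n : nat) (z : R * R) : R := 1 - (1 + -1 * bump a b c d z) ^+ n.

Lemma Cinf_X (f : R * R -> R) n : Cinf f -> Cinf (fun z => f z ^+ n).
Proof.
move=> hf; elim: n => [|n IH].
  by rewrite (_ : (fun _ => _) = fun=> 1); [exact: Cinf_cst|apply/funext => z; rewrite expr0].
rewrite (_ : (fun _ => _) = fun z => f z * f z ^+ n); first exact: CinfM.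
by apply/funext => z; rewrite exprS.
Qed.

Lemma bumpn_eq0 a b c d n z : ~ ((`]a, b[ `*` `]c, d[) z) -> bumpn a b c d n z = 0.
Proof. by move=> h; rewrite /bumpn bump_eq0// mulr0 addr0 expr1n subrr. Qed.

Lemma testfn_bumpn D a b c d n : `[a, b] `*` `[c, d] `<=` D ->
  test_function D (bumpn a b c d n).
Proof.
move=> h; apply: (testfn_sub (testfn_bump h)).
  rewrite (_ : bumpn _ _ _ _ _ = fun z => 1 + -1 * (1 + -1 * bump a b c d z) ^+ n).
    apply: CinfD; first exact: Cinf_cst.
    apply: CinfZ; apply: Cinf_X; apply: CinfD; first exact: Cinf_cst.
    by apply: CinfZ; exact: Cinf_bump.
  by apply/funext => z; rewrite mulN1r.
by move=> z /notin_supp hz; rewrite /bumpn hz mulr0 addr0 expr1n subrr.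
Qed.

Lemma bumpn_ge0 a b c d n z : 0 <= bumpn a b c d n z.
Proof.
have h0 := bump_ge0 a b c d z; have h1 := bump_le1 a b c d z.
by rewrite /bumpn subr_ge0 exprn_ile1//; lra.
Qed.

Lemma bumpn_le1 a b c d n z : bumpn a b c d n z <= 1.
Proof.
have h1 := bump_le1 a b c d z.
by rewrite /bumpn gerBl exprn_ge0//; lra.
Qed.

Lemma bumpn_cvg a b c d z : bumpn a b c d n z @[n --> \oo] --> (\1_(`]a, b[ `*` `]c, d[) z : R).
Proof.
have [h|h] := pselect ((`]a, b[ `*` `]c, d[) z); last first.
  rewrite indicE memNset//; under eq_fun do rewrite bumpn_eq0//; exact: cvg_cst.
rewrite indicE mem_set// -[X in _ --> X]subr0; apply: cvgB; first exact: cvg_cst.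
apply: cvg_expr.
have h1 := bump_le1 a b c d z.
have h0 : 0 < bump a b c d z.
  by rewrite bump_gt0; case: h => /=; rewrite !in_itv /= => -> ->.
by rewrite ltr_norml; apply/andP; split; lra.
Qed.

End SmoothCutoff.

(** * Density of test functions in L2(D), duality, and uniqueness of weak derivatives *)

Section Density.
Context {R : realType}.
Local Notation mR := (measurableTypeR R).
Local Notation plane := (mR * mR)%type.
Variable D : set (R * R).
Hypotheses (oD : open D) (fD : (leb2 D < +oo)%E).
Implicit Types (u v g phi : R * R -> R) (X Y : set plane).

Let mD : measurable (D : set plane) := open_measurable2 oD.

Definition test_approx u := L2 D u /\
  forall e, 0 < e -> exists phi, test_function D phi /\ L2norm D (fun z => u z - phi z) <= e.

Lemma test_approx_lim u : L2 D u ->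
  (forall e, 0 < e -> exists v, test_approx v /\ L2norm D (fun z => u z - v z) <= e) ->
  test_approx u.
Proof.
move=> hu h; split => // e e0; have e2 : 0 < e / 2 by rewrite divr_gt0.
have [v [[hv /(_ _ e2) [phi [tphi h2]]] h1]] := h _ e2.
exists phi; split => //; have hphi := testfn_L2 mD tphi.
rewrite (@eq_L2norm _ _ _ (fun z => (u z - v z) + (v z - phi z))); last by move=> z _; ring.
apply: le_trans (ler_L2normD mD (L2B hu hv) (L2B hv hphi)) _; lra.
Qed.

Lemma eq_test_approx u v : (forall z, D z -> u z = v z) -> test_approx u -> test_approx v.
Proof.
move=> uv [hu h]; split; first exact: eq_L2 uv hu.
move=> e /h [phi [t hphi]]; exists phi; split => //.
by rewrite -(@eq_L2norm _ _ (fun z => u z - phi z))// => z Dz; rewrite uv.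
Qed.

Lemma test_approx0 : test_approx (fun=> 0).
Proof.
split; first by apply: testfn_L2 => //; exact: (@testfn0 _ D).
move=> e e0; exists (fun=> 0); split; first exact: testfn0.
rewrite (_ : L2norm _ _ = 0) ?ltW//.
rewrite /L2norm (@eq_L2ip _ _ _ _ (fun=> 0) (fun=> 0)); last by move=> z _; rewrite subr0.
by rewrite /L2ip; under eq_Rintegral do rewrite mulr0; rewrite Rintegral_cst// mul0r sqrtr0.
Qed.

Lemma test_approxD u v : test_approx u -> test_approx v -> test_approx (fun z => u z + v z).
Proof.
move=> [hu h1] [hv h2]; split; first exact: L2D.
move=> e e0; have e2 : 0 < e / 2 by rewrite divr_gt0.
have [p [tp hp]] := h1 _ e2; have [q [tq hq]] := h2 _ e2.
exists (fun z => p z + q z); split; first exact: testfnD.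
have L2p := testfn_L2 mD tp; have L2q := testfn_L2 mD tq.
rewrite (@eq_L2norm _ _ _ (fun z => (u z - p z) + (v z - q z))); last by move=> z _; ring.
apply: le_trans (ler_L2normD mD (L2B hu L2p) (L2B hv L2q)) _; lra.
Qed.

Lemma test_approxZ c u : test_approx u -> test_approx (fun z => c * u z).
Proof.
move=> [hu h]; split; first exact: L2Z.
move=> e e0; have e2 : 0 < e / (`|c| + 1) by rewrite divr_gt0// ltr_wpDl.
have [p [tp hp]] := h _ e2; exists (fun z => c * p z); split; first exact: testfnZ.
have L2p := testfn_L2 mD tp.
rewrite (@eq_L2norm _ _ _ (fun z => c * (u z - p z))); last by move=> z _; ring.
rewrite L2normZ//; last exact: L2B.
apply: (@le_trans _ _ ((`|c| + 1) * (e / (`|c| + 1)))); last first.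
  by rewrite mulrCA divff ?mulr1// gt_eqF// ltr_wpDl.
by apply: ler_pM => //; [exact: L2norm_ge0|rewrite lerDl].
Qed.

Lemma test_approxB u v : test_approx u -> test_approx v -> test_approx (fun z => u z - v z).
Proof.
move=> hu /(test_approxZ (-1)) /(test_approxD hu).
by apply: eq_test_approx => z _; rewrite mulN1r.
Qed.

Lemma test_approx_sum (n : nat) (F : nat -> R * R -> R) :
  (forall i, test_approx (F i)) -> test_approx (fun z => \sum_(i < n) F i z).
Proof.
move=> hF; elim: n => [|n IH].
  by apply: eq_test_approx test_approx0 => z _; rewrite big_ord0.
by apply: eq_test_approx (test_approxD IH (hF n)) => z _; rewrite big_ord_recr.
Qed.

Lemma ler_norm_sqr (x y : R) : `|x| <= `|y| -> x ^+ 2 <= y ^+ 2.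
Proof.
by move=> h; rewrite -(real_normK (num_real x)) -(real_normK (num_real y)) lerXn2r ?nnegrE.
Qed.

Lemma L2norm_dominated (u_ : nat -> R * R -> R) u g :
  (forall n, L2 D (u_ n)) -> L2 D u -> L2 D g ->
  (forall n z, D z -> `|u_ n z| <= `|g z|) ->
  (forall z, D z -> u_ n z @[n --> \oo] --> u z) ->
  forall e, 0 < e -> exists n, L2norm D (fun z => u z - u_ n z) <= e.
Proof.
move=> hu_ hu hg ug cu e e0.
have i2 w : L2 D w -> leb2.-integrable (D : set plane) (EFin \o (fun z => w z * w z)).
  by move=> hw; exact: L2_integrableM.
have hd n := L2B hu (hu_ n).
pose f_ (n : nat) (z : plane) := ((u z - u_ n z) * (u z - u_ n z))%:E.
(* From [(u - u_n)^2 <= 2 u^2 + 2 u_n^2] and [|u_n| <= |g|]. *)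
pose G (z : plane) := ((2 * u z) * u z + (2 * g z) * g z)%:E.
have iG : leb2.-integrable (D : set plane) G.
  rewrite /G; under eq_fun do rewrite EFinD.
  by apply: integrableD => //; apply: L2_integrableM => //; exact: L2Z.
have mf n : measurable_fun (D : set plane) (f_ n) by exact: measurable_int (i2 _ (hd n)).
have ff : {ae leb2, forall z, (D : set plane) z -> f_ ^~ z @ \oo --> (cst 0%E) z}.
  apply: aeW => z Dz; rewrite /f_ /=; apply: cvg_EFin; first exact: nearW.
  have : u z - u_ n z @[n --> \oo] --> (0 : R).
    by rewrite -(subrr (u z)); apply: cvgB; [exact: cvg_cst|exact: cu].
  by move=> c0; rewrite -[X in _ --> X](mulr0 (0 : R)); apply: cvgM.
have fG : {ae leb2, forall z n, (D : set plane) z -> (`|f_ n z| <= G z)%E}.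
  apply: aeW => z n Dz; rewrite /f_ /G lee_fin.
  rewrite ger0_norm; last by rewrite -expr2 sqr_ge0.
  have h := ler_norm_sqr (ug n z Dz); have := sqr_ge0 (u z + u_ n z).
  move: h; move: (u z) (u_ n z) (g z) => x y w; nra.
have [_ _ ] := dominated_convergence mD mf (measurable_cst _) ff iG fG.
rewrite integral0 => /fine_cvg /= h.
have /cvgrPdist_le/(_ (e ^+ 2)) := h; rewrite exprn_gt0// => /(_ isT) [N _ hN].
exists N; have := hN N (leqnn N); rewrite /= sub0r normrN => hh.
rewrite -(ger0_norm (ltW e0)) -sqrtr_sqr; apply: ler_wsqrtr.
exact: le_trans (ler_norm _) hh.
Qed.

Lemma test_approx_dominated (u_ : nat -> R * R -> R) u g :
  (forall n, test_approx (u_ n)) -> L2 D u -> L2 D g ->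
  (forall n z, D z -> `|u_ n z| <= `|g z|) ->
  (forall z, D z -> u_ n z @[n --> \oo] --> u z) -> test_approx u.
Proof.
move=> h hu hg ug cu; apply: test_approx_lim => // e e0.
have [n hn] := L2norm_dominated (fun n => (h n).1) hu hg ug cu e0.
by exists (u_ n); split.
Qed.

Lemma L2_indic X : measurable X -> L2 D (\1_X : R * R -> R).
Proof.
move=> mX; apply: (@L2_bounded _ _ _ 1) => //.
  by apply: measurable_restrict2 => //; exact: measurable_indic.
by move=> z _; rewrite indicE; case: (_ \in _); rewrite ?normr1 ?normr0.
Qed.

Lemma norm_indic_le1 X z : `|\1_X z : R| <= `|1|.
Proof. by rewrite indicE; case: (_ \in _); rewrite ?normr1 ?normr0. Qed.

Lemma L2_1 : L2 D (fun=> 1). Proof. exact: L2_cst. Qed.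

Lemma test_approx_box a b c d : `[a, b] `*` `[c, d] `<=` D ->
  test_approx (\1_(`]a, b[ `*` `]c, d[ : set plane)).
Proof.
move=> h; apply: (@test_approx_dominated (bumpn a b c d) _ (fun=> 1)).
- move=> n; have t := testfn_bumpn n h; split; first exact: testfn_L2 t.
  move=> e e0; exists (bumpn a b c d n); split => //.
  rewrite (@eq_L2norm _ _ _ (fun=> 0)); last by move=> z _; rewrite subrr.
  by rewrite /L2norm /L2ip; under eq_Rintegral do rewrite mulr0; rewrite Rintegral_cst// mul0r sqrtr0 ltW.
- by apply: L2_indic; exact: measurable_box.
- exact: L2_1.
- by move=> n z _; rewrite normr1 ger0_norm ?bumpn_ge0 ?bumpn_le1.
- by move=> z _; exact: bumpn_cvg.
Qed.

Lemma test_approx_setD X Y : Y `<=` X ->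
  test_approx (\1_X) -> test_approx (\1_Y) -> test_approx (\1_(X `\` Y)).
Proof.
move=> YX hX hY; apply: eq_test_approx (test_approxB hX hY) => z _.
rewrite !indicE in_setD.
case: (boolP (z \in Y)) => zY; last by rewrite subr0 andbT.
by rewrite (mem_set (YX _ (set_mem zY))) subrr.
Qed.

(** The indicators of the partial unions converge pointwise and are dominated by 1, which is in L2
    because [D] has finite measure. *)
Lemma test_approx_bigcup (F : nat -> set plane) : (forall n, measurable (F n)) ->
  trivIset setT F -> (forall n, test_approx (\1_(F n))) -> test_approx (\1_(\bigcup_n F n)).
Proof.
move=> mF tF hF.
apply: (@test_approx_dominated (fun n => \1_(\big[setU/set0]_(i < n) F i)) _ (fun=> 1)).
- elim=> [|n IH].
    by apply: eq_test_approx test_approx0 => z _; rewrite big_ord0 indic0.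
  apply: eq_test_approx (test_approxD IH (hF n)) => z _.
  rewrite big_ord_recr /= !indicE in_setU.
  case: (boolP (z \in F n)) => zn; last by rewrite orbF addr0.
  rewrite (_ : z \in _ = false) ?add0r//; apply/negbTE; rewrite notin_setE.
  rewrite -bigcup_mkord => -[i /= ilt zi].
  have := tF i n I I; rewrite (_ : (i = n) = False); last first.
    by apply/propext; split => // e; rewrite e ltnn in ilt.
  by apply; exists z; split => //; rewrite inE in zn.
- by apply: L2_indic; exact: bigcupT_measurable.
- exact: L2_1.
- by move=> n z _; exact: norm_indic_le1.
- move=> z _; have [[N _ zN]|h] := pselect ((\bigcup_n F n) z).
    apply: cvg_near_cst; exists N.+1 => //= n Nn.
    have h1 : z \in \bigcup_n F n by rewrite inE; exists N.
    have h2 : z \in \big[setU/set0]_(i < n) F i by rewrite inE -bigcup_mkord; exists N.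
    by rewrite !indicE h1 h2.
  apply: cvg_near_cst; apply: nearW => n; rewrite !indicE !memNset//.
  by apply: contra_not h; rewrite -bigcup_mkord => -[i _ zi]; exists i.
Qed.

(** * Indicators of measurable subsets of one box *)

Section GoodBox.
Variables (a b c d : R).
Hypothesis abcd : `[a, b] `*` `[c, d] `<=` D.
Let Q : set plane := `]a, b[ `*` `]c, d[.
(** Cutting by a fixed box whose closure lies in [D] turns every product of open intervals into such
    a box. Three Dynkin arguments then reach Borel sets in the first factor, in the second, and
    finally all measurable sets of the product. *)
Let P X := test_approx (\1_(X `&` Q)).
Let G := @RGenOpens.G R.

Let setI_closed_G : setI_closed G.
Proof.
move=> _ _ [x1 [y1 ->]] [x2 [y2 ->]]; exists (Num.max x1 x2), (Num.min y1 y2).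
apply/seteqP; split => x /=; rewrite !in_itv /= gt_max lt_min.
  by move=> [/andP[-> ->] /andP[-> ->]].
by move=> /andP[/andP[-> ->] /andP[-> ->]].
Qed.

Let PD X Y : Y `<=` X -> P X -> P Y -> P (X `\` Y).
Proof.
move=> YX hX hY; rewrite /P (_ : (X `\` Y) `&` Q = (X `&` Q) `\` (Y `&` Q)).
  by apply: test_approx_setD => //; exact: setSI.
apply/seteqP; split => z; first by move=> [[zX nY] zQ]; split => // -[].
by move=> [[zX zQ] n]; split => //; split => // zY; apply: n.
Qed.

Let P_bigcup (F : nat -> set plane) : (forall n, measurable (F n)) ->
  trivIset setT F -> (forall n, P (F n)) -> P (\bigcup_n F n).
Proof.
move=> mF tF hF; rewrite /P setI_bigcupl; apply: test_approx_bigcup => //.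
  by move=> n; apply: measurableI => //; exact: measurable_box.
by apply: trivIset_setIr.
Qed.

Let P_GG I J : G I -> G J -> P (I `*` J).
Proof.
move=> [x1 [y1 ->]] [x2 [y2 ->]].
rewrite /P /Q (_ : _ `&` _ = `]Num.max x1 a, Num.min y1 b[ `*` `]Num.max x2 c, Num.min y2 d[).
  apply: test_approx_box; apply: subset_trans abcd => z [] /=; rewrite !in_itv /= !ge_max !le_min.
  by move=> /andP[/andP[_ ->] /andP[_ ->]] /andP[/andP[_ ->] /andP[_ ->]].
apply/seteqP; split => z; rewrite /setX /setI /= !in_itv /= !gt_max !lt_min.
  by move=> [[/andP[-> ->] /andP[-> ->]] [/andP[-> ->] /andP[-> ->]]].
by move=> [/andP[/andP[-> ->] /andP[-> ->]] /andP[/andP[-> ->] /andP[-> ->]]].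
Qed.

Let PT X Y : X `&` Q = Y `&` Q -> P X -> P Y.
Proof. by rewrite /P => ->. Qed.

Let P_AG (A : set mR) J : measurable A -> G J -> P (A `*` J).
Proof.
move=> mA GJ.
have mG K : G K -> measurable (K : set mR).
  by move=> [x [y ->]]; exact: measurable_itv.
(* The whole line is not in the generating class [G]; after intersection with [Q] it may be replaced
   by the open interval from [a] to [b]. *)
have PTJ : P (setT `*` J).
  apply: PT (P_GG (ex_intro _ a (ex_intro _ b erefl)) GJ).
  rewrite /Q; apply/seteqP; split => z; rewrite /setX /setI /=; first by move=> [[]].
  by move=> [[_ ?] [? ?]].
rewrite (@RGenOpens.measurableE R) in mA.
apply: (@dynkin_induction _ mR G (fun A => P (A `*` J)) (@RGenOpens.measurableE R) setI_closed_G) mA.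
- exact: PTJ.
- by move=> I GI; exact: P_GG.
- move=> S mS PS; rewrite (_ : _ `*` _ = (setT `*` J) `\` (S `*` J)); first by apply: PD => // z [].
  apply/seteqP; split => z /=; first by move=> [h1 h2]; split => // -[].
  by move=> [[_ h1] h2]; split => // h3; apply: h2.
- move=> F mF tF hF; rewrite (_ : _ `*` _ = \bigcup_k (F k `*` J)).
    apply: P_bigcup => // [n|]; first by apply: measurableX => //; exact: mG.
    by move=> i j _ _ [z [[z1 _] [z2 _]]]; apply: tF => //; exists z.1.
  by apply/seteqP; split => z /=; [move=> [[n _ ?] ?]; exists n|move=> [n _ [? ?]]; split => //; exists n].
Qed.

Let P_AB (A B : set mR) : measurable A -> measurable B -> P (A `*` B).
Proof.
move=> mA mB.
have PAT : P (A `*` setT).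
  apply: PT (P_AG mA (ex_intro _ c (ex_intro _ d erefl))).
  rewrite /Q; apply/seteqP; split => z; rewrite /setX /setI /=; first by move=> [[]].
  by move=> [[? _] [? ?]].
rewrite (@RGenOpens.measurableE R) in mB.
apply: (@dynkin_induction _ mR G (fun B => P (A `*` B)) (@RGenOpens.measurableE R) setI_closed_G) mB.
- exact: PAT.
- by move=> I GI; exact: P_AG.
- move=> S mS PS; rewrite (_ : _ `*` _ = (A `*` setT) `\` (A `*` S)); first by apply: PD => // z [].
  apply/seteqP; split => z /=; first by move=> [h1 h2]; split => // -[].
  by move=> [[h1 _] h2]; split => // h3; apply: h2.
- move=> F mF tF hF; rewrite (_ : _ `*` _ = \bigcup_k (A `*` F k)).
    apply: P_bigcup => // [n|]; first exact: measurableX.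
    by move=> i j _ _ [z [[_ z1] [_ z2]]]; apply: tF => //; exists z.2.
  by apply/seteqP; split => z /=; [move=> [? [n _ ?]]; exists n|move=> [n _ [? ?]]; split => //; exists n].
Qed.

Lemma test_approx_sub_box X : measurable X -> test_approx (\1_(X `&` Q)).
Proof.
move=> mX; rewrite measurable_prod_measurableType in mX.
apply: (@dynkin_induction _ plane [set A `*` B | A in measurable & B in measurable] P (@measurable_prod_measurableType _ _ mR mR)) mX.
- move=> _ _ [A mA [B mB <-]] [A' mA' [B' mB' <-]].
  by exists (A `&` A'); [exact: measurableI|exists (B `&` B'); [exact: measurableI|rewrite setXI]].
- by rewrite -setXTT; exact: P_AB.
- by move=> _ [A mA [B mB <-]]; exact: P_AB.
- move=> S mS PS; rewrite -setTD; apply: PD => //.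
  by rewrite -setXTT; exact: P_AB.
- by move=> F mF tF hF; exact: P_bigcup.
Qed.

End GoodBox.

Lemma test_approx_indic X : measurable X -> test_approx (\1_X).
Proof.
move=> mX; have mB := measurable_box_cover D.
(* The cover of [D] is made disjoint; each piece is empty or lies in a single box, where the
   previous lemma applies. *)
have mS n : measurable (seqDU (box_cover D) n).
  by apply: measurableD => //; exact: bigsetU_measurable.
have h : test_approx (\1_(\bigcup_n (X `&` seqDU (box_cover D) n))).
  apply: test_approx_bigcup.
  - by move=> n; exact: measurableI.
  - by apply: trivIset_setIl; exact: trivIset_seqDU.
  - move=> n; have sub : seqDU (box_cover D) n `<=` box_cover D n by apply: subDsetl.
    have [e|[a [b [c [d [_ _ abcd e]]]]]] := box_coverP D n.
      rewrite (_ : _ `&` _ = set0); last by apply/seteqP; split => // z [_ /sub]; rewrite e.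
      by apply: eq_test_approx test_approx0 => z _; rewrite indic0.
    have := test_approx_sub_box abcd (measurableI _ _ mX (mS n)).
    rewrite -e (_ : _ `&` box_cover D n = X `&` seqDU (box_cover D) n)//.
    by rewrite setIidl// => z [_ /sub].
apply: eq_test_approx h => z Dz.
rewrite -setI_bigcupr -seqDU_bigcup_eq bigcup_box_cover// !indicE in_setI.
by rewrite [z \in D]mem_set// andbT.
Qed.

Import HBNNSimple.

(** Simple functions increase to [u], and [u] itself dominates them. *)
Lemma test_approx_ge0 u : L2 D u -> (forall z, D z -> 0 <= u z) -> test_approx u.
Proof.
move=> hu u0; have mu := L2_measurable hu.
have mU : measurable_fun [set: plane] (EFin \o (u \_ D)) by exact/measurable_EFinP.
have U0 z : 0 <= (u \_ D) z by rewrite patchE; case: ifPn => // /set_mem; exact: u0.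
pose f := nnsfun_approx measurableT mU.
have cf z : f n z @[n --> \oo] --> (u \_ D) z.
  have := cvg_nnsfun_approx measurableT mU (fun z _ => U0 z) (I : setT z).
  by move=> /fine_cvg.
have fle n z : f n z <= (u \_ D) z.
  have nd : nondecreasing_seq (f ^~ z).
    by move=> i j ij; have /lefP := nd_nnsfun_approx measurableT mU ij; exact.
  rewrite -(cvg_lim _ (cf z))//; apply: nondecreasing_cvgn_le => //.
  by apply/cvg_ex; exists ((u \_ D) z).
apply: (@test_approx_dominated f _ u) => //.
- move=> n; pose s : seq R := finmap.enum_fset (fset_set (f n @` setT)).
  have H i : test_approx (fun z => s`_i * \1_(f n @^-1` [set s`_i]) z).
    apply: test_approxZ; apply: test_approx_indic.
    by rewrite -[X in measurable X]setTI; apply: (measurable_funPT (f n)).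
  apply: eq_test_approx (test_approx_sum (size s) H) => z _.
  by rewrite [RHS]fimfunEord.
- move=> n z Dz; rewrite !ger0_norm ?u0//.
  by have := fle n z; rewrite patchE mem_set.
- by move=> z Dz; have := cf z; rewrite patchE mem_set.
Qed.

(** [u] is half the difference of the nonnegative functions [|u| + u] and [|u| - u]. *)
Lemma test_functions_dense u : L2 D u -> test_approx u.
Proof.
move=> hu.
have hn := L2_abs hu.
have h1 : test_approx (fun z => `|u z| + u z).
  apply: test_approx_ge0; first exact: L2D.
  by move=> z _; rewrite -lerBlDl sub0r lerNl -normrN ler_norm.
have h2 : test_approx (fun z => `|u z| - u z).
  by apply: test_approx_ge0; [exact: L2B|move=> z _; rewrite subr_ge0 ler_norm].
apply: eq_test_approx (test_approxZ (2^-1) (test_approxB h1 h2)) => z _; lra.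
Qed.

(** Testing against [phi] close to [g] almost recovers the squared norm of [g]. This is the passage
    from identities against test functions to L2 bounds. *)
Lemma L2norm_le_dual g M : 0 <= M -> L2 D g ->
  (forall phi, test_function D phi -> `|L2ip D g phi| <= M * L2norm D phi) ->
  L2norm D g <= M.
Proof.
move=> M0 hg h; rewrite leNgt; apply/negP => Mg.
set G := L2norm D g in Mg.
have G0 : 0 < G by exact: le_lt_trans M0 Mg.
(* A quarter of the gap is small enough: with [G = M + 4 e], the inequality [G^2 <= G e + M (G + e)]
   reached below would say [2 M e + 12 e^2 <= 0]. *)
pose e := (G - M) / 4; have e0 : 0 < e by rewrite divr_gt0// subr_gt0.
have [_ /(_ _ e0) [phi [t hphi]]] := test_functions_dense hg.
have L2p := testfn_L2 mD t.
have E : G ^+ 2 = L2ip D g (fun z => g z - phi z) + L2ip D g phi.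
  by rewrite -L2ipDr//; [rewrite sqr_L2norm; apply: eq_L2ip => z _; ring|exact: L2B].
have h1 : L2ip D g (fun z => g z - phi z) <= G * e.
  apply: le_trans (ler_norm _) _; apply: le_trans (cauchy_schwarz mD hg (L2B hg L2p)) _.
  by rewrite ler_wpM2l// L2norm_ge0.
have h2 : L2ip D g phi <= M * (G + e).
  apply: le_trans (ler_norm _) _; apply: le_trans (h _ t) _; rewrite ler_wpM2l//.
  rewrite (@eq_L2norm _ _ _ (fun z => g z - (g z - phi z))); last by move=> z _; ring.
  by apply: le_trans (ler_L2normB mD hg (L2B hg L2p)) _; rewrite lerD2l.
have {E h1 h2} : G ^+ 2 <= G * e + M * (G + e) by rewrite E lerD.
have Ee : G = M + 4 * e by rewrite /e; field.
rewrite Ee; nra.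
Qed.

(** The difference is orthogonal to every test function: the dual bound with [M = 0]. *)
Lemma weak_partial_unique i j u g1 g2 :
  weak_partial_of D i j u g1 -> weak_partial_of D i j u g2 ->
  L2norm D (fun z => g1 z - g2 z) = 0.
Proof.
move=> [h1 w1] [h2 w2]; apply/eqP; rewrite eq_le L2norm_ge0 andbT.
apply: L2norm_le_dual => //; first exact: L2B.
move=> phi t; rewrite mul0r normr_le0; have hp := testfn_L2 mD t.
rewrite L2ipBl// subr_eq0.
have s0 : (-1 : R) ^+ (i + j) != 0 by rewrite expf_neq0// oppr_eq0 oner_eq0.
by apply/eqP; apply: (mulfI s0); rewrite -w1// -w2.
Qed.

End Density.

(** * Transport of densities by contraction towards a point *)

Section Poincare.
Context {R : realType}.
Local Notation mR := (measurableTypeR R).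
Local Notation plane := (mR * mR)%type.
Implicit Types (D : set (R * R)) (u v w f phi : R * R -> R) (a x y z : R * R).

(** The two derivatives are arguments, so that the difference of a weak derivative of xi and a
    derivative of a polynomial can be used with its explicit gradient. *)
Definition weak_grad D w w1 w2 := [/\ L2 D w, L2 D w1, L2 D w2,
  forall phi, test_function D phi -> L2ip D w (D1 phi) = - L2ip D w1 phi &
  forall phi, test_function D phi -> L2ip D w (D2 phi) = - L2ip D w2 phi].

(* The image of the density [f] under the homothety of center [a] and ratio [s^-1]. *)
Definition push f a (s : R) y : R :=
  s ^+ 2 * f (a.1 + (y.1 - a.1) * s, a.2 + (y.2 - a.2) * s).

Definition dpush f a (s : R) y : R :=
  let x := (a.1 + (y.1 - a.1) * s, a.2 + (y.2 - a.2) * s) in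
  2 * s * f x + s ^+ 2 * (D1 f x * (y.1 - a.1) + D2 f x * (y.2 - a.2)).

(** The image of the origin under the homothety of center [a] and ratio [s]. *)
Definition push_center a (s : R) : R * R := (a.1 - s * a.1, a.2 - s * a.2).

Lemma homothety_push a s y :
  homothety (push_center a s) s y = (a.1 + (y.1 - a.1) * s, a.2 + (y.2 - a.2) * s).
Proof. by rewrite /homothety /push_center /=; congr pair; ring. Qed.

Lemma pushE f a s : push f a s = fun y => s ^+ 2 * (f \o homothety (push_center a s) s) y.
Proof. by apply/funext => y; rewrite /push /= homothety_push. Qed.

Lemma Cinf_push f a s : Cinf f -> Cinf (push f a s).
Proof. by move=> hf; rewrite pushE; apply: CinfZ; exact: Cinf_homothety. Qed.

Lemma homothety_cancelV a s x : s != 0 ->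
  homothety (push_center a s^-1) s^-1 (homothety (push_center a s) s x) = x.
Proof.
by move=> s0; rewrite /homothety /push_center [RHS]surjective_pairing /=; congr pair; field.
Qed.

Lemma testfn_push D D' f a s : s != 0 -> test_function D f ->
  (forall x, supp f x -> D' (homothety (push_center a s^-1) s^-1 x)) ->
  test_function D' (push f a s).
Proof.
move=> s0 hf hD.
apply: (@testfn_intro _ _ (homothety (push_center a s^-1) s^-1 @` supp f)).
- apply: continuous_compact; last exact: testfn_compact hf.
  by apply: continuous_subspaceT; exact: homothety_continuous.
- by move=> _ [x hx <-]; exact: hD.
- by apply: Cinf_push; exact: testfn_Cinf hf.
move=> y hy; rewrite pushE /= notin_supp ?mulr0// => h; apply: hy.
by exists (homothety (push_center a s) s y) => //; rewrite homothety_cancelV.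
Qed.

Lemma is_derive_push f a y (s : R) : Cinf f ->
  is_derive s 1 (fun s => push f a s y) (dpush f a s y).
Proof.
move=> hf.
have ha (b c : R) : is_derive s 1 (fun s => b + c * s) c by exact: is_derive_affine.
have h1 := is_derive_path (hf 1%N) (ha a.1 (y.1 - a.1)) (ha a.2 (y.2 - a.2)).
have h2 : is_derive s 1 (fun s : R => s ^+ 2) (2 * s).
  have := is_deriveX 2 (is_derive_id s 1); rewrite /GRing.scale /= mulr1 expr1.
  by rewrite mulr_natl.
have := is_deriveM h2 h1; rewrite /GRing.scale /= => h3.
apply: (is_derive_eq h3); rewrite /dpush /=; ring.
Qed.

(** The continuity equation: mass is conserved while a point [y] moves with velocity
    [- (y - a) / s], so the [s]-derivative of the density is the divergence of [(y - a) / s] times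
    the density. *)
Lemma push_div f a (s : R) : Cinf f -> s != 0 ->
  dpush f a s = fun y => s^-1 * (D1 (fun y => (- a.1 + y.1) * push f a s y) y +
                                D2 (fun y => (- a.2 + y.2) * push f a s y) y).
Proof.
move=> hf s0; have hp := Cinf_push a s hf.
have c1 : Cinf (fun z : R * R => - a.1 + z.1) by apply: CinfD; [exact: Cinf_cst|exact: Cinf_fst].
have c2 : Cinf (fun z : R * R => - a.2 + z.2) by apply: CinfD; [exact: Cinf_cst|exact: Cinf_snd].
have hh := Cinf_homothety (push_center a s) s hf.
rewrite (D1M c1 hp) (D2M c2 hp).
have -> : D1 (fun z : R * R => - a.1 + z.1) = fun=> 1.
  apply: D1_is_derive => z; have := is_deriveD (is_derive_cst (- a.1) z (1, 0)) (is_derive_fst z).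
  by rewrite add0r.
have -> : D2 (fun z : R * R => - a.2 + z.2) = fun=> 1.
  apply: D2_is_derive => z; have := is_deriveD (is_derive_cst (- a.2) z (0, 1)) (is_derive_snd z).
  by rewrite add0r.
rewrite pushE (D1Z _ hh) (D2Z _ hh) (D1_homothety _ _ hf) (D2_homothety _ _ hf).
apply/funext => y; rewrite /dpush /= -homothety_push.
by move: (f _) (D1 f _) (D2 f _) => p q r; field.
Qed.

Lemma Rfubini (F : plane * plane -> R) :
  (leb2 \x leb2)%E.-integrable [set: plane * plane] (EFin \o F) ->
  (forall a, leb2.-integrable [set: plane] (fun y => (F (a, y))%:E)) ->
  (forall y, leb2.-integrable [set: plane] (fun a => (F (a, y))%:E)) ->
  Rintegral leb2 setT (fun a => Rintegral leb2 setT (fun y => F (a, y))) =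
  Rintegral leb2 setT (fun y => Rintegral leb2 setT (fun a => F (a, y))).
Proof.
move=> iF i1 i2; rewrite /Rintegral; congr fine.
under eq_integral do rewrite fineK ?(integrable_fin_num measurableT (i1 _))//.
under [RHS]eq_integral do rewrite fineK ?(integrable_fin_num measurableT (i2 _))//.
exact: (Fubini iF).
Qed.

Section Domain.
Variables (D : set (R * R)) (h : R).
Hypotheses (oD : open D) (h0 : 0 < h).
Hypothesis hD : forall x y, D x -> D y -> `|x.1 - y.1| <= h /\ `|x.2 - y.2| <= h.
Let mD : measurable (D : set plane) := open_measurable2 oD.

Lemma leb2_le_diam : (leb2 D <= ((2 * h) ^+ 2)%:E)%E.
Proof.
have [->|/set0P[x Dx]] := eqVneq (D : set plane) set0.
  by rewrite measure0 lee_fin sqr_ge0.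
by apply: (@bounded_measure_lty _ _ x) => // z Dz; exact: hD.
Qed.

Let fD : (leb2 D < +oo)%E.
Proof. exact: le_lt_trans leb2_le_diam (ltry _). Qed.

(** The squared density carries [s^4], and the change of variables takes back [s^2]. *)
Lemma L2norm_push f a (s : R) : 0 < s -> test_function D f -> test_function D (push f a s) ->
  L2norm D (push f a s) = s * L2norm D f.
Proof.
move=> s0 tf tp; have sn0 : s != 0 by rewrite gt_eqF.
rewrite -[s in RHS](gtr0_norm s0) -sqrtr_sqr -sqrtrM ?sqr_ge0//; congr Num.sqrt.
rewrite (L2ip_testfn _ tp) (L2ip_testfn _ tf).
have iff : leb2.-integrable [set: plane] (EFin \o (fun z => f z * f z)).
  by apply: (@testfn_integrable _ D); apply: testfnM => //; exact: testfn_Cinf tf.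
have iT := integrable_homothety (push_center a s) sn0 iff.
rewrite (Rintegral_homothety (push_center a s) sn0 iff) -RintegralZl// -RintegralZl//.
  by apply: eq_Rintegral => z _; rewrite pushE /=; ring.
rewrite /comp; under eq_fun do rewrite EFinM.
exact: integrableZl.
Qed.

Section Transport.
Variables (w w1 w2 f : R * R -> R) (a : R * R).
Hypotheses (ww : weak_grad D w w1 w2) (tf : test_function D f) (Da : D a).
Hypothesis star : forall x (t : R), supp f x -> 0 < t <= 1 -> D (homothety (push_center a t) t x).

Let hw : L2 D w. Proof. by case: ww. Qed.

Lemma testfn_push_star s : 1 <= s -> test_function D (push f a s).
Proof.
move=> s1; have s0 : 0 < s by exact: lt_le_trans ltr01 s1.
apply: (testfn_push _ tf); first by rewrite gt_eqF.
by move=> x hx; apply: star => //; rewrite invr_gt0 s0 invf_le1.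
Qed.

Let Phi (s : R) := L2ip D w (push f a s).

Lemma is_derive_transport (s : R) : 0 < s < 3 -> is_derive s 1 Phi (L2ip D w (dpush f a s)).
Proof.
move=> s03.
have cf := testfn_Cinf tf.
have [M0 [M00 hM0]] := testfn_bounded tf.
have [M1 [M10 hM1]] := testfn_bounded (testfn_D1 tf).
have [M2 [M20 hM2]] := testfn_bounded (testfn_D2 tf).
(* Differentiation under the integral is done on []0, 3[], a neighbourhood of [[1, 2]], where
   [2 s <= 6] and [s^2 <= 9]. *)
pose K := 6 * M0 + 9 * (M1 * h + M2 * h).
have K0 : 0 <= K by rewrite !addr_ge0 ?mulr_ge0// ?addr_ge0 ?mulr_ge0// ltW.
pose F (s : R) (y : plane) := w y * push f a s y.
pose G (y : plane) := K * `|w y|.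
have mp t : measurable_fun [set: plane] (push f a t : plane -> mR).
  by apply: continuous_measurable2; apply: Cinf_continuous; exact: Cinf_push.
have L2p t : L2 D (push f a t).
  apply: (@L2_bounded _ _ _ (t ^+ 2 * M0)) => //; first exact: measurable_restrict2.
  by move=> z _; rewrite /push normrM ger0_norm ?sqr_ge0// ler_wpM2l ?sqr_ge0.
have dF (t : R) y : is_derive t 1 (F ^~ y) (w y * dpush f a t y).
  by apply: is_deriveZ; exact: is_derive_push.
have d1F (t : R) y : partial1of2 F t y = w y * dpush f a t y.
  by rewrite partial1of2E; case: (dF t y).
have intF (t : R) : `]0, 3[%classic t -> leb2.-integrable (D : set plane) (EFin \o F t).
  by move=> _; exact: L2_integrableM.
have derF (t : R) y : `]0, 3[%classic t -> (D : set plane) y -> derivable (F ^~ y) t 1.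
  by move=> _ _; case: (dF t y).
have G0 y : 0 <= G y by rewrite mulr_ge0.
have L2n := L2_abs hw.
have intG : leb2.-integrable (D : set plane) (EFin \o G).
  exact: L2_integrableM mD (L2_cst K mD fD) L2n.
have Gub (t : R) y : `]0, 3[%classic t -> (D : set plane) y -> `|partial1of2 F t y| <= G y.
  rewrite /= in_itv /= => /andP[t0 t3] Dy; rewrite d1F normrM mulrC ler_wpM2r//.
  have [ya1 ya2] := hD Dy Da; rewrite /dpush /K /=.
  set X := (_, _).
  apply: le_trans (ler_normD _ _) _; rewrite !normrM !(gtr0_norm t0) ger0_norm//.
  apply: lerD; first by apply: ler_pM; rewrite ?mulr_ge0 ?(ltW t0)//; lra.
  apply: ler_pM; rewrite ?mulr_ge0 ?(ltW t0)//; first by nra.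
  apply: le_trans (ler_normD _ _) _; rewrite !normrM.
  by apply: lerD; apply: ler_pM.
have Is : `]0, 3[%classic s by rewrite /= in_itv.
have := derivable_under_integral mD Is intF derF G0 intG Gub.
have := differentiation_under_integral mD Is intF derF G0 intG Gub.
rewrite derive1E => E dP; constructor; first exact: dP.
apply: etrans E _; apply: eq_Rintegral => y _.
exact: d1F.
Qed.

(** Integrating the divergence by parts moves the derivatives to [w]. The coordinates of [y - a] are
    at most [h], and the factor [s] of [L2norm_push] cancels the [s^-1] of [push_div], so the bound
    does not depend on [s]. *)
Lemma transport_derive_bound (s : R) : 1 <= s ->
  `|L2ip D w (dpush f a s)| <= h * (L2norm D w1 + L2norm D w2) * L2norm D f.
Proof.
move=> s1; have s0 : 0 < s by exact: lt_le_trans ltr01 s1.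
have sn0 : s != 0 by rewrite gt_eqF.
have [_ hw1 hw2 W1 W2] := ww.
have tp := testfn_push_star s1; have cf := testfn_Cinf tf.
pose p1 y := (- a.1 + y.1) * push f a s y; pose p2 y := (- a.2 + y.2) * push f a s y.
have t1 : test_function D p1.
  by apply: testfnM => //; apply: CinfD; [exact: Cinf_cst|exact: Cinf_fst].
have t2 : test_function D p2.
  by apply: testfnM => //; apply: CinfD; [exact: Cinf_cst|exact: Cinf_snd].
have l1 := testfn_L2 mD t1; have l2 := testfn_L2 mD t2; have lp := testfn_L2 mD tp.
have l11 := testfn_L2 mD (testfn_D1 t1); have l22 := testfn_L2 mD (testfn_D2 t2).
rewrite (push_div a cf sn0) L2ipZr//; last exact: L2D.
rewrite L2ipDr// W1// W2//.
have B (u p : R * R -> R) : L2 D u -> L2 D p -> (forall z, D z -> `|p z| <= h * `|push f a s z|) ->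
    `|L2ip D u p| <= L2norm D u * (h * (s * L2norm D f)).
  move=> hu hp hle; apply: le_trans (cauchy_schwarz mD hu hp) _.
  rewrite ler_wpM2l ?L2norm_ge0// -(L2norm_push s0 tf tp).
  rewrite -(gtr0_norm h0) -L2normZ//; apply: L2norm_le => //; first exact: L2Z.
  by move=> z Dz; rewrite normrM (gtr0_norm h0) hle.
have b1 : `|L2ip D w1 p1| <= L2norm D w1 * (h * (s * L2norm D f)).
  apply: B => // z Dz; rewrite normrM ler_wpM2r// addrC; by have [] := hD Dz Da.
have b2 : `|L2ip D w2 p2| <= L2norm D w2 * (h * (s * L2norm D f)).
  apply: B => // z Dz; rewrite normrM ler_wpM2r// addrC; by have [] := hD Dz Da.
rewrite -opprD mulrN normrN normrM normfV (gtr0_norm s0) mulrC ler_pdivrMr//.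
apply: le_trans (ler_normD _ _) _; apply: le_trans (lerD b1 b2) _.
rewrite le_eqVlt; apply/orP; left; apply/eqP; ring.
Qed.

Lemma transport_bound :
  `|L2ip D w f - L2ip D w (push f a 2)| <= h * (L2norm D w1 + L2norm D w2) * L2norm D f.
Proof.
have -> : L2ip D w f = Phi 1.
  by apply: eq_L2ip => z _; rewrite /push expr1n mul1r !mulr1 !subrKC -surjective_pairing.
have dPhi (s : R) : 0 < s < 3 -> is_derive s 1 Phi (L2ip D w (dpush f a s)).
  exact: is_derive_transport.
have d12 (t : R) : t \in `]1, 2[ -> is_derive t 1 Phi (L2ip D w (dpush f a t)).
  by rewrite in_itv /= => /andP[t1 t2]; apply: dPhi; lra.
have cPhi : {within `[1, 2], continuous Phi}.
  apply: derivable_within_continuous => t; rewrite in_itv /= => /andP[t1 t2].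
  have t03 : 0 < t < 3 by lra.
  by case: (dPhi t t03).
have [c] := @MVT R Phi _ 1 2 (ltr1n _ 2) d12 cPhi.
rewrite in_itv /= => /andP[c1 c2] E.
rewrite distrC E; have -> : (2 - 1 : R) = 1 by lra.
by rewrite mulr1; apply: transport_derive_bound; exact: ltW.
Qed.

End Transport.

(** The weight may be signed: it will be the probability density [theta] once, and the test function
    [f] once. *)
Lemma weighted_mean_bound (theta g : plane -> R) (c K : R) :
  leb2.-integrable [set: plane] (EFin \o theta) ->
  leb2.-integrable [set: plane] (EFin \o (fun a => theta a * g a)) ->
  (forall a, theta a != 0 -> `|c - g a| <= K) ->
  `|c * Rintegral leb2 setT theta - Rintegral leb2 setT (fun a => theta a * g a)| <=
  K * Rintegral leb2 setT (fun a => `|theta a|).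
Proof.
move=> i1 i2 hK.
have ic : leb2.-integrable [set: plane] (EFin \o (fun a => c * theta a)).
  by rewrite /comp; under eq_fun do rewrite EFinM; exact: integrableZl.
have ia : leb2.-integrable [set: plane] (EFin \o (fun a => `|theta a|)).
  exact: (integrable_norm i1).
have iK : leb2.-integrable [set: plane] (EFin \o (fun a => K * `|theta a|)).
  by rewrite /comp; under eq_fun do rewrite EFinM; exact: integrableZl.
have id : leb2.-integrable [set: plane] (EFin \o (fun a => c * theta a - theta a * g a)).
  by rewrite /comp; under eq_fun do rewrite EFinB; exact: integrableB.
rewrite -RintegralZl// -RintegralB// -RintegralZl//.
apply: le_trans (le_normr_Rintegral measurableT id) _.
apply: le_Rintegral => //; first exact: (integrable_norm id).
move=> a _; have [->|ne] := eqVneq (theta a) 0.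
  by rewrite mulr0 mul0r subrr normr0 mulr0.
by rewrite [c * _]mulrC -mulrBr normrM mulrC ler_wpM2r// hK.
Qed.

(** * Averaging the transport over its center *)

Section FubiniPush.
Variables (W theta f : plane -> R).
Hypotheses (iW : leb2.-integrable [set: plane] (EFin \o W))
  (tt : test_function setT theta) (tf : test_function setT f).

Let F (p : plane * plane) : R := theta p.1 * (W p.2 * push f p.1 2 p.2).

Let mF : measurable_fun [set: plane * plane] (F : plane * plane -> mR).
Proof.
have m1 : measurable_fun [set: plane * plane] (fst : _ -> plane) by exact: measurable_fst.
have m2 : measurable_fun [set: plane * plane] (snd : _ -> plane) by exact: measurable_snd.
have m11 : measurable_fun [set: plane * plane] (fun p : plane * plane => p.1.1 : mR).
  exact: (measurableT_comp measurable_fst m1).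
have m12 : measurable_fun [set: plane * plane] (fun p : plane * plane => p.1.2 : mR).
  exact: (measurableT_comp measurable_snd m1).
have m21 : measurable_fun [set: plane * plane] (fun p : plane * plane => p.2.1 : mR).
  exact: (measurableT_comp measurable_fst m2).
have m22 : measurable_fun [set: plane * plane] (fun p : plane * plane => p.2.2 : mR).
  exact: (measurableT_comp measurable_snd m2).
apply: measurable_funM; first exact: (measurableT_comp (testfn_measurable tt) m1).
apply: measurable_funM.
  have /measurable_EFinP mW := measurable_int _ iW.
  exact: (measurableT_comp mW m2).
apply: measurable_funM; first exact: measurable_cst.
apply: (measurableT_comp (testfn_measurable tf)); apply: measurable_fun_pair.
  by apply: measurable_funD => //; apply: measurable_funM => //; exact: measurable_funB.
by apply: measurable_funD => //; apply: measurable_funM => //; exact: measurable_funB.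
Qed.

Let M := projT1 (cid (testfn_bounded tf)).
Let M0 : 0 <= M. Proof. by rewrite /M; case: cid => ? []. Qed.
Let fM z : `|f z| <= M. Proof. by rewrite /M; case: cid => ? []. Qed.

Let FM a y : `|F (a, y)| <= `|theta a| * (`|W y| * (4 * M)).
Proof.
rewrite /F /= !normrM; apply: ler_pM => //; apply: ler_pM => //.
have -> : `|2| * `|2| = 4 :> R by rewrite ger0_norm//; ring.
by rewrite ler_wpM2l.
Qed.

Let i1 a : leb2.-integrable [set: plane] (fun y => (F (a, y))%:E).
Proof.
have iG : leb2.-integrable [set: plane] (EFin \o (fun y => (`|theta a| * (4 * M)) * W y)).
  by rewrite /comp; under eq_fun do rewrite EFinM; exact: integrableZl.
apply: (le_integrable measurableT _ _ iG).
  apply/measurable_EFinP; apply: (measurableT_comp mF); apply: measurable_fun_pair.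
    exact: measurable_cst.
  exact: measurable_id.
move=> y _; rewrite /= lee_fin (le_trans (FM a y))// !normrM !normr_id.
rewrite (ger0_norm M0) (ger0_norm (ler0n _ 4)).
by rewrite [X in _ <= X](_ : _ = `|theta a| * (`|W y| * (4 * M)))//; ring.
Qed.

Let i2 y : leb2.-integrable [set: plane] (fun a => (F (a, y))%:E).
Proof.
have iG : leb2.-integrable [set: plane] (EFin \o (fun a => (`|W y| * (4 * M)) * theta a)).
  rewrite /comp; under eq_fun do rewrite EFinM; apply: integrableZl => //.
  exact: testfn_integrable tt.
apply: (le_integrable measurableT _ _ iG).
  apply/measurable_EFinP; apply: (measurableT_comp mF); apply: measurable_fun_pair.
    exact: measurable_id.
  exact: measurable_cst.
move=> a _; rewrite /= lee_fin (le_trans (FM a y))// !normrM !normr_id.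
rewrite (ger0_norm M0) (ger0_norm (ler0n _ 4)).
by rewrite [X in _ <= X](_ : _ = `|theta a| * (`|W y| * (4 * M)))//; ring.
Qed.

Let iF : (leb2 \x leb2)%E.-integrable [set: plane * plane] (EFin \o F).
Proof.
have mEF : measurable_fun [set: plane * plane] (EFin \o F) by apply/measurable_EFinP; exact: mF.
pose m := [the {sigma_finite_measure set plane -> \bar R} of @leb2 R].
apply: (iffRL (@integrable12ltyP _ _ plane plane R m m _ mEF)).
have iN : leb2.-integrable [set: plane] (EFin \o (fun y => `|W y| * (4 * M))).
  rewrite /comp; under eq_fun do rewrite mulrC EFinM; apply: integrableZl => //.
  exact: (integrable_norm iW).
have it : leb2.-integrable [set: plane] (EFin \o (fun a => `|theta a|)).
  exact: (integrable_norm (testfn_integrable tt)).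
pose C := Rintegral leb2 setT (fun y => `|W y| * (4 * M)).
have CE : (\int[leb2]_y (`|W y| * (4 * M))%:E = C%:E)%E.
  by rewrite /C /Rintegral fineK//; exact: (integrable_fin_num measurableT iN).
apply: (@le_lt_trans _ _ (\int[leb2]_a (C * `|theta a|)%:E)%E); last first.
  have ic : leb2.-integrable [set: plane] (EFin \o (fun a => C * `|theta a|)).
    by rewrite /comp; under eq_fun do rewrite EFinM; exact: integrableZl.
  have := integrable_fin_num measurableT ic.
  by rewrite fin_numElt => /andP[].
apply: ge0_le_integral => //.
- by move=> a _; apply: integral_ge0.
- apply: (measurable_fun_fubini_tonelli_F (fun p => `|(F p)%:E|)%E) => //.
  exact: measurableT_comp.
- apply/measurable_EFinP; apply: measurable_funM; first exact: measurable_cst.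
  by have /integrableP[/measurable_EFinP] := it.
move=> a _; apply: (@le_trans _ _ (\int[leb2]_y (`|theta a|%:E * (`|W y| * (4 * M))%:E))%E).
  apply: ge0_le_integral => //.
  + by apply: measurableT_comp => //; have /integrableP[] := i1 a.
  + apply: emeasurable_funM; first exact: measurable_cst.
    by have /integrableP[] := iN.
  + by move=> y _; rewrite -EFinM lee_fin; exact: FM.
rewrite ge0_integralZl//.
- by rewrite CE -EFinM lee_fin mulrC.
- by have /integrableP[] := iN.
- by move=> y _; rewrite lee_fin mulr_ge0// mulr_ge0.
Qed.

Let I (a : plane) := Rintegral leb2 setT (fun y => W y * push f a 2 y).

Let pull a : Rintegral leb2 setT (fun y => F (a, y)) = theta a * I a.
Proof.
(* Where [theta a] is nonzero, dividing the slice of [F] by it yields the integrability needed to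
   pull this factor out. *)
rewrite /F /= /I; have [->|ne] := eqVneq (theta a) 0.
  by under eq_Rintegral do rewrite mul0r; rewrite Rintegral_cst// !mul0r.
rewrite -RintegralZl//.
have := integrableZl measurableT (theta a)^-1 (i1 a); apply: eq_integrable => // y _.
by rewrite -EFinM /F /= mulKf.
Qed.

Lemma integrable_push_mean : leb2.-integrable [set: plane] (EFin \o (fun a => theta a * I a)).
Proof.
have := integrable_fubini_F iF; apply: eq_integrable => // a _.
rewrite /fubini_F /= -pull /Rintegral fineK//.
exact: (integrable_fin_num measurableT (i1 a)).
Qed.

Lemma Fubini_push : Rintegral leb2 setT (fun a => theta a * I a) =
  Rintegral leb2 setT (fun y => W y * Rintegral leb2 setT (fun a => theta a * push f a 2 y)).
Proof.
under eq_Rintegral do rewrite -pull.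
rewrite (Rfubini iF i1 i2); apply: eq_Rintegral => y _.
have E : (fun a => F (a, y)) = fun a => W y * (theta a * push f a 2 y).
  by apply/funext => a; rewrite /F /= mulrCA.
rewrite E; have [->|ne] := eqVneq (W y) 0.
  by under eq_Rintegral do rewrite mul0r; rewrite Rintegral_cst// !mul0r.
rewrite RintegralZl//.
have := integrableZl measurableT (W y)^-1 (i2 y); apply: eq_integrable => // a _.
by rewrite -EFinM /F /= [theta a * _]mulrCA mulKf.
Qed.

(* [push f a 2 y] evaluates [f] at [2 y - a]: the reflection [a |-> 2 y - a] exchanges [theta]
   and [f]. *)
Lemma push_sym y : Rintegral leb2 setT (fun a => theta a * push f a 2 y) =
  Rintegral leb2 setT (fun x => f x * push theta x 2 y).
Proof.
have E a : (fun a => theta a * push f a 2 y) a = theta a * (4 * f (homothety (2 * y.1, 2 * y.2) (-1) a)).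
  rewrite /push /homothety /=; congr (_ * (_ * f _)); last by congr pair; ring.
  by ring.
have tff : test_function setT (fun a => f (homothety (2 * y.1, 2 * y.2) (-1) a) * theta a).
  by apply: testfnM => //; apply: Cinf_homothety; exact: testfn_Cinf tf.
rewrite (@Rintegral_homothety _ (2 * y.1, 2 * y.2) (-1)).
- rewrite sqrrN expr1n mul1r; apply: eq_Rintegral => x _ /=; rewrite /push /homothety /=.
  rewrite (_ : (_ + (y.1 - _) * 2, _) = x).
    rewrite (_ : (_ + -1 * x.1, _) = (x.1 + (y.1 - x.1) * 2, x.2 + (y.2 - x.2) * 2)).
      by ring.
    by congr pair; ring.
  by rewrite [RHS]surjective_pairing; congr pair; ring.
- by rewrite oppr_eq0 oner_eq0.
- have := integrableZl measurableT 4 (testfn_integrable tff); apply: eq_integrable => // a _ /=.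
  by rewrite E -EFinM; congr EFin; ring.
Qed.

End FubiniPush.

(** Both directions occur: a point of [B] is contracted towards an arbitrary point of [D], or a
    point of [D] towards a center in [B]. *)
Lemma star_homothety (B : set (R * R)) a x (t : R) : star_shaped D B ->
  (D a /\ B x) \/ (B a /\ D x) -> 0 < t <= 1 -> D (homothety (push_center a t) t x).
Proof.
move=> st hax /andP[t0 t1]; case: hax => [[Da Bx]|[Ba Dx]].
  apply: (st a x Da Bx); exists t; first by rewrite /= in_itv /= t1 ltW.
  by rewrite /homothety /push_center /=; congr pair; ring.
apply: (st x a Dx Ba); exists (1 - t); first by rewrite /= in_itv /=; lra.
by rewrite /homothety /push_center /=; congr pair; ring.
Qed.

Lemma L2norm_1_le : L2norm D (fun=> 1) <= 2 * h.
Proof.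
have h2 : 0 <= 2 * h by rewrite mulr_ge0// ltW.
rewrite -(ger0_norm h2) -sqrtr_sqr; apply: ler_wsqrtr.
rewrite /L2ip Rintegral_cst// mulr1 mul1r -lee_fin fineK ?leb2_le_diam//.
by rewrite ge0_fin_numE ?measure_ge0.
Qed.

(** Cauchy-Schwarz against the constant 1, whose norm is at most [2 * h] since [D] fits in a square
    of side [2 * h]. *)
Lemma Rintegral_abs_le f : test_function D f ->
  Rintegral leb2 setT (fun z => `|f z|) <= 2 * h * L2norm D f.
Proof.
move=> tf; have hf := testfn_L2 mD tf; have ha := L2_abs hf.
have h1 : L2 D (fun=> 1) by exact: L2_cst.
have -> : Rintegral leb2 setT (fun z => `|f z|) = L2ip D (fun z => `|f z|) (fun=> 1).
  rewrite /L2ip Rintegral_mkcond; congr Rintegral; apply/funext => z.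
  rewrite patchE mulr1; case: ifPn => //; rewrite notin_setE => nz.
  by rewrite (testfn_out tf nz) normr0.
apply: le_trans (ler_norm _) _; apply: le_trans (cauchy_schwarz mD ha h1) _.
rewrite mulrC (_ : L2norm D (fun z => `|f z|) = L2norm D f).
  by rewrite ler_wpM2r ?L2norm_ge0 ?L2norm_1_le.
by congr Num.sqrt; apply: eq_L2ip => z _; rewrite -normrM ger0_norm// -expr2 sqr_ge0.
Qed.

(** * Poincare's inequality on a star-shaped domain *)

Section StarShaped.
Variables (B : set (R * R)) (theta : R * R -> R).
Hypotheses (BD : B `<=` D) (st : star_shaped D B) (tB : test_function B theta).
Hypotheses (theta0 : forall z, 0 <= theta z) (theta1 : Rintegral leb2 setT theta = 1).

Let tt : test_function D theta. Proof. exact: testfnW BD tB. Qed.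

(* [f] and [theta] are both transported to the law of the midpoint of independent points of
   densities [f] and [theta]. *)
Lemma poincare_test w w1 w2 f : weak_grad D w w1 w2 -> L2ip D w theta = 0 ->
  test_function D f ->
  `|L2ip D w f| <= h * (1 + 2 * h * L2norm D theta) * (L2norm D w1 + L2norm D w2) * L2norm D f.
Proof.
move=> ww w0 tf; have [hw _ _ _ _] := ww.
set N := L2norm D w1 + L2norm D w2.
have N0 : 0 <= N by rewrite addr_ge0 ?L2norm_ge0.
pose W := w \_ D.
have iW : leb2.-integrable [set: plane] (EFin \o W).
  have := L2_integrableM mD hw (L2_cst 1 mD fD).
  move/(integrable_mkcond _ mD); rewrite restrict_EFin; apply: eq_integrable => // z _ /=.
  by congr EFin; rewrite /W !patchE; case: ifP => // _; rewrite mulr1.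
have IE g a : Rintegral leb2 setT (fun y => W y * push g a 2 y) = L2ip D w (push g a 2).
  rewrite /L2ip [RHS]Rintegral_mkcond; congr Rintegral; apply/funext => y.
  by rewrite /W !patchE; case: ifP => // _; rewrite mul0r.
have tfT := testfnW (@subsetT _ D) tf; have ttT := testfnW (@subsetT _ D) tt.
(* [J] is [w] integrated against the common midpoint density; [J1] and [J2] reach it by averaging
   over centers with weight [theta] and with weight [f]. *)
pose J := Rintegral leb2 setT (fun y => W y * Rintegral leb2 setT (fun a => theta a * push f a 2 y)).
have J1 : Rintegral leb2 setT (fun a => theta a * L2ip D w (push f a 2)) = J.
  by rewrite /J -(Fubini_push iW ttT tfT); apply: eq_Rintegral => a _; rewrite IE.
have J2 : Rintegral leb2 setT (fun x => f x * L2ip D w (push theta x 2)) = J.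
  transitivity (Rintegral leb2 setT (fun y => W y * Rintegral leb2 setT (fun x => f x * push theta x 2 y))).
    by rewrite -(Fubini_push iW tfT ttT); apply: eq_Rintegral => a _; rewrite IE.
  by apply: eq_Rintegral => y _; rewrite (push_sym ttT tfT).
have i1 : leb2.-integrable [set: plane] (EFin \o (fun a => theta a * L2ip D w (push f a 2))).
  rewrite (_ : (fun a => _) = fun a => theta a * Rintegral leb2 setT (fun y => W y * push f a 2 y)).
    exact: integrable_push_mean.
  by apply/funext => a; congr (_ * _); exact: esym (IE f a).
have i2 : leb2.-integrable [set: plane] (EFin \o (fun x => f x * L2ip D w (push theta x 2))).
  rewrite (_ : (fun x => _) = fun x => f x * Rintegral leb2 setT (fun y => W y * push theta x 2 y)).
    exact: integrable_push_mean.
  by apply/funext => x; congr (_ * _); exact: esym (IE theta x).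
(* The centers [a] lie in [B], so [D] is star-shaped about each of them and contains the contracted
   support of [f]. *)
have b1 : `|L2ip D w f - J| <= h * N * L2norm D f.
  have := weighted_mean_bound (testfn_integrable tt) i1 (c := L2ip D w f) (K := h * N * L2norm D f).
  rewrite theta1 J1 mulr1 (_ : Rintegral _ _ _ = 1) ?mulr1; last first.
    by rewrite -theta1; apply: eq_Rintegral => z _; rewrite ger0_norm.
  apply=> a ta; have Ba : B a by apply: contrapT => /(testfn_out tB) e; rewrite e eqxx in ta.
  apply: (transport_bound ww tf (BD Ba)) => x t /(testfn_supp tf) Dx ht.
  exact: (star_homothety st (or_intror (conj Ba Dx)) ht).
have c0 : 0 <= h * N * L2norm D theta.
  exact: mulr_ge0 (mulr_ge0 (ltW h0) N0) (L2norm_ge0 _ _).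
(* The centers are now arbitrary points of [D], and it is the support of [theta], inside [B], that
   contracts. Since [w] has [theta]-mean zero, [J] itself is bounded; the signed weight [f] has
   total mass at most [2 * h * L2norm D f], which produces the second term of the constant. *)
have b2 : `|J| <= h * N * L2norm D theta * (2 * h * L2norm D f).
  have := weighted_mean_bound (testfn_integrable tf) i2 (c := L2ip D w theta)
    (K := h * N * L2norm D theta).
  rewrite J2 w0 mul0r sub0r normrN => hh.
  apply: le_trans (hh _) _; last first.
    exact: (ler_wpM2l c0 (Rintegral_abs_le tf)).
  move=> x fx; have Dx : D x by apply: contrapT => /(testfn_out tf) e; rewrite e eqxx in fx.
  rewrite -w0; apply: (transport_bound ww tt Dx) => z t /(testfn_supp tB) Bz ht.
  exact: (star_homothety st (or_introl (conj Dx Bz)) ht).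
rewrite -(subrK J (L2ip D w f)); apply: le_trans (ler_normD _ _) _.
apply: le_trans (lerD b1 b2) _.
rewrite le_eqVlt; apply/orP; left; apply/eqP; ring.
Qed.

Lemma poincare w w1 w2 : weak_grad D w w1 w2 -> L2ip D w theta = 0 ->
  L2norm D w <= h * (1 + 2 * h * L2norm D theta) * (L2norm D w1 + L2norm D w2).
Proof.
move=> ww w0; have [hw _ _ _ _] := ww.
apply: (L2norm_le_dual oD fD) => //; last by move=> f; exact: poincare_test.
by rewrite !mulr_ge0 ?addr_ge0 ?mulr_ge0 ?L2norm_ge0// ltW.
Qed.

End StarShaped.
End Domain.

(** * Mollifiers and their scaling *)

(** By continuity [g] stays above [g z0 / 2] on a box of positive measure around [z0]. *)
Lemma Rintegral_gt0 (U : set (R * R)) (g : R * R -> R) z0 : open U -> U z0 ->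
  continuous g -> (forall z, 0 <= g z) ->
  leb2.-integrable (U : set plane) (EFin \o g) -> 0 < g z0 -> 0 < Rintegral leb2 U g.
Proof.
move=> oU Uz cg g0 ig gz.
pose V := U `&` [set z | g z0 / 2 < g z].
have oV : open V.
  apply: openI => //; have := @open_comp _ _ g [set x | g z0 / 2 < x] _ (@open_gt R (g z0 / 2)).
  by apply=> z _; exact: cg.
have Vz : V z0 by split => //=; lra.
have [q [/andP[q1 q2] /andP[q3 q4] qV]] := rat_box oV Vz.
set a := ratr q.1.1 in q1 qV *; set b := ratr q.1.2 in q2 qV *.
set c := ratr q.2.1 in q3 qV *; set d := ratr q.2.2 in q4 qV *.
pose Q : set plane := `[a, b] `*` `[c, d].
have mQ : measurable Q by exact: measurable_box.
have mU := open_measurable2 oU.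
have QU : Q `<=` U by move=> z /qV [].
have ab : a < b by exact: lt_trans q1 q2.
have cd : c < d by exact: lt_trans q3 q4.
have lQ : leb2 Q = ((b - a) * (d - c))%:E.
  rewrite /Q leb2X; [|exact: measurable_itv|exact: measurable_itv].
  by rewrite !lebesgue_measure_itv /= !lte_fin ab cd -!EFinB -EFinM.
have fQ : (leb2 Q < +oo)%E by rewrite lQ ltry.
have : g z0 / 2 * ((b - a) * (d - c)) <= Rintegral leb2 U g.
  have -> : g z0 / 2 * ((b - a) * (d - c)) = Rintegral leb2 Q (fun=> g z0 / 2).
    rewrite Rintegral_cst//; congr (_ * _); exact: (esym (congr1 fine lQ)).
  have iQ := integrableS mU mQ QU ig.
  apply: (@le_trans _ _ (Rintegral leb2 Q g)).
    apply: le_Rintegral => //; last by move=> z /qV [_ /= /ltW].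
    apply: (measurable_bounded_integrable mQ fQ); first exact: measurable_cst.
    have g2 : 0 <= g z0 / 2 by lra.
    exists (g z0 / 2); split; first exact: num_real.
    by move=> x xg z _ /=; rewrite (ger0_norm g2); exact: ltW.
  rewrite /Rintegral; apply: fine_le.
  - exact: integrable_fin_num.
  - exact: integrable_fin_num.
  - apply: ge0_subset_integral => //; first by have /integrableP[] := ig.
    by move=> z _; rewrite lee_fin.
by apply: lt_le_trans; rewrite !mulr_gt0 ?subr_gt0// invr_gt0.
Qed.

Definition unit_bump : R * R -> R := bump (- 2^-1) (2^-1) (- 2^-1) (2^-1).

Lemma testfn_unit_bump : test_function setT unit_bump.
Proof. exact: testfn_bump. Qed.

Definition bump_mass : R := Rintegral leb2 setT unit_bump.

Lemma bump_mass_gt0 : 0 < bump_mass.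
Proof.
apply: (@Rintegral_gt0 _ _ (0, 0)) => //.
- exact: openT.
- by apply: Cinf_continuous; exact: Cinf_bump.
- by move=> z; exact: bump_ge0.
- exact: testfn_integrable testfn_unit_bump.
- by rewrite bump_gt0 /=; apply/andP; split; apply/andP; split; lra.
Qed.

(* [unit_bump] rescaled to the square of side [r] centered at [c], with integral [1]. *)
Definition mollifier (c : R * R) (r : R) (z : R * R) : R :=
  (bump_mass * r ^+ 2)^-1 * unit_bump (homothety (- c.1 / r, - c.2 / r) r^-1 z).

Lemma mollifier_ge0 c r z : 0 <= mollifier c r z.
Proof.
by rewrite mulr_ge0 ?bump_ge0// invr_ge0 mulr_ge0 ?sqr_ge0// ltW ?bump_mass_gt0.
Qed.

Lemma testfn_mollifier (B : set (R * R)) c r : 0 < r ->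
  (forall z, `|z.1 - c.1| <= r / 2 -> `|z.2 - c.2| <= r / 2 -> B z) ->
  test_function B (mollifier c r).
Proof.
move=> r0 hB; have rn0 : r != 0 by rewrite gt_eqF.
apply: (testfn_intro (@compact_box R (c.1 - r / 2) (c.1 + r / 2) (c.2 - r / 2) (c.2 + r / 2))).
- by move=> z [] /=; rewrite !in_itv /= -!ler_distl; exact: hB.
- by apply: CinfZ; apply: (Cinf_homothety _ _ (@Cinf_bump R _ _ _ _)).
move=> z hz; rewrite /mollifier /unit_bump bump_eq0 ?mulr0// => -[].
rewrite /homothety /= !in_itv /= => h1 h2; apply: hz; split; rewrite /= in_itv /=.
  have e : - c.1 / r + r^-1 * z.1 = (z.1 - c.1) / r by field.
  by move: h1; rewrite e ltr_pdivlMr// ltr_pdivrMr// => /andP[]; lra.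
have e : - c.2 / r + r^-1 * z.2 = (z.2 - c.2) / r by field.
by move: h2; rewrite e ltr_pdivlMr// ltr_pdivrMr// => /andP[]; lra.
Qed.

Lemma Rintegral_mollifier c r : 0 < r -> Rintegral leb2 setT (mollifier c r) = 1.
Proof.
move=> r0; have rn0 : r^-1 != 0 by rewrite invr_eq0 gt_eqF.
have m0 := bump_mass_gt0.
have i := testfn_integrable testfn_unit_bump.
have iT := integrable_homothety (- c.1 / r, - c.2 / r) rn0 i.
rewrite /mollifier RintegralZl//.
have := Rintegral_homothety (- c.1 / r, - c.2 / r) rn0 i.
rewrite -/bump_mass => E; rewrite [X in (X * _)^-1]E /comp.
set X := Rintegral _ _ _ in E *.
have X0 : X != 0 by apply: contraTneq m0 => X0; rewrite E X0 mulr0 ltxx.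
by field; rewrite X0 gt_eqF.
Qed.

(** In the plane the L2 norm of a bump of mass 1 scales like [r^-1]. At [r = rho * h] the product
    [h * L2norm D theta] in Poincare's constant therefore depends on [rho] alone. *)
Lemma L2norm_mollifier (D : set (R * R)) c r : 0 < r -> test_function D (mollifier c r) ->
  L2norm D (mollifier c r) = L2norm setT unit_bump / (bump_mass * r).
Proof.
move=> r0 tD; have rn0 : r^-1 != 0 by rewrite invr_eq0 gt_eqF.
have m0 := bump_mass_gt0.
have mr : 0 < (bump_mass * r)^-1 by rewrite invr_gt0 mulr_gt0.
rewrite mulrC -(gtr0_norm mr) -sqrtr_sqr -sqrtrM ?sqr_ge0//; congr Num.sqrt.
rewrite (L2ip_testfn _ tD) (L2ip_testfn _ testfn_unit_bump).
have i : leb2.-integrable [set: plane] (EFin \o (fun z => unit_bump z * unit_bump z)).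
  by apply: (@testfn_integrable _ setT); apply: testfnM; [exact: Cinf_bump|exact: testfn_unit_bump].
have iT := integrable_homothety (- c.1 / r, - c.2 / r) rn0 i.
rewrite (Rintegral_homothety (- c.1 / r, - c.2 / r) rn0 i) mulrA -RintegralZl//.
apply: eq_Rintegral => z _; rewrite /mollifier /=.
move: (unit_bump _) => x; field; by rewrite !gt_eqF.
Qed.

End Poincare.

(** * Polynomials in two variables and their L2 projections *)

Section Polynomials.
Context {R : realType}.
Local Notation mR := (measurableTypeR R).
Local Notation plane := (mR * mR)%type.
Implicit Types (D : set (R * R)) (u p q f g : R * R -> R) (z : R * R).

Lemma partialS i j f : partial i.+1 j f = D1 (partial i j f). Proof. by []. Qed.
Lemma partial0S j f : partial 0 j.+1 f = D2 (partial 0 j f). Proof. by []. Qed.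

Lemma partialD i j f g : Cinf f -> Cinf g ->
  partial i j (fun z => f z + g z) = fun z => partial i j f z + partial i j g z.
Proof.
move=> hf hg; elim: i => [|i IH].
  elim: j => [//|j IH]; rewrite !partial0S IH D2D//; exact: Cinf_partial.
by rewrite !partialS IH D1D//; exact: Cinf_partial.
Qed.

Lemma partialZ i j c f : Cinf f -> partial i j (fun z => c * f z) = fun z => c * partial i j f z.
Proof.
move=> hf; elim: i => [|i IH].
  elim: j => [//|j IH]; rewrite !partial0S IH D2Z//; exact: Cinf_partial.
by rewrite !partialS IH D1Z//; exact: Cinf_partial.
Qed.

Lemma partialB i j f g : Cinf f -> Cinf g ->
  partial i j (fun z => f z - g z) = fun z => partial i j f z - partial i j g z.
Proof.
move=> hf hg; rewrite (_ : (fun z => f z - g z) = fun z => f z + -1 * g z).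
  by rewrite partialD ?partialZ//; [apply/funext => z; rewrite mulN1r|exact: CinfZ].
by apply/funext => z; rewrite mulN1r.
Qed.

Lemma CinfB f g : Cinf f -> Cinf g -> Cinf (fun z => f z - g z).
Proof.
move=> hf hg; rewrite (_ : (fun z => f z - g z) = fun z => f z + -1 * g z).
  by apply: CinfD => //; exact: CinfZ.
by apply/funext => z; rewrite mulN1r.
Qed.

Lemma partial_homothety i j a s f : Cinf f ->
  partial i j (f \o homothety a s) = fun z => s ^+ (i + j) * partial i j f (homothety a s z).
Proof.
move=> hf; elim: i => [|i IH].
  elim: j => [|j IH]; first by apply/funext => z; rewrite expr0 mul1r.
  have hp := Cinf_partial 0 j hf.
  rewrite !partial0S IH D2Z; last exact: Cinf_homothety.
  by rewrite (D2_homothety _ _ hp); apply/funext => z; rewrite !add0n exprSr mulrA.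
have hp := Cinf_partial i j hf.
rewrite !partialS IH D1Z; last exact: Cinf_homothety.
by rewrite (D1_homothety _ _ hp); apply/funext => z; rewrite addSn exprSr mulrA.
Qed.

Definition mon (i j : nat) z : R := z.1 ^+ i * z.2 ^+ j.

Lemma Cinf_mon i j : Cinf (mon i j).
Proof. by apply: CinfM; apply: Cinf_X; [exact: Cinf_fst|exact: Cinf_snd]. Qed.

Lemma is_derive_expn (n : nat) (x : R) : is_derive x 1 (fun x : R => x ^+ n) (n%:R * x ^+ n.-1).
Proof.
have h := is_deriveX n (is_derive_id x 1).
rewrite (_ : (fun x : R => x ^+ n) = (id : R -> R) ^+ n).
  by apply: (is_derive_eq h); rewrite /GRing.scale /= mulr1 -mulr_natl.
by apply/funext => y; rewrite fctE.
Qed.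

Lemma D1_mon i j : D1 (mon i j) = fun z => i%:R * mon i.-1 j z.
Proof.
apply: D1_is_derive => z; apply/is_derive1_coord; rewrite /mon /=.
have := is_deriveM (is_derive_expn i z.1) (is_derive_cst (z.2 ^+ j) z.1 1).
move=> h; apply: (is_derive_eq h).
by rewrite scaler0 add0r /GRing.scale /= /cst; ring.
Qed.

Lemma D2_mon i j : D2 (mon i j) = fun z => j%:R * mon i j.-1 z.
Proof.
apply: D2_is_derive => z; apply/is_derive2_coord; rewrite /mon /=.
have := is_deriveM (is_derive_cst (z.1 ^+ i) z.2 1) (is_derive_expn j z.2).
move=> h; apply: (is_derive_eq h).
by rewrite scaler0 addr0 /GRing.scale /= /cst; ring.
Qed.

Lemma partial_mon i j a b :
  partial i j (mon a b) = fun z => (a ^_ i * b ^_ j)%:R * mon (a - i) (b - j) z.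
Proof.
elim: i => [|i IH].
  elim: j => [|j IH]; first by apply/funext => z; rewrite !ffactn0 !subn0 mul1r.
  rewrite partial0S IH (D2Z _ (@Cinf_mon _ _)) D2_mon; apply/funext => z.
  by rewrite mulrA -natrM -mulnA -ffactnSr subnS.
rewrite partialS IH (D1Z _ (@Cinf_mon _ _)) D1_mon; apply/funext => z.
by rewrite mulrA -natrM mulnAC -ffactnSr subnS.
Qed.

(** Replaces computations with the double sum: a property stable under linear combinations need only
    be checked on monomials. *)
Lemma polyfun_ind (k : nat) (P : (R * R -> R) -> Prop) : P (fun=> 0) ->
  (forall f g, P f -> P g -> P (fun z => f z + g z)) ->
  (forall c f, P f -> P (fun z => c * f z)) ->
  (forall i j, (i + j <= k)%N -> P (mon i j)) -> forall p, polyfun k p -> P p.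
Proof.
move=> P0 PD PZ Pm p [c hc].
have Psum (I : Type) (s : seq I) (Q : pred I) (F : I -> R * R -> R) :
    (forall i, Q i -> P (F i)) -> P (fun z => \sum_(i <- s | Q i) F i z).
  move=> hF; elim: s => [|i s IH].
    by rewrite (_ : (fun _ => _) = fun=> 0)//; apply/funext => z; rewrite big_nil.
  case Qi: (Q i).
    rewrite (_ : (fun _ => _) = fun z => F i z + \sum_(i <- s | Q i) F i z).
      by apply: PD => //; exact: hF.
    by apply/funext => z; rewrite big_cons Qi.
  by rewrite (_ : (fun _ => _) = fun z => \sum_(i <- s | Q i) F i z)//; apply/funext => z; rewrite big_cons Qi.
rewrite (_ : p = fun z => \sum_(i < k.+1) \sum_(j < k.+1 | (i + j <= k)%N) c i j * mon i j z).
  apply: (Psum _ _ _ (fun (i : 'I_k.+1) z => \sum_(j < k.+1 | (i + j <= k)%N) c i j * mon i j z)) => i _.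
  by apply: (Psum _ _ _ (fun (j : 'I_k.+1) z => c i j * mon i j z)) => j ij; apply: PZ; exact: Pm.
apply/funext => z; rewrite hc; apply: eq_bigr => i _; apply: eq_bigr => j _.
by rewrite /mon mulrA.
Qed.

Lemma polyfun0 k : polyfun k (fun=> 0 : R).
Proof.
exists (fun _ _ => 0) => z; rewrite big1// => i _; rewrite big1// => j _.
by rewrite !mul0r.
Qed.

Lemma polyfunD k p q : polyfun k p -> polyfun k q -> polyfun k (fun z => p z + q z).
Proof.
move=> [c hc] [d hd]; exists (fun i j => c i j + d i j) => z.
rewrite hc hd -big_split; apply: eq_bigr => i _; rewrite -big_split; apply: eq_bigr => j _ /=.
by rewrite !mulrDl.
Qed.

Lemma polyfunZ k a p : polyfun k p -> polyfun k (fun z => a * p z).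
Proof.
move=> [c hc]; exists (fun i j => a * c i j) => z.
rewrite hc mulr_sumr; apply: eq_bigr => i _; rewrite mulr_sumr; apply: eq_bigr => j _ /=.
by rewrite !mulrA.
Qed.

Lemma polyfunB k p q : polyfun k p -> polyfun k q -> polyfun k (fun z => p z - q z).
Proof.
move=> hp /(polyfunZ (-1)) /(polyfunD hp).
by rewrite (_ : (fun z => p z + -1 * q z) = fun z => p z - q z)//; apply/funext => z; rewrite mulN1r.
Qed.

Lemma polyfun_mon k i j : (i + j <= k)%N -> polyfun k (mon i j).
Proof.
move=> ij; exists (fun a b => ((a == i) && (b == j))%:R) => z.
have ik : (i < k.+1)%N by rewrite ltnS (leq_trans _ ij)// leq_addr.
have jk : (j < k.+1)%N by rewrite ltnS (leq_trans _ ij)// leq_addl.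
rewrite (bigD1 (Ordinal ik))//= (bigD1 (Ordinal jk))//= !eqxx mul1r.
rewrite big1 ?addr0; last first.
  by move=> b /andP[_ bj]; rewrite (_ : (b : nat) == j = false) ?mul0r//; apply: negbTE bj.
rewrite big1 ?addr0// => a ai; rewrite big1// => b _.
by rewrite (_ : (a : nat) == i = false) ?mul0r//; apply: negbTE ai.
Qed.

Lemma polyfun_le k k' p : (k <= k')%N -> polyfun k p -> polyfun k' p.
Proof.
move=> kk'; apply: polyfun_ind; [exact: polyfun0|by move=> *; exact: polyfunD|by move=> *; exact: polyfunZ|].
by move=> i j ij; apply: polyfun_mon; exact: leq_trans ij kk'.
Qed.

Lemma Cinf_polyfun k p : polyfun k p -> Cinf p.
Proof.
apply: polyfun_ind; [exact: Cinf_cst|by move=> *; exact: CinfD|by move=> *; exact: CinfZ|].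
by move=> i j _; exact: Cinf_mon.
Qed.

Lemma polyfun_mul1 k p : polyfun k p -> polyfun k.+1 (fun z => z.1 * p z).
Proof.
move: p; apply: (@polyfun_ind k (fun p => polyfun k.+1 (fun z => z.1 * p z))).
- by rewrite (_ : (fun _ => _) = fun=> 0); [exact: polyfun0|apply/funext => z; rewrite mulr0].
- move=> f g hf hg; rewrite (_ : (fun _ => _) = fun z => z.1 * f z + z.1 * g z); first exact: polyfunD.
  by apply/funext => z; rewrite mulrDr.
- move=> c f hf; rewrite (_ : (fun _ => _) = fun z => c * (z.1 * f z)); first exact: polyfunZ.
  by apply/funext => z; rewrite mulrCA.
- move=> i j ij; rewrite (_ : (fun _ => _) = mon i.+1 j); first exact: polyfun_mon.
  by apply/funext => z; rewrite /mon exprS mulrA.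
Qed.

Lemma polyfun_mul2 k p : polyfun k p -> polyfun k.+1 (fun z => z.2 * p z).
Proof.
move: p; apply: (@polyfun_ind k (fun p => polyfun k.+1 (fun z => z.2 * p z))).
- by rewrite (_ : (fun _ => _) = fun=> 0); [exact: polyfun0|apply/funext => z; rewrite mulr0].
- move=> f g hf hg; rewrite (_ : (fun _ => _) = fun z => z.2 * f z + z.2 * g z); first exact: polyfunD.
  by apply/funext => z; rewrite mulrDr.
- move=> c f hf; rewrite (_ : (fun _ => _) = fun z => c * (z.2 * f z)); first exact: polyfunZ.
  by apply/funext => z; rewrite mulrCA.
- move=> i j ij; rewrite (_ : (fun _ => _) = mon i j.+1).
    by apply: polyfun_mon; rewrite addnS.
  by apply/funext => z; rewrite /mon exprS; ring.
Qed.

Lemma polyfun_mon_homothety a s i j : polyfun (i + j) (mon i j \o homothety a s).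
Proof.
elim: i => [|i IH].
  elim: j => [|j IH].
    rewrite (_ : _ \o _ = mon 0 0); first exact: polyfun_mon.
    by apply/funext => z; rewrite /mon /= !expr0.
  rewrite (_ : _ \o _ = fun z => a.2 * (mon 0 j \o homothety a s) z +
                                 s * (z.2 * (mon 0 j \o homothety a s) z)).
    apply: polyfunD; apply: polyfunZ; last exact: polyfun_mul2.
    by apply: polyfun_le IH; rewrite leqnSn.
  by apply/funext => z; rewrite /mon /= !expr0 exprS; ring.
rewrite (_ : _ \o _ = fun z => a.1 * (mon i j \o homothety a s) z +
                               s * (z.1 * (mon i j \o homothety a s) z)).
  apply: polyfunD; apply: polyfunZ; last exact: polyfun_mul1.
  by apply: polyfun_le IH; rewrite addSn leqnSn.
by apply/funext => z; rewrite /mon /= exprS; ring.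
Qed.

Lemma polyfun_homothety k a s p : polyfun k p -> polyfun k (p \o homothety a s).
Proof.
move: p; apply: (@polyfun_ind k (fun p => polyfun k (p \o homothety a s))).
- exact: polyfun0.
- by move=> f g hf hg; exact: (polyfunD hf hg).
- by move=> c f hf; exact: (polyfunZ c hf).
- by move=> i j ij; apply: polyfun_le ij _; exact: polyfun_mon_homothety.
Qed.

Lemma partial_high n p i j : polyfun n p -> (n < i + j)%N -> partial i j p = fun=> 0.
Proof.
(* Smoothness is carried through the induction because [partialD] and [partialZ] ask for it. *)
move=> hp nij; suff [] : Cinf p /\ partial i j p = fun=> 0 by [].
move: p hp; apply: polyfun_ind.
- split; first exact: Cinf_cst.
  rewrite (_ : (fun=> 0) = fun z => 0 * mon 0 0 z); last by apply/funext => z; rewrite mul0r.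
  by rewrite partialZ; [apply/funext => z; rewrite !mul0r|exact: Cinf_mon].
- move=> f g [cf hf] [cg hg]; split; first exact: CinfD.
  by rewrite partialD// hf hg; apply/funext => z; rewrite addr0.
- move=> c f [cf hf]; split; first exact: CinfZ.
  by rewrite partialZ// hf; apply/funext => z; rewrite mulr0.
- move=> a b ab; split; first exact: Cinf_mon.
  rewrite partial_mon; apply/funext => z.
  rewrite (_ : a ^_ i * b ^_ j = 0)%N ?mul0r//.
  have [ai|ia] := ltnP a i; first by rewrite ffact_small.
  rewrite [X in (_ * X)%N]ffact_small ?muln0//.
  by rewrite -(ltn_add2l i) (leq_ltn_trans _ nij)// (leq_trans _ ab)// leq_add2r.
Qed.

Lemma continuous_box_bounded f (M : R) : continuous f ->
  exists B : R, 0 <= B /\ forall z, `|z.1| <= M -> `|z.2| <= M -> `|f z| <= B.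
Proof.
move=> cf; pose K : set (R * R) := `[- M, M] `*` `[- M, M].
have [K0|/set0P K0] := eqVneq K set0.
  exists 0; split => // z h1 h2; suff : set0 z by [].
  by rewrite -K0; split; rewrite /= in_itv /= -ler_norml.
have cn : {within K, continuous (fun z => `|f z|)}.
  apply: continuous_subspaceT => z; apply: (@continuous_comp _ _ _ f (fun x => `|x|)); first exact: cf.
  exact: norm_continuous.
have [c _ cM] := compact_EVT_max K0 (@compact_box R _ _ _ _) cn.
exists `|f c|; split => // z h1 h2; apply: cM; rewrite inE.
by split; rewrite /= in_itv /= -ler_norml.
Qed.

(** The span of a list of monomials, recursive in the list so that Gram-Schmidt can add one monomial
    at a time; [polyfun k] is the span of [poly_index k]. *)
Fixpoint mon_span (s : seq (nat * nat)) p : Prop :=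
  if s is ij :: s' then
    exists c q, mon_span s' q /\ p = fun z => c * mon ij.1 ij.2 z + q z
  else p = fun=> 0.

Lemma mon_span0 s : mon_span s (fun=> 0).
Proof.
elim: s => [//|ij s IH]; exists 0, (fun=> 0); split => //.
by apply/funext => z; rewrite mul0r addr0.
Qed.

Lemma mon_spanD s p q : mon_span s p -> mon_span s q -> mon_span s (fun z => p z + q z).
Proof.
elim: s p q => [|ij s IH] p q; first by move=> -> ->; apply/funext => z; rewrite addr0.
move=> [c [p' [hp ->]]] [d [q' [hq ->]]]; exists (c + d), (fun z => p' z + q' z).
split; first exact: IH.
by apply/funext => z; ring.
Qed.

Lemma mon_spanZ s a p : mon_span s p -> mon_span s (fun z => a * p z).
Proof.
elim: s p => [|ij s IH] p; first by move=> ->; apply/funext => z; rewrite mulr0.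
move=> [c [p' [hp ->]]]; exists (a * c), (fun z => a * p' z); split; first exact: IH.
by apply/funext => z; ring.
Qed.

Lemma mon_span_mem s i j : (i, j) \in s -> mon_span s (mon i j).
Proof.
elim: s => [//|ab s IH]; rewrite inE => /predU1P[<-|/IH h].
  exists 1, (fun=> 0); split; first exact: mon_span0.
  by apply/funext => z; rewrite mul1r addr0.
by exists 0, (mon i j); split => //; apply/funext => z; rewrite mul0r add0r.
Qed.

Definition poly_index (k : nat) : seq (nat * nat) :=
  [seq ij <- [seq (i, j) | i <- iota 0 k.+1, j <- iota 0 k.+1] | (ij.1 + ij.2 <= k)%N].

Lemma mem_poly_index k i j : ((i, j) \in poly_index k) = (i + j <= k)%N.
Proof.
rewrite /poly_index mem_filter; apply/andP/idP => [[]//|ij]; split=> //.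
apply/allpairsP; exists (i, j).
by rewrite !mem_iota /= !add0n !ltnS; split => //; apply: leq_trans ij; rewrite ?leq_addr ?leq_addl.
Qed.

Lemma uniq_poly_index k : uniq (poly_index k).
Proof.
by apply: filter_uniq; apply: allpairs_uniq; rewrite ?iota_uniq// => -[a b] [c d] _ _ [-> ->].
Qed.

Lemma mon_span_polyfun k p : mon_span (poly_index k) p <-> polyfun k p.
Proof.
split.
  have : {subset poly_index k <= poly_index k} by [].
  move: {1 3}(poly_index k) => s; elim: s p => [|[i j] s IH] p hs.
    by move=> ->; exact: polyfun0.
  move=> [c [q [hq ->]]]; apply: polyfunD.
    by apply: polyfunZ; apply: polyfun_mon; rewrite -mem_poly_index hs// mem_head.
  by apply: IH => // x xs; apply: hs; rewrite inE xs orbT.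
apply: polyfun_ind; [exact: mon_span0|by move=> *; exact: mon_spanD|by move=> *; exact: mon_spanZ|].
by move=> i j ij; apply: mon_span_mem; rewrite mem_poly_index.
Qed.

Lemma Cinf_mon_span s p : mon_span s p -> Cinf p.
Proof.
elim: s p => [|ij s IH] p; first by move=> ->; exact: Cinf_cst.
move=> [c [q [/IH hq ->]]]; apply: CinfD => //; apply: CinfZ; exact: Cinf_mon.
Qed.

(** At the origin [partial i j] reads off the coefficient of [mon i j] up to a factorial. This
    expresses the linear independence of monomials. *)
Lemma partial_mon_span0 s p i j : mon_span s p -> (i, j) \notin s -> partial i j p (0, 0) = 0.
Proof.
elim: s p => [|[a b] s IH] p.
  move=> -> _; rewrite (_ : (fun=> 0) = fun z => 0 * mon 0 0 z); last by apply/funext => z; rewrite mul0r.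
  by rewrite partialZ ?mul0r//; exact: Cinf_mon.
move=> [c [q [hq ->]]]; rewrite inE negb_or => /andP[ne hs].
have cq := Cinf_mon_span hq; have cm := @Cinf_mon a b.
rewrite (@partialD i j _ _ (CinfZ c cm) cq) (partialZ _ _ _ cm) (IH _ hq hs) addr0 partial_mon /mon /=.
have [ai|ia] := ltnP a i; first by rewrite ffact_small// !mul0r mulr0.
have [bj|jb] := ltnP b j; first by rewrite [X in (_ * X)%N]ffact_small// muln0 !mul0r mulr0.
rewrite !expr0n !subn_eq0.
have [ai|ia'] := leqP a i; last by rewrite mul0r !mulr0.
have [bj|jb'] := leqP b j; last by rewrite !mulr0.
exfalso; move/negP: ne; apply; apply/eqP; congr pair; apply/eqP; rewrite eqn_leq; apply/andP; split => //.
Qed.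

Lemma L2ip_pythagoras D u v : measurable (D : set plane) -> L2 D u -> L2 D v ->
  L2ip D u v = 0 ->
  L2ip D (fun z => u z + v z) (fun z => u z + v z) = L2ip D u u + L2ip D v v.
Proof.
move=> mD hu hv uv; have huv := L2D hu hv.
rewrite (L2ipDl mD hu hv huv) (L2ipDr mD hu hv hu) (L2ipDr mD hu hv hv).
by rewrite (L2ipC D v u) uv addr0 add0r.
Qed.

Section Projection.
Variable D : set (R * R).
Hypotheses (oD : open D) (cD : forall f, Cinf f -> L2 D f).
Let mD : measurable (D : set plane) := open_measurable2 oD.

(** Gram-Schmidt: [e] is the projection of the new monomial on the old span, and [d = mon i j - e]
    is the new orthogonal direction. *)
Lemma mon_span_proj s u : L2 D u -> exists p, mon_span s p /\
  forall q, mon_span s q -> L2ip D (fun z => u z - p z) q = 0.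
Proof.
move=> hu; elim: s u hu => [|[i j] s IH] u hu.
  exists (fun=> 0); split => // q ->.
  by rewrite /L2ip; under eq_Rintegral do rewrite mulr0; rewrite Rintegral_cst// mul0r.
have L2s p : mon_span s p -> L2 D p by move=> /Cinf_mon_span /cD.
have hm := cD (@Cinf_mon i j).
have [p [sp hp]] := IH _ hu; have [e [se he]] := IH _ hm.
have Lp := L2s _ sp; have Le := L2s _ se.
pose d z := mon i j z - e z; have Ld : L2 D d by exact: L2B.
have Lup : L2 D (fun z => u z - p z) by exact: L2B.
(* If [d] has norm zero it is orthogonal to everything by Cauchy-Schwarz, and the old projection
   serves. *)
have [d0|d0] := eqVneq (L2ip D d d) 0.
  exists p; split; first by exists 0, p; split => //; apply/funext => z; rewrite mul0r add0r.
  move=> q [c [q' [sq ->]]]; have Lq := L2s _ sq.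
  rewrite (L2ipDr mD (L2Z c hm) Lq Lup) (hp q' sq) addr0 (L2ipZr mD c hm Lup).
  rewrite (@eq_L2ip _ _ _ _ (fun z => u z - p z) (fun z => d z + e z)); last by move=> z _; rewrite /d subrK.
  rewrite (L2ipDr mD Ld Le Lup) (hp e se) addr0.
  have := cauchy_schwarz mD Lup Ld; rewrite /L2norm d0 sqrtr0 mulr0 normr_le0 => /eqP ->.
  by rewrite mulr0.
(* The old projection [p] is orthogonal to [d], so the coefficient of [u - p] along [d] can be
   computed from [u]. *)
pose t := L2ip D u d / L2ip D d d.
have sd : mon_span ((i, j) :: s) d.
  exists 1, (fun z => -1 * e z); split; first exact: mon_spanZ.
  by apply/funext => z; rewrite mul1r mulN1r.
have sp' : mon_span ((i, j) :: s) p.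
  by exists 0, p; split => //; apply/funext => z; rewrite mul0r add0r.
exists (fun z => p z + t * d z); split; first by apply: mon_spanD => //; exact: mon_spanZ.
have Lt := L2Z t Ld.
have LU : L2 D (fun z => u z - (p z + t * d z)) by apply: L2B => //; exact: L2D.
have key v : L2 D v -> L2ip D (fun z => u z - (p z + t * d z)) v =
    L2ip D (fun z => u z - p z) v - t * L2ip D d v.
  move=> hv; rewrite -(L2ipZl mD t Ld hv) -(L2ipBl mD Lup Lt hv); apply: eq_L2ip => z _.
  by rewrite opprD addrA.
have orth v : mon_span s v -> L2ip D d v = 0 by exact: he.
move=> q [c [q' [sq ->]]]; have Lq := L2s _ sq.
rewrite (L2ipDr mD (L2Z c hm) Lq LU) (key q' Lq) (hp q' sq) (orth _ sq) mulr0 subr0 addr0 (L2ipZr mD c hm LU).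
rewrite (@eq_L2ip _ _ _ _ (fun z => u z - (p z + t * d z)) (fun z => d z + e z)); last by move=> z _; rewrite /d subrK.
rewrite (L2ipDr mD Ld Le LU) (key _ Ld) (key _ Le) (hp _ se) (orth _ se) mulr0 subr0 addr0.
rewrite (L2ipBl mD hu Lp Ld) (L2ipC D p) (orth _ sp) subr0 /t divfK// subrr mulr0 //.
Qed.

Lemma polyfun_proj k u : L2 D u -> exists p, polyfun k p /\
  forall q, polyfun k q -> L2ip D (fun z => u z - p z) q = 0.
Proof.
move=> hu; have [p [sp hp]] := mon_span_proj (poly_index k) hu.
exists p; split; first exact/mon_span_polyfun.
by move=> q /mon_span_polyfun; exact: hp.
Qed.

Lemma L2projP k u : L2 D u -> polyfun k (L2proj k D u) /\
  forall q, polyfun k q -> L2ip D (fun z => u z - L2proj k D u z) q = 0.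
Proof.
move=> /(polyfun_proj k) ex; rewrite /L2proj.
exact: (xgetPex (cst 0) ex).
Qed.

(** Pythagoras for [u - q], split as [u - L2proj k D u] plus a polynomial. It plays the part of the
    contraction property of the projection applied to [u - q], with no appeal to linearity of
    [L2proj]. *)
Lemma L2proj_dist k u q : L2 D u -> polyfun k q ->
  L2norm D (fun z => L2proj k D u z - q z) <= L2norm D (fun z => u z - q z).
Proof.
move=> hu hq; have [hp orth] := L2projP k hu; set p := L2proj k D u in hp orth *.
have Lp := cD (Cinf_polyfun hp); have Lq := cD (Cinf_polyfun hq).
have Lpq := L2B Lp Lq; have Lup := L2B hu Lp.
apply: ler_wsqrtr.
rewrite [leRHS](@eq_L2ip _ _ _ _ (fun z => (u z - p z) + (p z - q z)) (fun z => (u z - p z) + (p z - q z))); last first.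
  by move=> z _; rewrite addrA subrK.
rewrite (L2ip_pythagoras mD Lup Lpq (orth _ (polyfunB hp hq))).
by rewrite lerDr L2ip_ge0.
Qed.

End Projection.

End Polynomials.

(** * Inverse inequality and averaged polynomial approximation *)

Section Approximation.
Context {R : realType}.
Local Notation mR := (measurableTypeR R).
Local Notation plane := (mR * mR)%type.
Implicit Types (D U : set (R * R)) (u v p q f g : R * R -> R) (c z : R * R).

Lemma partial_cst0 i j : partial i j (fun=> 0 : R) = fun=> 0.
Proof.
have e : (fun=> 0) = (fun z => 0 * mon 0 0 z : R) by apply/funext => z; rewrite mul0r.
by rewrite [in LHS]e (partialZ _ _ _ (@Cinf_mon R 0 0)); apply/funext => z; rewrite mul0r.
Qed.

Lemma partial_sum i j (I : Type) (s : seq I) (F : I -> R * R -> R) :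
  (forall a, Cinf (F a)) ->
  partial i j (fun z => \sum_(a <- s) F a z) = fun z => \sum_(a <- s) partial i j (F a) z.
Proof.
move=> hF; elim: s => [|a s IH].
  have e (G : I -> R * R -> R) : (fun z => \sum_(a <- [::]) G a z) = fun=> 0.
    by apply/funext => z; rewrite big_nil.
  by rewrite !e partial_cst0.
have e (G : I -> R * R -> R) :
    (fun z => \sum_(b <- a :: s) G b z) = fun z => G a z + \sum_(b <- s) G b z.
  by apply/funext => z; rewrite big_cons.
have cs : Cinf (fun z => \sum_(b <- s) F b z) by apply: Cinf_sum => b _; exact: hF.
by rewrite !e (partialD _ _ (hF a) cs) IH.
Qed.

Lemma polyfun_sum n (I : Type) (s : seq I) (F : I -> R * R -> R) :
  (forall a, polyfun n (F a)) -> polyfun n (fun z => \sum_(a <- s) F a z).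
Proof.
move=> hF; elim: s => [|a s IH].
  by rewrite (_ : (fun _ => _) = fun=> 0); [exact: polyfun0|apply/funext => z; rewrite big_nil].
rewrite (_ : (fun _ => _) = fun z => F a z + \sum_(b <- s) F b z); first exact: polyfunD.
by apply/funext => z; rewrite big_cons.
Qed.

Lemma D2_partial i j f : Cinf f -> D2 (partial i j f) = partial i j.+1 f.
Proof.
move=> hf; elim: i => [//|i IH].
by rewrite !partialS -IH schwarz//; have /(_ 2%N) := Cinf_partial i j hf.
Qed.

Lemma partial_eq0 U i j f : open U -> (forall z, U z -> f z = 0) ->
  forall z, U z -> partial i j f z = 0.
Proof.
move=> oU.
have D0 (v : R * R) g : (forall z, U z -> g z = 0) -> forall z, U z -> 'D_v g z = 0.
  move=> g0 z Uz; have /(near_eq_derive v) -> : \forall w \near z, g w = cst 0 w.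
    by apply: filterS (open_nbhs_nbhs (conj oU Uz)); exact: g0.
  by rewrite derive_cst.
move=> f0; elim: i => [|i IH]; last exact: D0.
by elim: j => [//|j IH]; exact: D0.
Qed.

Lemma L2norm_gt0 U f z : open U -> U z -> continuous f -> L2 U f -> f z != 0 -> 0 < L2norm U f.
Proof.
move=> oU Uz cf hf fz; rewrite sqrtr_gt0 /L2ip.
apply: (@Rintegral_gt0 _ U (fun z => f z * f z) z) => //.
- by move=> y; apply: cvgM; exact: cf.
- by move=> y; rewrite -expr2 sqr_ge0.
- exact: (L2_integrableM (open_measurable2 oU) hf hf).
- by rewrite -expr2 exprn_even_gt0.
Qed.

Lemma Cinf_L2 D (h : R) f : open D -> 0 < h ->
  (forall x y, D x -> D y -> `|x.1 - y.1| <= h /\ `|x.2 - y.2| <= h) -> Cinf f -> L2 D f.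
Proof.
move=> oD h0 hD cf; have mD := open_measurable2 oD.
have fD : (leb2 (D : set plane) < +oo)%E by exact: le_lt_trans (leb2_le_diam oD hD) (ltry _).
have mf : measurable_fun [set: plane] (f \_ D : plane -> mR).
  by apply: measurable_restrict2 => //; apply: continuous_measurable2; exact: Cinf_continuous.
have [D0|/set0P[c Dc]] := eqVneq D set0.
  by apply: (L2_bounded (M := 0) mD fD mf) => z; rewrite D0.
have [B [_ hB]] := continuous_box_bounded (`|c.1| + `|c.2| + h) (Cinf_continuous cf).
apply: (L2_bounded (M := B) mD fD mf) => z Dz; have [z1 z2] := hD _ _ Dz Dc.
apply: hB.
  have := ler_normD c.1 (z.1 - c.1); rewrite addrC subrK; have := normr_ge0 c.2; lra.
have := ler_normD c.2 (z.2 - c.2); rewrite addrC subrK; have := normr_ge0 c.1; lra.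
Qed.

Definition unit_square : set (R * R) := `](- 2^-1), 2^-1[%classic `*` `](- 2^-1), 2^-1[%classic.

Lemma open_unit_square : open unit_square.
Proof.
have -> : unit_square = ((fst : R * R -> R) @^-1` `](- 2^-1), 2^-1[%classic) `&`
    ((snd : R * R -> R) @^-1` `](- 2^-1), 2^-1[%classic) by [].
apply: openI.
  by apply: open_comp => [z _|]; [exact: cvg_fst|exact: itv_open].
by apply: open_comp => [z _|]; [exact: cvg_snd|exact: itv_open].
Qed.

Lemma unit_square_diam x y : unit_square x -> unit_square y ->
  `|x.1 - y.1| <= 1 /\ `|x.2 - y.2| <= 1.
Proof.
move=> [] /=; rewrite !in_itv /= => /andP[a b] /andP[c d] [] /=.
rewrite !in_itv /= => /andP[a' b'] /andP[c' d']; rewrite !ler_norml.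
by split; apply/andP; split; lra.
Qed.

Lemma Cinf_L2_unit_square f : Cinf f -> L2 unit_square f.
Proof. by apply: (Cinf_L2 open_unit_square ltr01); exact: unit_square_diam. Qed.

(* Gram-Schmidt, one monomial at a time, replaces the compactness of the unit sphere of the
   finite dimensional space of polynomials. *)
Lemma mon_span_bound s i j (M : R) : uniq s -> exists C : R, 0 <= C /\
  forall p, mon_span s p -> forall z, `|z.1| <= M -> `|z.2| <= M ->
    `|partial i j p z| <= C * L2norm unit_square p.
Proof.
have oU := open_unit_square; have cU := Cinf_L2_unit_square.
have mU := open_measurable2 oU.
elim: s => [_|[a b] s IH /= /andP[abs us]].
  by exists 0; split => // p -> z _ _; rewrite partial_cst0 normr0 mul0r.
have [C [C0 hC]] := IH us; have cm := @Cinf_mon R a b.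
have [e [se he]] := mon_span_proj oU cU s (cU _ cm).
pose d z := mon a b z - e z.
have ce := Cinf_mon_span se; have cd : Cinf d by exact: CinfB.
have Ld := cU _ cd.
(* If [d] vanished on the square, so would its derivative of order [(a, b)] at the origin, which
   equals [a! b!]. *)
have d0 : 0 < L2norm unit_square d.
  rewrite lt_neqAle L2norm_ge0 andbT eq_sym; apply/negP => /eqP d0.
  have U0 : unit_square (0, 0) by split; rewrite /= in_itv /=; apply/andP; split; lra.
  have dU z : unit_square z -> d z = 0.
    move=> Uz; apply/eqP/negP => /negP dz.
    by have := L2norm_gt0 oU Uz (Cinf_continuous cd) Ld dz; rewrite d0 ltxx.
  have := partial_eq0 a b oU dU U0.
  rewrite /d (partialB _ _ cm ce) (partial_mon_span0 se abs) subr0 partial_mon !subnn.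
  by rewrite !ffactnn /mon /= !expr0 !mulr1 => /eqP; rewrite pnatr_eq0 muln_eq0 !eqn0Ngt !fact_gt0.
have [B [B0 hB]] := continuous_box_bounded M (Cinf_continuous (Cinf_partial i j cd)).
exists (B / L2norm unit_square d + C); split; first by rewrite addr_ge0// divr_ge0// ltW.
move=> p [c [q [sq pE]]] z z1 z2.
(* This writes [p] as [c * d + q'] with orthogonal terms, so each term has norm at most that of
   [p]. *)
pose q' z := c * e z + q z.
have sq' : mon_span s q' by apply: mon_spanD => //; exact: mon_spanZ.
have cq' := Cinf_mon_span sq'; have Lq' := cU _ cq'.
have Lcd := L2Z c Ld.
have pE' : p = fun z => c * d z + q' z.
  by rewrite pE; apply/funext => y; rewrite /q' /d /=; ring.
have orth : L2ip unit_square (fun z => c * d z) q' = 0.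
  by rewrite (L2ipZl mU c Ld Lq') (he _ sq') mulr0.
have N1 : `|c| * L2norm unit_square d <= L2norm unit_square p.
  rewrite -(L2normZ mU c Ld) pE'; apply: ler_wsqrtr.
  by rewrite (L2ip_pythagoras mU Lcd Lq' orth) lerDl L2ip_ge0.
have N2 : L2norm unit_square q' <= L2norm unit_square p.
  rewrite pE'; apply: ler_wsqrtr.
  by rewrite (L2ip_pythagoras mU Lcd Lq' orth) lerDr L2ip_ge0.
rewrite [in leLHS]pE' (partialD _ _ (CinfZ c cd) cq') (partialZ _ _ _ cd).
apply: le_trans (ler_normD _ _) _; rewrite mulrDl; apply: lerD; last first.
  by apply: le_trans (hC _ sq' _ z1 z2) _; exact: ler_wpM2l.
rewrite normrM; apply: (@le_trans _ _ (`|c| * B)); first by rewrite ler_wpM2l// hB.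
rewrite (mulrC _ B) -mulrA ler_wpM2l//.
by rewrite mulrC ler_pdivlMr.
Qed.

(** The homothety sending [unit_square] onto the inscribed square of side [rho * h] pulls [D] back
    into the box of half-side [rho^-1]. There the derivatives of a polynomial are bounded pointwise
    by its norm on [unit_square]. *)
Lemma inverse_inequality k i j (rho : R) : 0 < rho -> exists C : R, 0 <= C /\
  forall D c (h : R) p, open D -> 0 < h ->
    (forall x y, D x -> D y -> `|x.1 - y.1| <= h /\ `|x.2 - y.2| <= h) -> D c ->
    (forall z, `|z.1 - c.1| <= rho * h / 2 -> `|z.2 - c.2| <= rho * h / 2 -> D z) ->
    polyfun k p -> L2norm D (partial i j p) <= C / h ^+ (i + j) * L2norm D p.
Proof.
move=> rho0; have [C [C0 hC]] := mon_span_bound i j rho^-1 (uniq_poly_index k).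
(* With [r = rho * h]: [r^-1] from the norm on the square, [r^-(i + j)] from the derivatives, and
   [2 * h] from the norm of 1 on [D]. *)
exists (C * 2 / rho ^+ (i + j).+1); split.
  by rewrite divr_ge0 ?exprn_ge0 ?mulr_ge0// ltW.
move=> D c h p oD h0 hD Dc sq pp.
have mD := open_measurable2 oD; have cD f := @Cinf_L2 D h f oD h0 hD.
pose r := rho * h; have r0 : 0 < r by rewrite mulr_gt0.
have rn0 : r != 0 by rewrite gt_eqF.
pose q := p \o homothety c r.
have cp := Cinf_polyfun pp; have Lp := cD _ cp.
have hq : mon_span (poly_index k) q by apply/mon_span_polyfun; exact: polyfun_homothety.
(* The scaled square lies in [D], the integrand [p * p] is nonnegative, and the Jacobian is
   [r^2]. *)
have nq : L2norm unit_square q <= r^-1 * L2norm D p.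
  rewrite -(gtr0_norm (x := r^-1)) ?invr_gt0// -sqrtr_sqr -sqrtrM ?sqr_ge0//.
  apply: ler_wsqrtr.
  have iF : leb2.-integrable [set: plane] (EFin \o ((fun z => p z * p z) \_ D)).
    by move: (L2_integrableM mD Lp Lp) => /(integrable_mkcond _ mD); rewrite restrict_EFin.
  have iG := integrable_homothety c rn0 iF.
  have E : L2ip D p p = r ^+ 2 * Rintegral leb2 setT (((fun z => p z * p z) \_ D) \o homothety c r).
    rewrite -(Rintegral_homothety c rn0 iF) /L2ip; exact: Rintegral_mkcond.
  rewrite E exprVn mulKf ?expf_neq0//.
  have Lq := Cinf_L2_unit_square (Cinf_mon_span hq).
  have mU := open_measurable2 open_unit_square.
  rewrite /L2ip Rintegral_mkcond; apply: le_Rintegral => //.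
    by move: (L2_integrableM mU Lq Lq) => /(integrable_mkcond _ mU); rewrite restrict_EFin.
  move=> y _; rewrite /= !patchE.
  have pos z : 0 <= p z * p z by rewrite -expr2 sqr_ge0.
  case: ifPn => [|_]; last by case: ifP.
  rewrite inE => -[/=]; rewrite !in_itv /= => /andP[a b] /andP[a' b'].
  rewrite ifT// inE; apply: sq.
    rewrite /homothety /= addrAC subrr add0r -/r normrM (gtr0_norm r0) ler_wpM2l ?ltW//.
    by rewrite ltr_norml a.
  rewrite /homothety /= addrAC subrr add0r -/r normrM (gtr0_norm r0) ler_wpM2l ?ltW//.
  by rewrite ltr_norml a'.
have bnd z : D z -> `|partial i j p z| <= C * (r^-1 * L2norm D p) / r ^+ (i + j).
  move=> Dz; have [z1 z2] := hD _ _ Dz Dc.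
  pose y : R * R := ((z.1 - c.1) / r, (z.2 - c.2) / r).
  have yz : homothety c r y = z.
    have e (s t : R) : s + r * ((t - s) / r) = t by rewrite mulrC divfK// addrC subrK.
    by rewrite /homothety /y /= !e -surjective_pairing.
  have rV : `|r^-1| = (rho * h)^-1 by rewrite ger0_norm// invr_ge0 ltW.
  have hr : h / r = rho^-1 by rewrite /r; field; rewrite !gt_eqF.
  have y1 : `|y.1| <= rho^-1 by rewrite -hr normrM rV ler_wpM2r// invr_ge0 ltW.
  have y2 : `|y.2| <= rho^-1 by rewrite -hr normrM rV ler_wpM2r// invr_ge0 ltW.
  have := hC _ hq y y1 y2; rewrite /q (partial_homothety _ _ _ _ cp) yz normrM.
  rewrite ger0_norm ?exprn_ge0 ?(ltW r0)// => H.
  rewrite ler_pdivlMr ?exprn_gt0// mulrC; apply: le_trans H _.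
  by rewrite ler_wpM2l.
set K := C * _ / _ in bnd; have K0 : 0 <= K.
  by rewrite /K divr_ge0 ?exprn_ge0 ?(ltW r0)// mulr_ge0// mulr_ge0 ?L2norm_ge0// invr_ge0 ltW.
have L1 : L2 D (fun=> 1) by apply: cD; exact: Cinf_cst.
have : L2norm D (partial i j p) <= L2norm D (fun=> K * 1).
  apply: (L2norm_le mD); [exact: cD (Cinf_partial i j cp)|exact: (L2Z K L1)|].
  by move=> z Dz; rewrite mulr1 (ger0_norm K0); exact: bnd.
move/le_trans; apply; rewrite (L2normZ mD K L1) (ger0_norm K0).
have := ler_wpM2l K0 (L2norm_1_le oD h0 hD); move/le_trans; apply.
rewrite /K /r exprMn exprS le_eqVlt; apply/orP; left; apply/eqP.
move: (L2norm D p) => N; move: (rho ^+ _) (h ^+ _) (exprn_gt0 (i + j) rho0) (exprn_gt0 (i + j) h0) => A B A0 B0.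
by field; rewrite !gt_eqF.
Qed.

Lemma poly_top n (m : nat -> nat -> R) : exists t, polyfun n t /\
  forall i j, (i + j)%N = n -> partial i j t = fun=> m i j.
Proof.
pose F a := fun z => (m a (n - a)%N / (a`! * (n - a)`!)%:R) * mon a (n - a) z.
(* Truncated subtraction would raise the degree for indices beyond [n]; [minn] prevents this for
   every index, as [polyfun_sum] requires, and is the identity on the range summed. *)
exists (fun z => \sum_(a <- iota 0 n.+1) F (minn a n) z); split.
  by apply: polyfun_sum => a; apply: polyfunZ; apply: polyfun_mon; rewrite subnKC// geq_minr.
move=> i j ijn; have iN : (i < n.+1)%N by rewrite ltnS -ijn leq_addr.
rewrite partial_sum; last by move=> a; apply: CinfZ; exact: Cinf_mon.
apply/funext => z; rewrite (bigD1_seq i) ?mem_iota ?iota_uniq//.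
have e a : partial i j (F a) = fun z => m a (n - a)%N / (a`! * (n - a)`!)%:R *
    ((a ^_ i * (n - a) ^_ j)%:R * mon (a - i) (n - a - j) z).
  by rewrite /F (partialZ _ _ _ (@Cinf_mon R _ _)) partial_mon.
rewrite big_seq_cond big1; last first.
  move=> a /andP[]; rewrite mem_iota add0n ltnS => /= aN ai; rewrite (minn_idPl aN) e.
  have [lt|] := ltnP a i; first by rewrite ffact_small// !mul0r mulr0.
  rewrite leq_eqVlt eq_sym (negbTE ai) /= => lt.
  rewrite (@ffact_small (n - a) j) ?muln0 ?mul0r ?mulr0//.
  by rewrite -(ltn_add2l a) subnKC// -ijn ltn_add2r.
have nij : (n - i)%N = j by rewrite -ijn addKn.
have fn0 : (i`! * j`!)%:R != 0 :> R by rewrite pnatr_eq0 muln_eq0 !eqn0Ngt !fact_gt0.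
have -> : minn i n = i by apply/minn_idPl; rewrite -ltnS.
rewrite [LHS]addr0 e nij !subnn !ffactnn /mon !expr0.
by move: (_%:R) fn0 (m i j) => x x0 y; rewrite !mulr1 divfK.
Qed.

(** The system is triangular in the order of the derivative: a part of degree [n.+1] fixes the top
    derivatives, which are constants, and a polynomial of degree [n], invisible to them, corrects
    the lower moments. *)
Lemma poly_moments D theta n (m : nat -> nat -> R) : measurable (D : set plane) ->
  (forall f, Cinf f -> L2 D f) -> L2 D theta -> L2ip D (fun=> 1) theta = 1 ->
  exists q, polyfun n q /\ forall i j, (i + j <= n)%N -> L2ip D (partial i j q) theta = m i j.
Proof.
move=> mD cD Lt t1.
have cst (a : R) : L2ip D (fun=> a) theta = a.
  have L1 : L2 D (fun=> 1) by apply: cD; exact: Cinf_cst.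
  by have := L2ipZl mD a L1 Lt; rewrite t1 !mulr1.
elim: n m => [|n IH] m.
  have [t [pt ht]] := poly_top 0 m; exists t; split => // i j.
  by rewrite leqn0 => /eqP ij; rewrite ht.
have [t [pt ht]] := poly_top n.+1 m; have ct := Cinf_polyfun pt.
have [q [pq hq]] := IH (fun i j => m i j - L2ip D (partial i j t) theta).
have cq := Cinf_polyfun pq.
exists (fun z => q z + t z); split; first by apply: polyfunD => //; apply: polyfun_le pq; exact: leqnSn.
move=> i j; rewrite leq_eqVlt => /predU1P[ij|]; rewrite (partialD _ _ cq ct).
  by rewrite (partial_high pq) ?ij// ht//; under [X in L2ip D X]funext do rewrite add0r; exact: cst.
rewrite ltnS => ij.
by rewrite (L2ipDl mD (cD _ (Cinf_partial i j cq)) (cD _ (Cinf_partial i j ct)) Lt) hq// subrK.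
Qed.

Lemma weak_partial_ofB D i j u v gu gv : measurable (D : set plane) -> L2 D u -> L2 D v ->
  weak_partial_of D i j u gu -> weak_partial_of D i j v gv ->
  weak_partial_of D i j (fun z => u z - v z) (fun z => gu z - gv z).
Proof.
move=> mD hu hv [Lu wu] [Lv wv]; split; first exact: L2B.
move=> phi tphi; have Lp := testfn_L2 mD tphi; have Lp' := testfn_L2 mD (testfn_partial i j tphi).
by rewrite (L2ipBl mD hu hv Lp') (L2ipBl mD Lu Lv Lp) wu// wv// mulrBr.
Qed.

(** Testing order [(i, j)] against [D1 phi] shows that the weak derivatives of [u] are weak
    gradients of one another, as [weak_grad] requires. *)
Lemma weak_partial_D1 D i j u g g1 : weak_partial_of D i j u g -> weak_partial_of D i.+1 j u g1 ->
  forall phi, test_function D phi -> L2ip D g (D1 phi) = - L2ip D g1 phi.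
Proof.
move=> [_ w] [_ w1] phi tphi; have sgn0 : (-1) ^+ (i + j) != 0 :> R by rewrite signr_eq0.
have := w _ (testfn_D1 tphi).
rewrite (partial_D1 _ _ (testfn_Cinf tphi)) (w1 _ tphi) addSn exprS mulN1r mulNr -mulrN.
by move=> /(mulfI (sgn0)) <-.
Qed.

Lemma weak_partial_D2 D i j u g g2 : weak_partial_of D i j u g -> weak_partial_of D i j.+1 u g2 ->
  forall phi, test_function D phi -> L2ip D g (D2 phi) = - L2ip D g2 phi.
Proof.
move=> [_ w] [_ w1] phi tphi; have sgn0 : (-1) ^+ (i + j) != 0 :> R by rewrite signr_eq0.
have := w _ (testfn_D2 tphi).
rewrite (partial_D2 _ _ _) (w1 _ tphi) addnS exprS mulN1r mulNr -mulrN.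
by move=> /(mulfI (sgn0)) <-.
Qed.

Lemma L2norm_weak_partial_le D m u i j : (i + j)%N = m ->
  L2norm D (weak_partial D i j u) <= Sobolev_seminorm m D u.
Proof.
move=> <-; apply: ler_wsqrtr; have im : (i < (i + j).+1)%N by rewrite ltnS leq_addr.
rewrite (bigD1 (Ordinal im))//= addKn lerDl; apply: sumr_ge0 => a _; exact: L2ip_ge0.
Qed.

(** There are [m.+1] derivatives of order [m]; the factor [m.+1] is a crude bound for its own square
    root. *)
Lemma Sobolev_seminorm_le D m u (b : R) : 0 <= b ->
  (forall i j, (i + j)%N = m -> L2norm D (weak_partial D i j u) <= b) ->
  Sobolev_seminorm m D u <= m.+1%:R * b.
Proof.
move=> b0 hb; have mb : 0 <= m.+1%:R * b by rewrite mulr_ge0.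
rewrite -(ger0_norm mb) -sqrtr_sqr; apply: ler_wsqrtr.
apply: (@le_trans _ _ (\sum_(i < m.+1) b ^+ 2)).
  apply: ler_sum => i _; rewrite -sqr_L2norm ler_sqr ?nnegrE ?L2norm_ge0//.
  by apply: hb; rewrite subnKC// -ltnS.
rewrite sumr_const card_ord -[leLHS]mulr_natl exprMn ler_wpM2r ?sqr_ge0//.
by rewrite -natrX ler_nat leq_pmulr.
Qed.

(** Here [d] counts the orders missing to reach [l.+1]. At [d = 0] the derivative of [q] vanishes
    and the seminorm remains; each further use of Poincare's inequality costs [2 * K], because it
    involves two first derivatives. *)
Lemma averaged_approx D theta (K : R) l xi : open D -> (forall f, Cinf f -> L2 D f) ->
  test_function D theta -> L2ip D (fun=> 1) theta = 1 -> 0 <= K ->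
  (forall w w1 w2, weak_grad D w w1 w2 -> L2ip D w theta = 0 ->
    L2norm D w <= K * (L2norm D w1 + L2norm D w2)) ->
  Sobolev l.+1 D xi ->
  exists q, polyfun l q /\ forall i j d, (i + j + d)%N = l.+1 -> 
    weak_partial_of D i j xi (weak_partial D i j xi) /\
    L2norm D (fun z => weak_partial D i j xi z - partial i j q z)
      <= (2 * K) ^+ d * Sobolev_seminorm l.+1 D xi.
Proof.
move=> oD cD tt t1 K0 poinc [hxi hw]; have mD := open_measurable2 oD.
have Lt := testfn_L2 mD tt.
have hg i j : (i + j <= l.+1)%N -> weak_partial_of D i j xi (weak_partial D i j xi).
  by move=> /hw; exact: xgetPex.
have [q [pq hq]] := poly_moments l (fun i j => L2ip D (weak_partial D i j xi) theta) mD cD Lt t1.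
have cq := Cinf_polyfun pq; have Lq i j := cD _ (Cinf_partial i j cq).
exists q; split => // i j d ijd; split; first by apply: hg; rewrite -ijd leq_addr.
elim: d i j ijd => [|d IH] i j ijd.
  rewrite addn0 in ijd; rewrite (partial_high pq) ?ijd// expr0 mul1r.
  rewrite (eq_L2norm (v := weak_partial D i j xi)); first exact: L2norm_weak_partial_le.
  by move=> z _; rewrite subr0.
have ij : (i + j <= l)%N by rewrite -ltnS -ijd addnS ltnS leq_addr.
have e1 : (i.+1 + j + d)%N = l.+1 by rewrite -ijd addSn addnS.
have e2 : (i + j.+1 + d)%N = l.+1 by rewrite -ijd !addnS.
have g0 := hg i j (leqW ij).
have g1 : weak_partial_of D i.+1 j xi (weak_partial D i.+1 j xi) by apply: hg; rewrite -e1 leq_addr.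
have g2 : weak_partial_of D i j.+1 xi (weak_partial D i j.+1 xi) by apply: hg; rewrite -e2 leq_addr.
have wg : weak_grad D (fun z => weak_partial D i j xi z - partial i j q z)
    (fun z => weak_partial D i.+1 j xi z - partial i.+1 j q z)
    (fun z => weak_partial D i j.+1 xi z - partial i j.+1 q z).
  have [L0 _] := g0; have [L1 _] := g1; have [L2' _] := g2.
  split; [exact: L2B|exact: L2B|exact: L2B| |] => phi tphi.
    have Lp := testfn_L2 mD tphi; have Lp' := testfn_L2 mD (testfn_D1 tphi).
    rewrite (L2ipBl mD L0 (Lq _ _) Lp') (L2ipBl mD L1 (Lq _ _) Lp).
    by rewrite (weak_partial_D1 g0 g1 tphi) (L2ip_D1 (Cinf_partial i j cq) tphi) opprB opprK addrC.
  have Lp := testfn_L2 mD tphi; have Lp' := testfn_L2 mD (testfn_D2 tphi).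
  rewrite (L2ipBl mD L0 (Lq _ _) Lp') (L2ipBl mD L2' (Lq _ _) Lp).
  rewrite (weak_partial_D2 g0 g2 tphi) (L2ip_D2 (Cinf_partial i j cq) tphi) opprB opprK addrC.
  by rewrite (D2_partial _ _ cq).
have m0 : L2ip D (fun z => weak_partial D i j xi z - partial i j q z) theta = 0.
  by rewrite (L2ipBl mD (proj1 g0) (Lq _ _) Lt) hq// subrr.
have := poinc _ _ _ wg m0; move/le_trans; apply.
rewrite exprS -!mulrA mulrCA ler_wpM2l// mulr2n mulrDl !mul1r.
by apply: lerD; exact: IH.
Qed.

End Approximation.

(** * Estimates for the projection on bounded star-shaped domains *)

Section ProjectionBound.
Context {R : realType}.
Local Notation mR := (measurableTypeR R).
Local Notation plane := (mR * mR)%type.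
Implicit Types (D : set (R * R)) (u v p q f g : R * R -> R) (c x y z : R * R).

Lemma coord_le_edist x y : `|x.1 - y.1| <= Defs.edist x y /\ `|x.2 - y.2| <= Defs.edist x y.
Proof. by rewrite -!sqrtr_sqr; split; apply: ler_wsqrtr; rewrite ?lerDl ?lerDr sqr_ge0. Qed.

Lemma edist_le_coord x y (b : R) : 0 <= b -> `|x.1 - y.1| <= b -> `|x.2 - y.2| <= b ->
  Defs.edist x y <= 2 * b.
Proof.
move=> b0; rewrite !ler_norml => /andP[h1 h2] /andP[h3 h4].
have b2 : 0 <= 2 * b by rewrite mulr_ge0.
rewrite -(ger0_norm b2) -sqrtr_sqr; apply: ler_wsqrtr; nra.
Qed.

Lemma edist_le_diameter D x y : bounded_set D -> D x -> D y -> Defs.edist x y <= diameter D.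
Proof.
move=> [M [_ /(_ (M + 1))]]; rewrite ltrDl => /(_ ltr01) hM Dx Dy.
have M0 : 0 <= M + 1 by exact: le_trans (normr_ge0 x) (hM _ Dx).
apply: ub_le_sup; last by exists (x, y).
exists (2 * (2 * (M + 1))) => _ [[a b] [/= Da Db] <-].
have B z : D z -> `|z.1| <= M + 1 /\ `|z.2| <= M + 1.
  by move=> Dz; have : `|z| <= M + 1 := hM _ Dz; rewrite prod_normE ge_max => /andP[].
have [a1 a2] := B _ Da; have [b1 b2] := B _ Db.
apply: edist_le_coord; first by rewrite mulr_ge0.
  by have := ler_normB a.1 b.1; lra.
by have := ler_normB a.2 b.2; lra.
Qed.

Lemma diameter_gt0 D : bounded_set D -> open D -> D !=set0 -> 0 < diameter D.
Proof.
move=> bD oD [z Dz]; have [q [/andP[q1 q2] /andP[q3 q4] qD]] := rat_box oD Dz.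
have Dy : D (ratr q.1.2, z.2).
  apply: qD; split; rewrite /= in_itv /=; apply/andP; split; [|exact: lexx|exact: ltW|exact: ltW].
  exact: ltW (lt_trans q1 q2).
have [h1 _] := coord_le_edist (ratr q.1.2, z.2) z.
apply: lt_le_trans (edist_le_diameter bD Dy Dz); apply: lt_le_trans h1.
by rewrite normr_gt0 subr_eq0 gt_eqF.
Qed.

Lemma square_sub_disc c (r : R) z : 0 < r -> `|z.1 - c.1| <= r / 2 -> `|z.2 - c.2| <= r / 2 ->
  disc c r z.
Proof.
move=> r0; rewrite !ler_norml => /andP[h1 h2] /andP[h3 h4].
rewrite /disc /= -(gtr0_norm r0) -sqrtr_sqr ltr_sqrt ?exprn_gt0//; nra.
Qed.

Lemma star_center D c (r : R) : 0 < r -> D !=set0 -> star_shaped D (disc c r) -> disc c r `<=` D.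
Proof.
move=> r0 [x Dx] st b hb; apply: (st x b Dx hb); exists 1.
  by rewrite /= in_itv /=; apply/andP; split; lra.
by rewrite subrr !mul0r !mul1r !add0r -surjective_pairing.
Qed.

Lemma L2norm_null D u v : measurable (D : set plane) -> L2 D u -> L2 D v ->
  L2norm D (fun z => u z - v z) = 0 -> L2norm D u <= L2norm D v.
Proof.
move=> mD hu hv uv; have := ler_L2normD mD (L2B hu hv) hv.
rewrite uv add0r (eq_L2norm (v := u))// => z _; exact: subrK.
Qed.

(** [weak_partial] is an arbitrary representative; uniqueness up to a null set lets an explicit weak
    derivative [g] bound its norm. *)
Lemma weak_partial_norm D i j u g : open D -> (leb2 (D : set plane) < +oo)%E ->
  weak_partial_of D i j u g -> L2norm D (weak_partial D i j u) <= L2norm D g.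
Proof.
move=> oD fD wg; have wp : weak_partial_of D i j u (weak_partial D i j u).
  exact: (xgetPex (cst 0) (ex_intro _ g wg)).
exact: L2norm_null (open_measurable2 oD) (proj1 wp) (proj1 wg) (weak_partial_unique oD fD wp wg).
Qed.

Lemma inverse_inequality2 k (rho : R) : 0 < rho -> exists C : R, 0 <= C /\
  forall i j, (i + j)%N = 2%N -> forall D c (h : R) p, open D -> 0 < h ->
    (forall x y, D x -> D y -> `|x.1 - y.1| <= h /\ `|x.2 - y.2| <= h) -> D c ->
    (forall z, `|z.1 - c.1| <= rho * h / 2 -> `|z.2 - c.2| <= rho * h / 2 -> D z) ->
    polyfun k p -> L2norm D (partial i j p) <= C / h ^+ 2 * L2norm D p.
Proof.
move=> rho0; have [C1 [C1p h1]] := inverse_inequality k 0 2 rho0.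
have [C2 [C2p h2]] := inverse_inequality k 1 1 rho0.
have [C3 [C3p h3]] := inverse_inequality k 2 0 rho0.
exists (C1 + C2 + C3); split; first by rewrite !addr_ge0.
move=> i j ij D c h p oD h0 hD Dc sq pp.
have mono (C C' : R) : C <= C' -> C / h ^+ 2 * L2norm D p <= C' / h ^+ 2 * L2norm D p.
  by move=> CC; rewrite ler_wpM2r ?L2norm_ge0// ler_wpM2r// invr_ge0 exprn_ge0// ltW.
have [i0|i0] := eqVneq i 0%N.
  have -> : i = 0%N by []. have -> : j = 2%N by rewrite -ij i0.
  by apply: le_trans (h1 D c h p oD h0 hD Dc sq pp) _; apply: mono; lra.
have [j0|j0] := eqVneq j 0%N.
  have -> : j = 0%N by []. have -> : i = 2%N by rewrite -ij j0 addn0.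
  by apply: le_trans (h3 D c h p oD h0 hD Dc sq pp) _; apply: mono; lra.
have [-> ->] : i = 1%N /\ j = 1%N by move: i j i0 j0 ij {mono} => [|[|i]] [|[|j]] //= _ _; rewrite ?addnS ?addSn.
by apply: le_trans (h2 D c h p oD h0 hD Dc sq pp) _; apply: mono; lra.
Qed.

Lemma projection_bound k (rho : R) : 0 < rho -> exists C : R, 0 <= C /\
  forall D c, open D -> D !=set0 -> bounded_set D -> star_shaped D (disc c (rho * diameter D)) ->
  forall l xi i j, (1 <= l <= k)%N -> (i + j)%N = 2%N -> Sobolev l.+1 D xi ->
  L2norm D (weak_partial D i j (fun z => xi z - L2proj k D xi z)) <=
    C * (diameter D ^+ (l - 1) * Sobolev_seminorm l.+1 D xi) /\
  (l = 1%N -> L2norm D (weak_partial D i j (L2proj k D xi)) <= C * Sobolev_seminorm 2 D xi).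
Proof.
move=> rho0; have [Ci [Ci0 hI]] := inverse_inequality2 k rho0.
have m0 := @bump_mass_gt0 R.
(* [h * P] is the constant [h * (1 + 2 * h * L2norm D theta)] of [poincare] for the mollifier of
   side [rho * h]. *)
pose P : R := 1 + 2 * (L2norm setT (@unit_bump R) / bump_mass) / rho.
have P1 : 1 <= P.
  by rewrite /P lerDl divr_ge0 ?(ltW rho0)// mulr_ge0// divr_ge0 ?L2norm_ge0 ?(ltW m0).
have P0 : 0 < P by exact: lt_le_trans ltr01 P1.
have T1 : 1 <= 2 * P by lra.
(* The 1 accounts for xi - q and [Ci] for the polynomial part. At most [l.+1] uses of Poincare's
   inequality occur, and [1 <= 2 * P] allows the exponent to be raised to [k.+1]. *)
exists ((1 + Ci) * (2 * P) ^+ k.+1); split.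
  by rewrite mulr_ge0 ?exprn_ge0 ?addr_ge0// mulr_ge0// ltW.
move=> D c oD D0 bD st l xi i j /andP[l1 lk] ij hS; have mD := open_measurable2 oD.
set h := diameter D in st *; have h0 : 0 < h by exact: diameter_gt0.
have hD x y : D x -> D y -> `|x.1 - y.1| <= h /\ `|x.2 - y.2| <= h.
  move=> Dx Dy; have [a b] := coord_le_edist x y; have le := edist_le_diameter bD Dx Dy.
  by split; apply: le_trans le.
have fD : (leb2 (D : set plane) < +oo)%E by exact: le_lt_trans (leb2_le_diam oD hD) (ltry _).
have cD f := @Cinf_L2 R D h f oD h0 hD.
have r0 : 0 < rho * h by rewrite mulr_gt0.
have BD := star_center r0 D0 st.
have sqB z : `|z.1 - c.1| <= rho * h / 2 -> `|z.2 - c.2| <= rho * h / 2 -> disc c (rho * h) z.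
  exact: square_sub_disc.
have sq z : `|z.1 - c.1| <= rho * h / 2 -> `|z.2 - c.2| <= rho * h / 2 -> D z.
  by move=> a b; apply: BD; exact: sqB.
have Dc : D c by apply: sq; rewrite subrr normr0 divr_ge0 // ltW.
pose theta := mollifier c (rho * h).
have tB : test_function (disc c (rho * h)) theta by exact: testfn_mollifier.
have tt : test_function D theta by exact: testfnW BD tB.
have t1 : Rintegral leb2 setT theta = 1 by exact: Rintegral_mollifier.
have hP0 : 0 <= h * P by rewrite mulr_ge0 // ltW.
have poinc w w1 w2 : weak_grad D w w1 w2 -> L2ip D w theta = 0 ->
    L2norm D w <= h * P * (L2norm D w1 + L2norm D w2).
  move=> ww w0; have := poincare oD h0 hD BD st tB (mollifier_ge0 c _) t1 ww w0.
  rewrite (L2norm_mollifier r0 tt) => /le_trans; apply; rewrite le_eqVlt; apply/orP; left; apply/eqP.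
  congr (_ * _ * _); rewrite /P; congr (1 + _).
  move: (L2norm _ _) => N; field; by rewrite !gt_eqF.
have t1D : L2ip D (fun=> 1) theta = 1.
  rewrite (L2ip_testfn _ tt) -[RHS]t1; apply: eq_Rintegral => z _; exact: mul1r.
have [q [pq hq]] := averaged_approx oD cD tt t1D hP0 poinc hS.
set S := Sobolev_seminorm l.+1 D xi in hq *; have S0 : 0 <= S by exact: sqrtr_ge0.
have Lxi : L2 D xi by case: hS.
have cq := Cinf_polyfun pq; have pqk := polyfun_le lk pq; have Lq := cD _ cq.
have [pp _] := L2projP oD cD k Lxi; have cp := Cinf_polyfun pp; have Lp := cD _ cp.
have eP d : (2 * (h * P)) ^+ d = (2 * P) ^+ d * h ^+ d by rewrite mulrCA exprMn mulrC.
have hl : h ^+ l.+1 = h ^+ 2 * h ^+ (l - 1).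
  by rewrite -exprD -[in LHS](subnK l1) addn1 add2n.
have N0 : L2norm D (fun z => xi z - q z) <= (2 * (h * P)) ^+ l.+1 * S.
  have [w00 b00] := hq 0%N 0%N l.+1 erefl; apply: le_trans b00.
  (* Even at order zero [weak_partial] is a chosen representative, equal to xi only almost
     everywhere. *)
  have wxi : weak_partial_of D 0 0 xi xi by split => // phi _; rewrite expr0 mul1r.
  have L00 := proj1 w00; apply: (L2norm_null mD); [exact: L2B|exact: L2B|].
  rewrite -(weak_partial_unique oD fD wxi w00); apply: eq_L2norm => z _.
  by rewrite /partial /= opprB addrA subrK.
have pq' := polyfunB pp pqk.
(* The inverse inequality costs [h^-2] while [N0] supplies [h^(l+1)], which leaves [h^(l-1)]. *)
have N1 : L2norm D (partial i j (fun z => L2proj k D xi z - q z)) <=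
    Ci * (2 * P) ^+ l.+1 * (h ^+ (l - 1) * S).
  apply: le_trans (hI i j ij D c h _ oD h0 hD Dc sq pq') _.
  apply: (@le_trans _ _ (Ci / h ^+ 2 * ((2 * (h * P)) ^+ l.+1 * S))).
    rewrite ler_wpM2l ?divr_ge0 ?exprn_ge0 ?(ltW h0)//.
    exact: le_trans (L2proj_dist oD cD Lxi pqk) N0.
  rewrite le_eqVlt; apply/orP; left; apply/eqP.
  rewrite eP hl.
  move: (h ^+ (l - 1)) ((2 * P) ^+ l.+1) => A B; field; by rewrite gt_eqF.
have Tle a b : (a <= b)%N -> (2 * P) ^+ a <= (2 * P) ^+ b by exact: ler_weXn2l.
have hS0 : 0 <= h ^+ (l - 1) * S by rewrite mulr_ge0// exprn_ge0// ltW.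
have N1' : L2norm D (partial i j (fun z => L2proj k D xi z - q z)) <=
    Ci * (2 * P) ^+ k.+1 * (h ^+ (l - 1) * S).
  by apply: le_trans N1 _; rewrite ler_wpM2r// ler_wpM2l// Tle.
have ijl : (i + j + (l - 1))%N = l.+1 by rewrite ij subn1 -[in RHS](prednK l1).
have [wij bij] := hq i j (l - 1)%N ijl.
have N2 : L2norm D (fun z => weak_partial D i j xi z - partial i j q z) <=
    (2 * P) ^+ k.+1 * (h ^+ (l - 1) * S).
  apply: le_trans bij _; rewrite eP -mulrA ler_wpM2r//.
  by apply: Tle; apply: leq_trans (leq_subr _ _) (leqW lk).
have Lg := proj1 wij.
have Lpij := cD _ (Cinf_partial i j cp); have Lqij := cD _ (Cinf_partial i j cq).
have Lpq := cD _ (Cinf_partial i j (CinfB cp cq)).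
have wp : weak_partial_of D i j (L2proj k D xi) (partial i j (L2proj k D xi)).
  exact: weak_partial_smooth.
split.
  have := weak_partial_norm oD fD (weak_partial_ofB mD Lxi Lp wij wp).
  move/le_trans; apply.
  have := ler_L2normB mD (L2B Lg Lqij) Lpq.
  rewrite (eq_L2norm (v := fun z => weak_partial D i j xi z - partial i j (L2proj k D xi) z)).
    by move/le_trans; apply; rewrite mulrDl mul1r mulrDl; exact: lerD.
  by move=> z _; rewrite (partialB _ _ cp cq); move: (weak_partial D i j xi z) => a; ring.
move=> l1E; have := weak_partial_norm oD fD wp; move/le_trans; apply.
have -> : partial i j (L2proj k D xi) = partial i j (fun z => L2proj k D xi z - q z).
  rewrite (partialB _ _ cp cq) (partial_high pq) ?ij ?l1E//.
  by apply/funext => z; rewrite subr0.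
apply: le_trans N1' _; rewrite /S l1E expr0 mul1r ler_wpM2r ?sqrtr_ge0//.
by rewrite ler_wpM2r ?lerDr// exprn_ge0// mulr_ge0// ltW.
Qed.

End ProjectionBound.

Theorem lemma2p12 (R : realType) (k : nat) (rho : R)
    (hk : (2 <= k)%N) (hrho0 : 0 < rho) (hrho1 : rho < 1) :
  exists C : R,
    forall (n : nat) (v : 'I_n -> R * R) (D : set (R * R)),
      polygon v D -> shape_regular rho v D ->
      (forall xi : R * R -> R, Sobolev 2 D xi ->
         Sobolev_seminorm 2 D (L2proj k D xi) <= C * Sobolev_seminorm 2 D xi)
      /\
      (forall l : nat, (1 <= l <= k)%N ->
         forall xi : R * R -> R, Sobolev l.+1 D xi ->
           Sobolev_seminorm 2 D (fun z => xi z - L2proj k D xi z)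
           <= C * diameter D ^+ (l - 1) * Sobolev_seminorm l.+1 D xi).
Proof.
(* The 3 is the factor [m.+1] of [Sobolev_seminorm_le] at [m = 2]. *)
have [C [C0 hC]] := projection_bound k hrho0; exists (3 * C) => n v D.
move=> [_ D0 oD _ [bD _]] [_ [c st]]; have h0 := diameter_gt0 bD oD D0.
split.
  move=> xi hxi; have k1 : (1 <= 1 <= k)%N by rewrite /= ltnW.
  rewrite -mulrA; apply: Sobolev_seminorm_le; first by rewrite mulr_ge0// sqrtr_ge0.
  move=> i j ij; have [_] := hC D c oD D0 bD st 1%N xi i j k1 ij hxi; exact.
move=> l lk xi hxi.
rewrite -!mulrA; apply: Sobolev_seminorm_le.
  by rewrite mulr_ge0// mulr_ge0 ?exprn_ge0 ?(ltW h0)// sqrtr_ge0.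
by move=> i j ij; have [] := hC D c oD D0 bD st l xi i j lk ij hxi.
Qed.
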